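(* Let $\Omega\subset M$ be open and let $\nu$ and $\nu_n$, $n\in\mathbb N$, be finite covector measures on $\Omega$. (i) Weak$^*$ and weak limits of $(\nu_n)$ are unique. (ii) If $(\nu_n)$ is bounded, i.e. $\sup_n|\nu_n|(\Omega)<\infty$, then it admits a weakly$^*$ convergent subsequence. (iii) Assume that $\nu_n\to\nu$ weakly$^*$. Then $\liminf_n|\nu_n|(U)\ge|\nu|(U)$ for all open subsets $U\subset\Omega$. If in addition $\limsup_n|\nu_n|(\Omega)\le|\nu|(\Omega)$, then $|\nu_n|\to|\nu|$ weakly as Radon measures on $\Omega$.
   Context: $M=(M,g)$ is a smooth, connected, oriented $m$-dimensional Riemannian manifold; $(\cdot,\cdot)$ and $|\cdot|$ denote the pointwise Riemannian inner product and norm. For a regularity class $\mathcal C$, $\Gamma_{\mathcal C}(\Omega;T\Omega)$ is the space of vector fields on $\Omega$ of class $\mathcal C$; $C_c$, $C_0$, $C_b$ denote continuous functions with compact support, vanishing at infinity, and bounded, respectively. A finite covector measure on $\Omega$ is a pair $\nu=(\mu,\sigma)$ of a finite (positive) Radon measure $\mu$ on $\Omega$ and a bounded Borel section $\sigma:\Omega\to T^*\Omega$. Put $\sigma^\nu=\sigma/|\sigma|$ where $\sigma\ne0$ and $\sigma^\nu=0$ elsewhere, and $|\nu|:=|\sigma|\mu$ (the total variation measure). Two pairs $\nu,\tilde\nu$ are identified if $|\nu|=|\tilde\nu|$ and $\sigma^\nu=\sigma^{\tilde\nu}$ $|\nu|$-a.e. One writes $\nu[X]=\int_\Omega\sigma^\nu(X)\,d|\nu|$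 for vector fields $X$ for which the integral makes sense. $\nu_n\to\nu$ weakly$^*$ means $\nu_n[X]\to\nu[X]$ for all $X\in\Gamma_{C_0}(\Omega;T\Omega)$; $\nu_n\to\nu$ weakly means $\nu_n[X]\to\nu[X]$ for all $X\in\Gamma_{C_b}(\Omega;T\Omega)$. Finite Radon measures $\mu_n$ converge weakly to $\mu$ if $\int\psi\,d\mu_n\to\int\psi\,d\mu$ for all $\psi\in C_b(\Omega)$. *)

(* Defs.v *)
From HB Require Import structures.
From mathcomp Require Import all_boot all_order all_algebra.
From mathcomp Require Import all_classical all_reals all_analysis.

Set Implicit Arguments.
Unset Strict Implicit.
Unset Printing Implicit Defensive.

Import Order.TTheory GRing.Theory Num.Theory.
Import numFieldNormedType.Exports.

Local Open Scope classical_set_scope.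
Local Open Scope ring_scope.

(** * Smooth maps between open subsets of normed spaces

  In finite dimension: [f] is C^(k+1) on the open set [A] iff it is
  differentiable there and all its directional derivatives are C^k. *)

Fixpoint Ck_on (R : realType) (V W : normedModType R) (k : nat)
    (A : set V) (f : V -> W) : Prop :=
  if k is k'.+1 then
    (forall x, A x -> differentiable f x) /\
    (forall v, Ck_on k' A (fun x => 'D_v f x))
  else forall x, A x -> {for x, continuous f}.

Definition smooth_on (R : realType) (V W : normedModType R)
    (A : set V) (f : V -> W) : Prop :=
  forall k, Ck_on k A f.

(** * Oriented smooth manifolds *)

(* [chart_inv] is only meaningful on the image of [chart_dom]. *)
Record chart (R : realType) (m : nat) (X : topologicalType) := Chart {
  chart_dom : set X;
  chart_map :> X -> 'rV[R]_m;
  chart_inv : 'rV[R]_m -> X;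
  chart_dom_open : open chart_dom;
  chart_img_open : open (chart_map @` chart_dom);
  chart_mapK : forall p, chart_dom p -> chart_inv (chart_map p) = p;
  chart_map_cts : forall p, chart_dom p -> {for p, continuous chart_map};
  chart_inv_cts : forall x, (chart_map @` chart_dom) x ->
    {for x, continuous chart_inv} }.

Definition transition (R : realType) (m : nat) (X : topologicalType)
    (c d : chart R m X) : 'rV[R]_m -> 'rV[R]_m :=
  d \o chart_inv c.

(* A connected, Hausdorff, second countable space with a smooth atlas all of
   whose transition maps preserve the orientation.  The carrier is pointed
   because the Borel measurable type of the library requires it; this only
   excludes the empty manifold. *)
Record oriented_manifold (R : realType) (m : nat) := OrientedManifold {
  carrier :> ptopologicalType;
  chart_index : Type;
  atlas : chart_index -> chart R m carrier;
  carrier_hausdorff : hausdorff_space carrier;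
  carrier_second_countable : @second_countable carrier;
  carrier_connected : connected [set: carrier];
  atlas_cover : forall p, exists i, chart_dom (atlas i) p;
  atlas_smooth : forall i j,
    smooth_on (atlas i @` (chart_dom (atlas i) `&` chart_dom (atlas j)))
      (transition (atlas i) (atlas j));
  atlas_oriented : forall i j p,
    chart_dom (atlas i) p -> chart_dom (atlas j) p ->
    0 < \det ('J (transition (atlas i) (atlas j)) (atlas i p)) }.

(** * Tangent spaces

  A tangent vector at [p] is the family of its components in the charts around
  [p], which transform by the differentials of the transition maps.  Components
  in charts that do not contain [p] are set to 0, so that equality of tangent
  vectors is Leibniz equality. *)

Definition tangent_pred (R : realType) (m : nat) (M : oriented_manifold R m)
    (p : M) : {pred (chart_index M -> 'rV[R]_m)} :=
  [pred v | `[< (forall i, ~ chart_dom (atlas i) p -> v i = 0) /\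
    (forall i j, chart_dom (atlas i) p -> chart_dom (atlas j) p ->
       v j = 'd (transition (atlas i) (atlas j)) (atlas i p) (v i)) >] ].

Section tangent_space.
Variables (R : realType) (m : nat) (M : oriented_manifold R m) (p : M).

Fact tangent_submod_closed : submod_closed (@tangent_pred R m M p).
Proof.
split=> [|a u v /asboolP[u0 uE] /asboolP[v0 vE]]; apply/asboolP; split.
- by [].
- by move=> i j _ _; rewrite /= linear0.
- by move=> i ip /=; rewrite !fctE u0// v0// scaler0 addr0.
- by move=> i j ip jp; rewrite !fctE (uE i j)// (vE i j)// linearP.
Qed.

HB.instance Definition _ :=
  GRing.isSubmodClosed.Build R (chart_index M -> 'rV[R]_m)
    (@tangent_pred R m M p) tangent_submod_closed.

Record tangent : Type := Tangent {
  component :> chart_index M -> 'rV[R]_m;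
  _ : component \in @tangent_pred R m M p }.

HB.instance Definition _ := [isSub for component].
HB.instance Definition _ := [Choice of tangent by <:].
HB.instance Definition _ := [SubChoice_isSubLmodule of tangent by <:].

End tangent_space.
Arguments tangent {R m} M p.

Definition vector_field (R : realType) (m : nat) (M : oriented_manifold R m) :=
  forall p : M, tangent M p.

Definition covector_field (R : realType) (m : nat)
    (M : oriented_manifold R m) :=
  forall p : M, {scalar tangent M p}.

(** * Riemannian metrics *)

(* [riem_smooth]: in each chart the metric is g_kl dx^k dx^l with smooth g_kl *)
Record riemannian_metric (R : realType) (m : nat)
    (M : oriented_manifold R m) := RiemannianMetric {
  riem : forall p : M, tangent M p -> tangent M p -> R;
  riem_linear : forall p (u : tangent M p), scalar (riem u);
  riem_sym : forall p (u v : tangent M p), riem u v = riem v u;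
  riem_pos : forall p (u : tangent M p), u != 0 -> 0 < riem u u;
  riem_smooth : forall i, exists G : 'rV[R]_m -> 'M[R]_m,
    smooth_on (atlas i @` chart_dom (atlas i)) G /\
    forall p, chart_dom (atlas i) p -> forall u v : tangent M p,
      riem u v = (u i *m G (atlas i p) *m (v i)^T) 0 0 }.

Definition tangent_norm (R : realType) (m : nat) (M : oriented_manifold R m)
    (g : riemannian_metric M) (p : M) (v : tangent M p) : R :=
  Num.sqrt (riem g v v).

Definition cotangent_norm (R : realType) (m : nat) (M : oriented_manifold R m)
    (g : riemannian_metric M) (p : M) (s : {scalar tangent M p}) : R :=
  sup [set `|s v| | v in [set v | tangent_norm g v <= 1]].

(** * Continuous vector fields and functions on an open set [Omega]

  Fields are total and only their values on [Omega] matter; as [Omega] is open,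
  continuity on [Omega] is continuity at each of its points. *)

Definition continuous_field (R : realType) (m : nat)
    (M : oriented_manifold R m) (Omega : set M) (X : vector_field M) : Prop :=
  forall i p, Omega p -> chart_dom (atlas i) p ->
    {for p, continuous (fun q : M => X q i)}.

Definition C0_field (R : realType) (m : nat) (M : oriented_manifold R m)
    (g : riemannian_metric M) (Omega : set M) (X : vector_field M) : Prop :=
  continuous_field Omega X /\
  forall e : R, 0 < e -> exists K : set M, [/\ compact K, K `<=` Omega &
    forall p, Omega p -> ~ K p -> tangent_norm g (X p) < e].

Definition Cb_field (R : realType) (m : nat) (M : oriented_manifold R m)
    (g : riemannian_metric M) (Omega : set M) (X : vector_field M) : Prop :=
  continuous_field Omega X /\
  exists C : R, forall p, Omega p -> tangent_norm g (X p) <= C.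

Definition Cb_function (R : realType) (X : topologicalType) (Omega : set X)
    (psi : X -> R) : Prop :=
  (forall p, Omega p -> {for p, continuous psi}) /\
  exists C : R, forall p, Omega p -> `|psi p| <= C.

(** * Radon measures *)

Definition borel (X : ptopologicalType) := g_sigma_algebraType (@open X).

(* A finite measure on [Omega] is encoded as a finite Borel measure on the
   ambient space that gives no mass to the complement of [Omega]. *)
Record finite_radon_measure (R : realType) (X : ptopologicalType)
    (Omega : set X) := FiniteRadonMeasure {
  radon_measure :> {finite_measure set (borel X) -> \bar R};
  radon_off : radon_measure (~` Omega) = 0%E;
  radon_inner_regular : forall A : set (borel X),
    measurable A -> A `<=` Omega ->
    radon_measure A = ereal_sup [set radon_measure K |
      K in [set K : set X | compact K /\ K `<=` A]] }.

(* [mu_ n] and [mu] are only assumed to be set functions, because [tot_var]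
   below is one. *)
Definition weak_cvg_measure (R : realType) (X : ptopologicalType)
    (Omega : set X) (mu_ : nat -> set (borel X) -> \bar R)
    (mu : set (borel X) -> \bar R) : Prop :=
  forall psi : X -> R, Cb_function Omega psi ->
    (fun n => fine (\int[mu_ n]_(p in Omega) (psi p)%:E)) @ \oo -->
      fine (\int[mu]_(p in Omega) (psi p)%:E).

(** * Finite covector measures *)

(* In each chart the section is s_k dx^k with Borel measurable s_k. *)
Definition borel_covector_field (R : realType) (m : nat)
    (M : oriented_manifold R m) (Omega : set M) (s : covector_field M) : Prop :=
  forall i, exists t : 'I_m -> borel M -> R,
    (forall k, measurable_fun
       (Omega `&` chart_dom (atlas i) : set (borel M)) (t k)) /\
    forall p, Omega p -> chart_dom (atlas i) p -> forall v : tangent M p,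
      s p v = \sum_(k < m) t k p * v i 0 k.

Record covector_measure (R : realType) (m : nat) (M : oriented_manifold R m)
    (g : riemannian_metric M) (Omega : set M) := CovectorMeasure {
  cm_measure : finite_radon_measure R Omega;
  cm_density : covector_field M;
  cm_borel : borel_covector_field Omega cm_density;
  cm_bounded : exists C : R,
    forall p, Omega p -> cotangent_norm g (cm_density p) <= C }.

Section covector_measure_theory.
Variables (R : realType) (m : nat) (M : oriented_manifold R m).
Variables (g : riemannian_metric M) (Omega : set M).
Implicit Types nu : covector_measure g Omega.

(* |nu| = |sigma| mu *)
Definition tot_var nu (A : set (borel M)) : \bar R :=
  \int[cm_measure nu]_(p in A `&` Omega)
    (cotangent_norm g (cm_density nu p))%:E.

(* sigma^nu; division by 0 is 0, so this vanishes where sigma does *)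
Definition polar nu (p : M) (v : tangent M p) : R :=
  cm_density nu p v / cotangent_norm g (cm_density nu p).

Definition pairing nu (X : vector_field M) : R :=
  fine (\int[tot_var nu]_(p in Omega) (polar nu (X p))%:E).

Definition cm_equiv nu nu' : Prop :=
  (forall A : set (borel M), measurable A -> A `<=` Omega ->
     tot_var nu A = tot_var nu' A) /\
  {ae tot_var nu, forall p : borel M, Omega p ->
     forall v : tangent M p, polar nu v = polar nu' v}.

Definition weak_star_cvg (nu_ : nat -> covector_measure g Omega) nu : Prop :=
  forall X, C0_field g Omega X ->
    (fun n => pairing (nu_ n) X) @ \oo --> pairing nu X.

Definition weak_cvg (nu_ : nat -> covector_measure g Omega) nu : Prop :=
  forall X, Cb_field g Omega X ->
    (fun n => pairing (nu_ n) X) @ \oo --> pairing nu X.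

End covector_measure_theory.

(* Main.v *)
From HB Require Import structures.
Require Import Defs.
From mathcomp Require Import all_boot all_order all_algebra.
From mathcomp Require Import all_classical all_reals all_analysis.
From mathcomp Require Import measurable_realfun ring lra.

Set Implicit Arguments.
Unset Strict Implicit.
Unset Printing Implicit Defensive.

Import Order.TTheory GRing.Theory Num.Theory.
Import numFieldNormedType.Exports.

Local Open Scope classical_set_scope.
Local Open Scope ring_scope.

(** The vector field that represents the polar part of a covector measure turns
    pairings into integrals of Riemannian inner products against the total
    variation.  Everything then rests on one fact, a monotone class theorem for
    vector fields ([field_class_bumps]): a property that is stable under linear
    combinations and bounded pointwise limits holds for all bounded Borel fields
    as soon as it holds for a countable family of continuous fields that vanish
    at infinity, namely coordinate fields of charts multiplied by bump functions.
    In particular the continuous fields vanishing at infinity are dense in L1 of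
    any finite measure ([C0_field_dense]).

    Uniqueness ([pairing_determines]).  Two covector measures with the same
    pairings against these fields have the same pairings against all bounded
    Borel fields.  Testing with the unit field of one of them on a Borel set
    compares the total variations, which therefore agree; testing once more
    gives equality in the Cauchy-Schwarz inequality, so the unit fields agree
    almost everywhere.

    Compactness ([weak_star_compactness]).  After extraction the total variations
    have a vague limit [mu] ([vague_compactness], which builds [mu] by
    Caratheodory's method from limit masses on a countable family of open sets),
    and the pairings converge on the bump fields by a diagonal argument.  The
    vague limit controls the pairings through the upper semicontinuity of the
    integral of [|X|], whose superlevel sets are compact ([Rint_limsup_le],
    [compact_superlevel]).  Hence the pairings converge on all continuous fields
    vanishing at infinity, to a functional that is 1-Lipschitz for the L1
    distance of [mu]; it extends to bounded Borel fields ([extend_functional]).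
    Applied to coordinate fields cut off to Borel sets it has Radon-Nikodym
    densities, which glue to a covector field of norm at most 1 almost everywhere
    ([functional_density]).

    Lower semicontinuity ([Rint_liminf]).  The integral of a nonnegative function
    [psi] against the total variation is nearly the pairing with [psi X], where
    [X] is a continuous field in the unit ball that is close to the unit field.
    The pairing passes to the limit and stays below the integral of [psi]
    against the total variations.  Open sets follow by exhaustion, and when no
    mass is lost the bound for [C + psi] and [C - psi] gives weak convergence. *)

(** * Bounded measurable functions and their integrals *)

Definition bounded_measurable d (T : measurableType d) (R : realType)
    (D : set T) (f : T -> R) :=
  measurable_fun D f /\ exists C : R, forall x, D x -> `|f x| <= C.

Section bounded_measurable_theory.
Context d (T : measurableType d) (R : realType).
Variables (D : set T) (mD : measurable D).
Implicit Types (f g : T -> R) (A : set T).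

Local Notation bm := (bounded_measurable D).

Lemma bounded_measurable_cst (c : R) : bm (fun=> c).
Proof. by split; [exact: measurable_cst|exists `|c|]. Qed.

Lemma bounded_measurableD f g : bm f -> bm g -> bm (fun x => f x + g x).
Proof.
move=> [mf [C Cf]] [mg [C' Cg]]; split; first exact: measurable_funD.
exists (C + C') => x Dx; rewrite (le_trans (ler_normD _ _))// lerD//.
  exact: Cf.
exact: Cg.
Qed.

Lemma bounded_measurableM f g : bm f -> bm g -> bm (fun x => f x * g x).
Proof.
move=> [mf [C Cf]] [mg [C' Cg]]; split; first exact: measurable_funM.
exists (C * C') => x Dx; rewrite normrM ler_pM//.
  exact: Cf.
exact: Cg.
Qed.

Lemma bounded_measurableZ (c : R) f : bm f -> bm (fun x => c * f x).
Proof. by apply: bounded_measurableM; exact: bounded_measurable_cst. Qed.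

Lemma bounded_measurableB f g : bm f -> bm g -> bm (fun x => f x - g x).
Proof.
move=> bf bg; have := bounded_measurableD bf (bounded_measurableZ (-1) bg).
by congr bm; apply/funext => x; rewrite mulN1r.
Qed.

Lemma bounded_measurable_norm f : bm f -> bm (fun x => `|f x|).
Proof.
move=> [mf [C Cf]]; split; first exact: measurableT_comp.
by exists C => x Dx; rewrite normr_id Cf.
Qed.

Lemma bounded_measurable_indic A : measurable A -> bm (\1_A : T -> R).
Proof.
move=> mA; split; first exact: measurable_indic.
by exists 1 => x _; rewrite indicE; case: (_ \in _); rewrite ?normr1 ?normr0.
Qed.

Lemma bounded_measurable_sum I (r : seq I) (F : I -> T -> R) :
  (forall i, bm (F i)) -> bm (fun x => \sum_(i <- r) F i x).
Proof.
move=> bF; elim: r => [|i r ih].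
  have := bounded_measurable_cst 0; congr bm.
  by apply/funext => x; rewrite big_nil.
have := bounded_measurableD (bF i) ih; congr bm.
by apply/funext => x; rewrite big_cons.
Qed.

Variable mu : {finite_measure set T -> \bar R}.

Lemma bounded_measurable_integrable f : bm f -> mu.-integrable D (EFin \o f).
Proof.
move=> [mf [C Cf]]; apply: measurable_bounded_integrable => //.
  by rewrite ltey_eq fin_num_measure.
exists C; split; first exact: num_real.
by move=> x Cx y Dy /=; rewrite (le_trans (Cf _ Dy))// ltW.
Qed.

Let bi := bounded_measurable_integrable.

Lemma RintD f g : bm f -> bm g ->
  \int[mu]_(x in D) (f x + g x) =
  \int[mu]_(x in D) f x + \int[mu]_(x in D) g x.
Proof. by move=> /bi ? /bi ?; exact: RintegralD. Qed.

Lemma RintB f g : bm f -> bm g ->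
  \int[mu]_(x in D) (f x - g x) =
  \int[mu]_(x in D) f x - \int[mu]_(x in D) g x.
Proof. by move=> /bi ? /bi ?; exact: RintegralB. Qed.

Lemma RintZ c f : bm f ->
  \int[mu]_(x in D) (c * f x) = c * \int[mu]_(x in D) f x.
Proof. by move=> /bi ?; exact: RintegralZl. Qed.

Lemma Rint_sum I (r : seq I) (F : I -> T -> R) : (forall i, bm (F i)) ->
  \int[mu]_(x in D) (\sum_(i <- r) F i x) =
  \sum_(i <- r) \int[mu]_(x in D) F i x.
Proof.
move=> bF; elim: r => [|i r ih].
  rewrite big_nil; under eq_Rintegral do rewrite big_nil.
  by rewrite Rintegral_cst// mul0r.
under eq_Rintegral do rewrite big_cons.
by rewrite RintD ?ih ?big_cons//; exact: bounded_measurable_sum.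
Qed.

Lemma le_Rint f g : bm f -> bm g -> (forall x, D x -> f x <= g x) ->
  \int[mu]_(x in D) f x <= \int[mu]_(x in D) g x.
Proof. by move=> /bi ? /bi ?; exact: le_Rintegral. Qed.

Lemma normr_Rint f : bm f ->
  `|\int[mu]_(x in D) f x| <= \int[mu]_(x in D) `|f x|.
Proof. by move=> /bi ?; exact: le_normr_Rintegral. Qed.

Lemma eq_Rint f g : (forall x, D x -> f x = g x) ->
  \int[mu]_(x in D) f x = \int[mu]_(x in D) g x.
Proof. by move=> fg; apply: eq_Rintegral => x /set_mem; exact: fg. Qed.

Lemma Rint_indic A : measurable A ->
  \int[mu]_(x in D) (\1_A x : R) = fine (mu (A `&` D)).
Proof. by move=> mA; rewrite /Rintegral integral_indic. Qed.

Lemma Rint_cvg (F : nat -> T -> R) f (C : R) :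
  (forall n, measurable_fun D (F n)) -> bm f ->
  (forall n x, D x -> `|F n x| <= C) ->
  (forall x, D x -> F n x @[n --> \oo] --> f x) ->
  \int[mu]_(x in D) F n x @[n --> \oo] --> \int[mu]_(x in D) f x.
Proof.
move=> mF bf FC Ff.
have /= := @dominated_cvg _ _ _ mu D mD (fun n x => (F n x)%:E) (EFin \o f)
  (cst C%:E).
rewrite /Rintegral => H; apply: fine_cvg.
rewrite fineK; last exact/integrable_fin_num/bi.
apply: H => //.
- by move=> n; exact/measurable_EFinP.
- by move=> x Dx; apply: cvg_EFin; [exact: nearW|exact: Ff].
- exact: (bounded_measurable_integrable (bounded_measurable_cst C)).
Qed.

End bounded_measurable_theory.

Lemma Rint_eq0_measure0 d (T : measurableType d) (R : realType)
    (D A : set T) (f : T -> R) (mu : {finite_measure set T -> \bar R}) :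
  measurable D -> bounded_measurable D f -> (forall x, D x -> 0 <= f x) ->
  \int[mu]_(x in D) f x <= 0 -> measurable A -> A `<=` D ->
  (forall x, A x -> f x != 0) -> mu A = 0%E.
Proof.
move=> mD bf f0 intf mA AD fA.
have I0 : \int[mu]_(x in D) f x = 0.
  by apply/le_anti; rewrite intf Rintegral_ge0.
have /ae_eq_integral_abs : measurable_fun D (EFin \o f).
  by apply/measurable_EFinP; exact: bf.1.
move=> /(_ mu mD)[+ _].
have -> : (\int[mu]_(x in D) `|(EFin \o f) x| = 0)%E.
  rewrite (eq_integral (EFin \o f)); last first.
    by move=> x /set_mem Dx /=; rewrite ger0_norm// f0.
  rewrite -[LHS]fineK; last exact/integrable_fin_num/bounded_measurable_integrable.
  by congr EFin.
move=> /(_ erefl)[Z [mZ Z0 fZ]]; apply/eqP; rewrite -measure_le0 -Z0.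
apply: le_measure; rewrite ?inE// => x Ax; apply: fZ => /= /(_ (AD _ Ax)) [fx].
by have := fA _ Ax; rewrite fx eqxx.
Qed.

(** * Approximation by staircases *)

(** The number of steps [1, ..., K] below [y] is the integer part of [y] (or
    [K] if that is smaller). *)
Lemma sum_steps (R : realDomainType) (K : nat) (y : R) : 0 <= y ->
  let s := \sum_(i < K) (i.+1%:R <= y)%R%:R in
  [/\ s <= K%:R, s <= y & y <= K%:R -> y <= s + 1].
Proof.
move=> y0 s; suff [sK sy sE] : [/\ s <= K%:R, s <= y & s = K%:R \/ y < s + 1].
  split=> // yK; case: sE => [->|/ltW//]; by rewrite (le_trans yK)// lerDl.
rewrite /s {s}; elim: K => [|K [sK sy sKy]].
  by rewrite big_ord0; split=> //; left.
rewrite big_ord_recr /=; have [Ky|yK] := leP K.+1%:R y.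
- case: sKy => [->|ys].
    by rewrite -natr1; split => //; [rewrite natr1|left].
  suff : y < K.+1%:R by rewrite ltNge Ky.
  by rewrite (lt_le_trans ys)// -natr1 lerD2r.
- rewrite addr0; split => //; first by rewrite (le_trans sK)// ler_nat.
  right; case: sKy => [->|//]; by rewrite natr1.
Qed.

(** A property of functions that is stable under linear combinations and
    uniform limits passes from indicators to bounded measurable functions:
    a function with values in [0, C] is within [1/l] of the staircase
    [\sum_i 1/l * \1_(f >= i/l)]. *)
Lemma bounded_measurable_ind d (T : measurableType d) (R : realType)
    (D : set T) (P : (T -> R) -> Prop) : measurable D ->
  (forall A, measurable A -> P (\1_A)) ->
  (forall a f g, bounded_measurable D f -> bounded_measurable D g ->
     P f -> P g -> P (fun x => a * f x + g x)) ->
  (forall f, bounded_measurable D f ->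
     (forall e : R, 0 < e -> exists g, [/\ bounded_measurable D g, P g &
        forall x, D x -> `|f x - g x| <= e]) -> P f) ->
  forall f, bounded_measurable D f -> P f.
Proof.
move=> mD P1 Plin Pcl f bf; apply: Pcl => // e e0.
have [mf [C0 C0f]] := bf; pose C : R := `|C0| + 1.
have b1 A mA := @bounded_measurable_indic _ T R D A mA.
have C_gt0 : 0 < C by rewrite ltr_wpDl.
have fC x : D x -> `|f x| <= C.
  by move=> /C0f /le_trans; apply; rewrite (le_trans (ler_norm _))// lerDl.
pose l := (Num.truncn e^-1).+1; pose K := (Num.truncn (2 * C * l%:R)).+1.
have l0 : 0 < l%:R :> R by [].
have le1 : l%:R^-1 <= e.
  by rewrite -[leRHS]invrK lef_pV2 ?posrE ?invr_gt0// ltW// truncnS_gt.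
pose A (i : nat) := D `&` [set x | i.+1%:R <= (f x + C) * l%:R].
have mA i : measurable (A i).
  suff : measurable_fun D (fun x => (f x + C) * l%:R).
    move=> /(_ mD _ (measurable_itv `[i.+1%:R, +oo[)); congr measurable.
    by rewrite /A; congr setI; apply/seteqP; split=> x /=; rewrite in_itv/= andbT.
  by apply: measurable_funM => //; apply: measurable_funD.
pose g k x := l%:R^-1 * (\sum_(i < k) \1_(A i) x) + - C * \1_D x.
have bS k : bounded_measurable D (fun x => \sum_(i < k) \1_(A i) x : R).
  by apply: bounded_measurable_sum => // i; exact: b1.
have bT : bounded_measurable D (fun x => - C * \1_D x : R).
  by apply: bounded_measurableZ; exact: b1.
have P0 : P (fun=> 0).
  have := Plin (-1) _ _ (b1 _ mD)
    (b1 _ mD) (P1 _ mD) (P1 _ mD).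
  by congr P; apply/funext => x; rewrite mulN1r addNr.
exists (g K); split.
- by apply: bounded_measurableD => //; exact: bounded_measurableZ.
- apply: (Plin _ _ _ (bS K)) => //.
    elim: K => [|K ih]; first by move: P0; congr P; apply/funext=> x; rewrite big_ord0.
    have := Plin 1 _ _ (b1 _ (mA K)) (bS K) (P1 _ (mA K)) ih.
    by congr P; apply/funext => x; rewrite mul1r big_ord_recr/= addrC.
  have := Plin (- C) _ _ (b1 _ mD)
    (bounded_measurable_cst D 0) (P1 _ mD) P0.
  by congr P; apply/funext => x; rewrite addr0.
- move=> x Dx; have := fC _ Dx; rewrite ler_norml => /andP[f1 f2].
  pose y := (f x + C) * l%:R.
  have y0 : 0 <= y by rewrite mulr_ge0// -lerBlDr sub0r.
  have yK : y <= K%:R.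
    by rewrite (le_trans _ (ltW (truncnS_gt _)))// ler_wpM2r// mulr_natl mulr2n lerD2r.
  have -> : g K x = l%:R^-1 * (\sum_(i < K) (i.+1%:R <= y)%R%:R) - C.
    rewrite /g indicE mem_set// mulr1; congr (_ * _ - _); apply: eq_bigr => i _.
    rewrite indicE; congr (_%:R); congr nat_of_bool.
    by apply/idP/idP => [/set_mem[]//|?]; apply/mem_set; split.
  have [_ s1 /(_ yK) s2] := sum_steps K y0.
  set s := \sum_(i < K) _ in s1 s2 *.
  rewrite (le_trans _ le1)// (_ : _ - _ = l%:R^-1 * (y - s)); last first.
    by rewrite /y mulrBr [_ * l%:R]mulrC mulKf ?gt_eqF//; ring.
  rewrite normrM gtr0_norm ?invr_gt0// -[leRHS]mulr1 ler_wpM2l ?invr_ge0//.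
  by rewrite ger0_norm ?subr_ge0// lerBlDr addrC.
Qed.

(** * Densities of dominated additive set functions *)

(** Domination by a finite measure turns finite additivity into countable
    additivity, since the measure of the tails of a disjoint union tends to 0;
    the density is then a Radon-Nikodym derivative. *)
Lemma dominated_additive_density d (T : measurableType d) (R : realType)
    (mu : {finite_measure set T -> \bar R}) (rho : set T -> R) (C : R) :
  (forall A B, measurable A -> measurable B -> A `&` B = set0 ->
     rho (A `|` B) = rho A + rho B) ->
  (forall A, measurable A -> `|rho A| <= C * fine (mu A)) ->
  exists h : T -> R, [/\ measurable_fun setT h,
    mu.-integrable setT (EFin \o h) &
    forall A, measurable A -> rho A = \int[mu]_(x in A) h x].
Proof.
move=> rhoD rhoC; pose nu A := (rho A)%:E.
have rho0 : rho set0 = 0.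
  apply/normr0_eq0/le_anti; rewrite normr_ge0 andbT.
  by rewrite (le_trans (rhoC _ measurable0))// measure0 mulr0.
have nu0 : nu set0 = 0%E by rewrite /nu rho0.
have nufin A : measurable A -> nu A \is a fin_num by [].
have nuS : semi_sigma_additive nu.
  move=> F mF tF mUF.
  have mS n : measurable (\big[setU/set0]_(i < n) F i) by exact: bigsetU_measurable.
  have sumE n : (\sum_(0 <= i < n) nu (F i) = nu (\big[setU/set0]_(i < n) F i))%E.
    elim: n => [|n ih]; first by rewrite big_nil big_ord0.
    rewrite big_nat_recr//= ih big_ord_recr/= /nu rhoD//; first exact: mS.
    rewrite setIC -subset0 => x [Fx]; rewrite -bigcup_mkord => -[k /= kn Fkx].
    have /trivIsetP/(_ k n Logic.I Logic.I (negbT (ltn_eqF kn))) := tF.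
    by move/seteqP => -[/(_ x) + _]; apply.
  have tailE n : rho (\bigcup_i F i) = rho (\big[setU/set0]_(i < n) F i) +
      rho (\bigcup_i F i `\` \big[setU/set0]_(i < n) F i).
    rewrite -rhoD//; last 2 first.
    - exact: measurableD.
    - by rewrite setDE setICA setICr setI0.
    by rewrite setDUK//; exact: bigsetU_bigcup.
  have mutail n : mu (\bigcup_i F i `\` \big[setU/set0]_(i < n) F i) =
      (mu (\bigcup_i F i) - \sum_(0 <= i < n) mu (F i))%E.
    rewrite measureD//; last by rewrite ltey_eq fin_num_measure.
    rewrite setIidr; last exact: bigsetU_bigcup.
    rewrite big_mkord.
    by rewrite measure_bigsetU.
  apply: cvg_EFin; first by apply: nearW => n; rewrite sumE.
  under eq_fun do rewrite /comp sumE/=.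
  apply/cvgrPdist_le => e e0.
  have C0 : 0 <= `|C| + 1 by rewrite addr_ge0.
  have muF : (\sum_(0 <= i < n) mu (F i))%E @[n --> \oo] --> mu (\bigcup_n F n).
    exact: measure_semi_sigma_additive.
  rewrite -(@fineK _ (mu (\bigcup_n F n))) ?fin_num_measure// in muF.
  move: muF => /fine_cvgP[_] /cvgrPdist_le /(_ (e / (`|C| + 1))).
  rewrite divr_gt0// ?ltr_wpDl// => /(_ isT); apply: filterS => n.
  rewrite (tailE n) addrAC subrr add0r /comp => H.
  apply: (le_trans (rhoC _ _)); first exact: measurableD.
  have := ler_wpM2l C0 H; rewrite mulrCA divff ?mulr1; last first.
    by rewrite gt_eqF// ltr_wpDl.
  apply: le_trans; rewrite mutail fineB ?fin_num_measure//; last first.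
    by apply/sum_fin_numP => i _ _; rewrite fin_num_measure.
  apply: (le_trans (ler_norm _)); rewrite normrM.
  by rewrite ler_wpM2r// lerDl.
pose c : {charge set T -> \bar R} :=
  HB.pack nu (isCharge.Build _ _ _ nu nu0 nufin nuS).
have cmu : c `<< mu.
  apply/null_content_dominatesP => A mA muA0.
  rewrite /= /nu; congr EFin; apply/normr0_eq0/le_anti; rewrite normr_ge0 andbT.
  by rewrite (le_trans (rhoC _ mA))// muA0 mulr0.
exists (fine \o Radon_Nikodym c mu); split.
- by apply: measurableT_comp => //; apply: (measurable_int mu); exact: Radon_Nikodym_integrable.
- apply: eq_integrable (Radon_Nikodym_integrable cmu) => // x _.
  by rewrite /= fineK//; exact: Radon_Nikodym_fin_num.
- move=> A mA; rewrite /Rintegral.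
  under eq_integral do rewrite /comp fineK ?Radon_Nikodym_fin_num//.
  by rewrite -Radon_Nikodym_integral.
Qed.

(** * Upper semicontinuity of integrals *)

(** Comparing [f] with the staircase of width [1/l] reduces the integrals of
    [f] to the measures of finitely many of its superlevel sets. *)
Lemma Rint_limsup_le d (T : measurableType d) (R : realType) (D : set T)
    (mD : measurable D) (mu_ : nat -> {finite_measure set T -> \bar R})
    (mu : {finite_measure set T -> \bar R}) (f : T -> R) (C : R) :
  bounded_measurable D f -> (forall x, D x -> 0 <= f x) ->
  (forall n, fine (mu_ n D) <= C) ->
  (forall t e : R, 0 < t -> 0 < e -> \forall n \near \oo,
     fine (mu_ n (D `&` [set x | t <= f x])) <=
     fine (mu (D `&` [set x | t <= f x])) + e) ->
  forall e : R, 0 < e -> \forall n \near \oo,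
    \int[mu_ n]_(x in D) f x <= \int[mu]_(x in D) f x + e.
Proof.
move=> bf f0 muC mu_le e e0.
have [mf [C0 C0f]] := bf.
have C_ge0 : 0 <= C by exact: le_trans (fine_ge0 _) (muC 0).
pose l := (Num.truncn (e / 2 / (C + 1))^-1).+1.
pose K := (Num.truncn (`|C0| * l%:R)).+1.
have l0 : 0 < l%:R :> R by [].
have C1 : 0 < C + 1 by rewrite ltr_wpDl.
have le1 : l%:R^-1 * C <= e / 2.
  have : l%:R^-1 <= e / 2 / (C + 1).
    by rewrite -[leRHS]invrK lef_pV2 ?posrE ?invr_gt0 ?divr_gt0// ltW// truncnS_gt.
  rewrite ler_pdivlMr//; apply: le_trans.
  by rewrite ler_wpM2l ?invr_ge0// lerDl.
pose A (i : nat) := D `&` [set x | i.+1%:R / l%:R <= f x].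
have mA i : measurable (A i).
  have := mf mD _ (measurable_itv `[i.+1%:R / l%:R, +oo[); congr measurable.
  by rewrite /A; congr setI; apply/seteqP; split=> x /=; rewrite in_itv/= andbT.
have b1 i : bounded_measurable D (\1_(A i) : T -> R).
  exact: bounded_measurable_indic.
pose s x := \sum_(i < K) \1_(A i) x : R.
have bs : bounded_measurable D s by exact: bounded_measurable_sum.
have sE x : D x -> s x = \sum_(i < K) (i.+1%:R <= f x * l%:R)%R%:R.
  move=> Dx; apply: eq_bigr => i _; rewrite indicE -ler_pdivrMr//.
  congr (_%:R); congr nat_of_bool.
  by apply/idP/idP => [/set_mem[]//|?]; apply/mem_set; split.
have fl0 x : D x -> 0 <= f x * l%:R by move=> Dx; rewrite mulr_ge0// f0.
have sf x : D x -> l%:R^-1 * s x <= f x.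
  move=> Dx; have [_ + _] := sum_steps K (fl0 _ Dx); rewrite -sE//.
  by rewrite [in X in _ -> X]mulrC -ler_pdivrMr.
have fs x : D x -> f x <= l%:R^-1 * s x + l%:R^-1.
  move=> Dx; have [_ _] := sum_steps K (fl0 _ Dx); rewrite -sE// => H.
  rewrite -[X in _ + X]mulr1 -mulrDr mulrC ler_pdivlMr//; apply: H.
  rewrite (le_trans _ (ltW (truncnS_gt _)))// ler_wpM2r//.
  by rewrite (le_trans (ler_norm _))// (le_trans (C0f _ Dx))// ler_norm.
have intS (m : {finite_measure set T -> \bar R}) :
    \int[m]_(x in D) (l%:R^-1 * s x) = l%:R^-1 * \sum_(i < K) fine (m (A i)).
  rewrite RintZ//; congr (_ * _); rewrite Rint_sum//; apply: eq_bigr => i _.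
  by rewrite Rint_indic// setIidl//; exact: subIsetl.
(* With this error for each level set, [K] of them scaled by [1/l] add [e / 2]. *)
have : \forall n \near \oo, forall i : 'I_K,
    fine (mu_ n (A i)) <= fine (mu (A i)) + e / 2 * l%:R / K%:R.
  apply: filter_forall => i; apply: mu_le; first by rewrite divr_gt0.
  by rewrite divr_gt0// mulr_gt0// divr_gt0.
apply: filterS => n H.
have b' : bounded_measurable D (fun x => l%:R^-1 * s x).
  exact: bounded_measurableZ.
apply: (@le_trans _ _ (\int[mu_ n]_(x in D) (l%:R^-1 * s x + l%:R^-1))).
  apply: le_Rint => //; apply: bounded_measurableD => //.
  exact: bounded_measurable_cst.
rewrite RintD//; last exact: bounded_measurable_cst.
rewrite Rintegral_cst// intS.
have step1 : l%:R^-1 * fine (mu_ n D) <= e / 2.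
  by rewrite (le_trans _ le1)// ler_wpM2l// invr_ge0.
have step2 : l%:R^-1 * \sum_(i < K) fine (mu_ n (A i)) <=
    l%:R^-1 * \sum_(i < K) fine (mu (A i)) + e / 2.
  rewrite (@le_trans _ _ (l%:R^-1 * \sum_(i < K) (fine (mu (A i)) + e / 2 * l%:R / K%:R)))//.
    by rewrite ler_wpM2l ?invr_ge0// ler_sum.
  rewrite big_split/= mulrDr lerD2l sumr_const card_ord -[_ *+ K]mulr_natr.
  by rewrite divfK ?pnatr_eq0// mulrC mulfK ?gt_eqF.
have step3 : l%:R^-1 * \sum_(i < K) fine (mu (A i)) <= \int[mu]_(x in D) f x.
  by rewrite -intS; exact: le_Rint.
lra.
Qed.

(** * Extraction of subsequences *)

(** A cluster point of a sequence in a product of segments, which exists by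
    Tychonoff's theorem, replaces the diagonal argument. *)
Lemma diagonal_subsequence (I : countType) (R : realType) (u : I -> nat -> R)
    (C : I -> R) : (forall i n, `|u i n| <= C i) ->
  exists phi : nat -> nat, {homo phi : a b / (a < b)%N} /\
    forall i, cvgn (u i \o phi).
Proof.
move=> uC.
pose v k n := if unpickle k is Some i then u i n else 0.
pose c k := if unpickle k is Some i then C i else 0.
have vc k n : `|v k n| <= c k.
  by rewrite /v /c; case: unpickle => [i|]; rewrite ?normr0.
pose Z : topologicalType := prod_topology (fun _ : nat => R).
pose K := [set f : Z | forall k, `[- c k, c k]%classic (f k)].
have cK : compact K.
  by apply: (@tychonoff nat (fun=> R) (fun k => `[- c k, c k]%classic)) => k; exact: segment_compact.
pose F := ((fun n : nat => (fun k => v k n) : Z) @ \oo).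
have FK : F K.
  by exists 0%N => // n _ k /=; rewrite in_itv/= -ler_norml.
have PF : ProperFilter F by exact: fmap_proper_filter.
have [z [_ Fz]] := cK F PF FK.
have zH (k j : nat) : nbhs (z : Z) [set w : Z | `|w j - z j| < k.+1%:R^-1].
  have zb : nbhs (z j) [set y | `|y - z j| < k.+1%:R^-1].
    apply: filterS (@nbhsx_ballx R R (z j) (k.+1%:R^-1) _); last by rewrite invr_gt0.
    by move=> y; rewrite /ball/= distrC.
  exact: (@proj_continuous nat (fun=> R) j z _ zb).
have cl N k : exists n, (N <= n)%N /\ forall j, (j <= k)%N -> `|v j n - z j| < k.+1%:R^-1.
  have zB : nbhs (z : Z) [set w : Z | forall j, (j <= k)%N -> `|w j - z j| < k.+1%:R^-1].
    have H (j : 'I_k.+1) := zH k j.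
    have := @filter_forall Z _ _ (nbhs (z : Z)) (nbhs_filter (z : Z)) H.
    apply: (@filterS Z (nbhs z) (nbhs_filter z)) => w Hw j jk.
    exact: (Hw (Ordinal (jk : (j < k.+1)%N))).
  have FN : F [set w : Z | exists2 n, (N <= n)%N & w = (fun k => v k n)].
    by exists N => // n /= Nn; exists n.
  have [w [[n Nn ->] H]] := Fz _ _ FN zB.
  by exists n.
pose f N k := sval (cid (cl N k)).
have fP N k : (N <= f N k)%N /\
    forall j, (j <= k)%N -> `|v j (f N k) - z j| < k.+1%:R^-1.
  by rewrite /f; case: cid.
pose phi := fix phi n := if n is m.+1 then f (phi m).+1 m.+1 else f 0%N 0%N.
exists phi; split.
  by apply: (homo_ltn ltn_trans) => n /=; exact: (fP _ _).1.
have phiP n j : (j <= n)%N -> `|v j (phi n) - z j| < n.+1%:R^-1.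
  by case: n => [|n] /=; exact: (fP _ _).2.
move=> i; apply/cvg_ex; exists (z (pickle i)).
apply/cvgrPdist_lt => e e0.
near=> n.
have -> : (u i \o phi) n = v (pickle i) (phi n) by rewrite /v pickleK.
rewrite distrC (lt_trans (phiP _ _ _))//; first by near: n; exact: nbhs_infty_ge.
by near: n; exact: (near_infty_natSinv_lt (PosNum e0)).
Unshelve. all: by end_near. Qed.

(** * Radon measures from limits on a countable family of open sets *)

(** The relatively compact open sets on which a limit of measures is prescribed:
    there are countably many of them, and every compact subset of [Omega] has
    arbitrarily small neighbourhoods of this form. *)
Definition finite_union (X : Type) (B : nat -> set X) (s : seq nat) : set X :=
  \big[setU/set0]_(n <- s) B n.

(** The last condition places closures, and not only members of the base, in a
    given open set: open sets are then exhausted by compact ones. *)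
Definition compact_base (X : topologicalType) (Omega : set X)
    (B : nat -> set X) : Prop :=
  [/\ forall n, open (B n), forall n, compact (closure (B n)),
      forall n, closure (B n) `<=` Omega &
      forall U p, open U -> U p -> Omega p ->
        exists n, B n p /\ closure (B n) `<=` U].

Section finite_union_theory.
Variables (X : ptopologicalType) (Omega : set X) (B : nat -> set X).
Hypothesis baseB : compact_base Omega B.
Local Notation V := (finite_union B).
Let Bo : forall n, open (B n) := let: And4 h _ _ _ := baseB in h.
Let Bc : forall n, compact (closure (B n)) := let: And4 _ h _ _ := baseB in h.
Let BO : forall n, closure (B n) `<=` Omega := let: And4 _ _ h _ := baseB in h.
Let Bb := let: And4 _ _ _ h := baseB in h.

Lemma finite_union_nil : V [::] = set0.
Proof. by rewrite /finite_union big_nil. Qed.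

Lemma finite_union_cat s t : V (s ++ t) = V s `|` V t.
Proof. by rewrite /finite_union big_cat. Qed.

Lemma finite_union_cons n s : V (n :: s) = B n `|` V s.
Proof. by rewrite /finite_union big_cons. Qed.

Lemma open_finite_union s : open (V s).
Proof.
elim: s => [|n s ih]; first by rewrite finite_union_nil; exact: open0.
by rewrite finite_union_cons; exact: openU.
Qed.

Lemma compact_finite_union s : compact (closure (V s)).
Proof.
elim: s => [|n s ih]; first by rewrite finite_union_nil closure0; exact: compact0.
by rewrite finite_union_cons closureU; exact: compactU.
Qed.

Lemma closure_finite_union_sub s U :
  (forall n, n \in s -> closure (B n) `<=` U) -> closure (V s) `<=` U.
Proof.
elim: s => [_|n s ih H]; first by rewrite finite_union_nil closure0.
rewrite finite_union_cons closureU => x [|].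
  by apply: H; rewrite mem_head.
by apply: ih => k ks; apply: H; rewrite inE ks orbT.
Qed.

Lemma closure_finite_unionO s : closure (V s) `<=` Omega.
Proof. by apply: closure_finite_union_sub => n _; exact: BO. Qed.

Lemma finite_union_subset s t : {subset s <= t} -> V s `<=` V t.
Proof.
move=> st x; rewrite /finite_union -!bigcup_seq => -[n /= ns Bnx].
by exists n => //=; exact: st.
Qed.

(** The members of the base with closure in a set of the cover are themselves an
    open cover. *)
Lemma compact_finite_union_cover (K : set X) (G : set (set X)) :
  compact K -> K `<=` Omega -> (forall U, G U -> open U) ->
  (forall x, K x -> exists2 U, G U & U x) ->
  exists s, K `<=` V s /\
    forall n, n \in s -> exists2 U, G U & closure (B n) `<=` U.
Proof.
move=> cK KO Go KG.
pose D := [set n | exists2 U, G U & closure (B n) `<=` U].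
have : cover_compact K by rewrite -compact_cover.
move=> /(_ nat D B)[n _|x Kx|D' D'D KD']; first exact: Bo.
  have [U GU Ux] := KG _ Kx.
  have [n [Bnx nU]] := Bb (Go _ GU) Ux (KO _ Kx).
  by exists n => //; exists U.
exists (finmap.enum_fset D'); split.
  by move=> x /KD'[n nD' Bnx]; rewrite /finite_union -bigcup_seq; exists n.
by move=> n nD'; have := D'D _ nD'; rewrite inE.
Qed.

Lemma compact_finite_union_sub (K U : set X) :
  compact K -> K `<=` Omega -> open U -> K `<=` U ->
  exists s, K `<=` V s /\ closure (V s) `<=` U.
Proof.
move=> cK KO oU KU.
have [| |s [Ks sU]] := @compact_finite_union_cover K [set U] cK KO.
- by move=> _ ->.
- by move=> x Kx; exists U => //; exact: KU.
exists s; split=> //; apply: closure_finite_union_sub => n /sU[_ ->]; exact.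
Qed.

End finite_union_theory.

Section limit_measure.
Variables (R : realType) (X : ptopologicalType) (Omega : set X).
Variable B : nat -> set X.
Hypotheses (hX : hausdorff_space X) (baseB : compact_base Omega B).
Local Notation V := (finite_union B).
Variables (alpha : seq nat -> R) (C : R).
Hypothesis alpha_ge0 : forall s, 0 <= alpha s.
Hypothesis alpha_le : forall s, alpha s <= C.
Hypothesis alpha_subadd : forall s t u, V s `<=` V t `|` V u ->
  alpha s <= alpha t + alpha u.
Hypothesis alpha_add : forall s t, V s `&` V t = set0 ->
  alpha s + alpha t <= alpha (s ++ t).

Lemma alpha_nil : alpha [::] = 0.
Proof.
apply/le_anti; rewrite alpha_ge0 andbT -(lerD2l (alpha [::])) addr0.
by apply: (alpha_add (s := [::])); rewrite finite_union_nil setI0.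
Qed.

Lemma alpha_mono s t : V s `<=` V t -> alpha s <= alpha t.
Proof.
move=> st; rewrite -[leRHS]addr0 -alpha_nil; apply: alpha_subadd.
by rewrite finite_union_nil setU0.
Qed.

(** Testing with closures, which are compact, makes the supremum countably
    subadditive although [alpha] is only finitely subadditive. *)
Definition open_content (U : set X) : R :=
  sup [set alpha s | s in [set s | closure (V s) `<=` U]].

Let has_sup_oc U : has_sup [set alpha s | s in [set s | closure (V s) `<=` U]].
Proof.
split; last by exists C => _ [s _ <-].
by exists (alpha [::]), [::] => //=; rewrite finite_union_nil closure0.
Qed.

Lemma open_content_ub s U : closure (V s) `<=` U -> alpha s <= open_content U.
Proof. by move=> sU; apply: sup_upper_bound => //; exists s. Qed.

Lemma open_content_lub U c : (forall s, closure (V s) `<=` U -> alpha s <= c) ->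
  open_content U <= c.
Proof.
move=> H; apply: ge_sup; first by case: (has_sup_oc U).
by move=> _ [s sU <-]; exact: H.
Qed.

Lemma open_content_approx U (e : R) : 0 < e ->
  exists s, closure (V s) `<=` U /\ open_content U - e < alpha s.
Proof.
by move=> e0; have [_ [s sU <-] ?] := sup_adherent e0 (has_sup_oc U); exists s.
Qed.

Lemma open_content_ge0 U : 0 <= open_content U.
Proof.
rewrite -alpha_nil; apply: open_content_ub.
by rewrite finite_union_nil closure0.
Qed.

Lemma open_content0 : open_content set0 = 0.
Proof.
apply/le_anti; rewrite open_content_ge0 andbT; apply: open_content_lub => s s0.
rewrite -alpha_nil; apply: alpha_mono => x Vx.
by have := s0 x (subset_closure Vx).
Qed.

Lemma open_contentU U W : open U -> open W ->
  open_content (U `|` W) <= open_content U + open_content W.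
Proof.
move=> oU oW; apply: open_content_lub => s sUW.
have [||t [st tP]] := compact_finite_union_cover baseB (G := [set U; W])
  (compact_finite_union baseB (s := s)) (closure_finite_unionO baseB (s := s)).
- by move=> _ [->|->].
- by move=> x /sUW[Ux|Wx]; [exists U; [left|]|exists W; [right|]].
pose p n := `[< closure (B n) `<=` U >].
rewrite (@le_trans _ _ (alpha [seq n <- t | p n] + alpha [seq n <- t | ~~ p n]))//.
  apply: alpha_subadd => x /subset_closure/st.
  rewrite /finite_union -!bigcup_seq => -[n /= nt Bnx].
  by have [pn|pn] := boolP (p n); [left|right]; exists n => //=;
    rewrite mem_filter pn.
apply: lerD; apply: open_content_ub; apply: closure_finite_union_sub => n;
  rewrite mem_filter => /andP[].
  by move=> /asboolP.
by move=> /asboolP pn /tP[_ [->|->]].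
Qed.

Lemma open_content_bigcup (U : nat -> set X) s : (forall n, open (U n)) ->
  closure (V s) `<=` \bigcup_n U n ->
  exists k, alpha s <= \sum_(n < k) open_content (U n).
Proof.
move=> oU sU.
have [||t [st tP]] := compact_finite_union_cover baseB (G := range U)
  (compact_finite_union baseB (s := s)) (closure_finite_unionO baseB (s := s)).
- by move=> _ [n _ <-].
- by move=> x /sU[n _ Unx]; exists (U n) => //; exists n.
have [k tk] : exists k, closure (V t) `<=` \big[setU/set0]_(n < k) U n.
  elim: t tP {st} => [_|n t ih tP].
    by exists 0%N; rewrite finite_union_nil closure0.
  have [|k kP] := ih; first by move=> j jt; apply: tP; rewrite inE jt orbT.
  have [|_ [i _ <-] ni] := tP n; first by rewrite mem_head.
  exists (maxn k i.+1); rewrite finite_union_cons closureU => x [/ni Uix|/kP].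
    by rewrite -bigcup_mkord; exists i => //=; rewrite leq_max ltnSn orbT.
  rewrite -!bigcup_mkord => -[j /= jk Ujx]; exists j => //=.
  by rewrite leq_max jk.
exists k; apply: (@le_trans _ _ (open_content (\big[setU/set0]_(n < k) U n))).
  rewrite (le_trans (alpha_mono (t := t) _))//.
    by move=> x /subset_closure/st.
  exact: open_content_ub.
elim: k {tk} => [|k ih]; first by rewrite !big_ord0 open_content0.
rewrite !big_ord_recr/= (le_trans (open_contentU _ _))//.
  by rewrite -bigcup_mkord; apply: bigcup_open.
by rewrite lerD2r.
Qed.

(** Only [A `&` Omega] is covered, which makes the complement of [Omega] null. *)
Definition outer_content (A : set X) : R :=
  inf [set open_content U | U in [set U | open U /\ A `&` Omega `<=` U]].

Let has_inf_oc A :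
  has_inf [set open_content U | U in [set U | open U /\ A `&` Omega `<=` U]].
Proof.
split; last by exists 0 => _ [U _ <-]; exact: open_content_ge0.
by exists (open_content setT), setT => //=; split => //; exact: openT.
Qed.

Lemma outer_content_lb A U : open U -> A `&` Omega `<=` U ->
  outer_content A <= open_content U.
Proof. by move=> oU AU; apply: inf_lbound; [case: (has_inf_oc A)|exists U]. Qed.

Lemma outer_content_glb A c :
  (forall U, open U -> A `&` Omega `<=` U -> c <= open_content U) ->
  c <= outer_content A.
Proof.
move=> H; apply: lb_le_inf; first by case: (has_inf_oc A).
by move=> _ [U [oU AU] <-]; exact: H.
Qed.

Lemma outer_content_approx A (e : R) : 0 < e ->
  exists U, [/\ open U, A `&` Omega `<=` U & open_content U < outer_content A + e].
Proof.
move=> e0; have [_ [U [oU AU] <-] ?] := inf_adherent e0 (has_inf_oc A).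
by exists U.
Qed.

Lemma outer_content_ge0 A : 0 <= outer_content A.
Proof. by apply: outer_content_glb => U _ _; exact: open_content_ge0. Qed.

Lemma outer_contentC : outer_content (~` Omega) = 0.
Proof.
apply/le_anti; rewrite outer_content_ge0 andbT -open_content0.
by apply: outer_content_lb; [exact: open0|rewrite setICl].
Qed.

Definition limit_outer (A : set X) : \bar R := (outer_content A)%:E.

Let outer0 : limit_outer set0 = 0%E.
Proof.
congr EFin; apply/le_anti; rewrite outer_content_ge0 andbT -open_content0.
by apply: outer_content_lb; [exact: open0|rewrite set0I].
Qed.

Let outer_ge0 A : (0 <= limit_outer A)%E.
Proof. by rewrite lee_fin outer_content_ge0. Qed.

Let outer_le : {homo limit_outer : A D / A `<=` D >-> (A <= D)%E}.
Proof.
move=> A D AD; rewrite lee_fin; apply: outer_content_glb => U oU DU.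
by apply: outer_content_lb => // x [/AD Dx Ox]; exact: DU.
Qed.

Let outer_sigma : sigma_subadditive limit_outer.
Proof.
move=> F; apply/lee_addgt0Pr => e e0.
apply: le_trans (epsilon_trick xpredT (fun n => outer_ge0 (F n)) (ltW e0)).
have H n : exists U, [/\ open U, F n `&` Omega `<=` U &
    open_content U < outer_content (F n) + e / (2 ^ n.+1)%:R].
  by apply: outer_content_approx; rewrite divr_gt0// ltr0n expn_gt0.
have [U /all_and3[oU FU UF]] := choice H.
set S := (X in (_ <= X)%E).
have US k : ((\sum_(n < k) open_content (U n))%:E <= S)%E.
  apply: le_trans (nneseries_lim_ge k _); last first.
    by move=> n _ _; rewrite -EFinD lee_fin (le_trans _ (ltW (UF n)))// open_content_ge0.
  rewrite big_mkord -sumEFin; apply: lee_sum => i _.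
  by rewrite -EFinD lee_fin ltW.
have [->|Sfin] := eqVneq S +oo%E; first by rewrite leey.
have S0 : (0 <= S)%E by have := US 0%N; rewrite big_ord0.
rewrite -(fineK (x := S)) ?ge0_fin_numE ?ltey// lee_fin.
apply: (@le_trans _ _ (open_content (\bigcup_n U n))).
  apply: outer_content_lb; first by apply: bigcup_open => n _.
  by move=> x [[n _ Fnx] Ox]; exists n => //; exact: FU.
apply: open_content_lub => s sU; have [k sk] := open_content_bigcup oU sU.
rewrite (le_trans sk)// -lee_fin fineK// ge0_fin_numE ?ltey//.
Qed.

HB.instance Definition _ := isOuterMeasure.Build R X limit_outer
  outer0 outer_ge0 outer_le outer_sigma.

(** Splitting a set [A] along an open set [O] loses nothing: exhaust [U `&` O]
    from inside by some [V s] for [U] an open neighbourhood of [A], and the rest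
    of [U] from inside by some [V t] disjoint from [V s]. *)
Lemma open_caratheodory (O : set X) : open O -> limit_outer.-caratheodory O.
Proof.
move=> oO; apply: le_caratheodory_measurable => A /=.
rewrite -EFinD lee_fin; apply: outer_content_glb => U oU AU.
apply/ler_addgt0Pr => e e0.
have [s [sUO se]] := open_content_approx (U `&` O) (divr_gt0 e0 (ltr0n _ 2)).
have oU' : open (U `&` ~` closure (V s)).
  by apply: openI => //; apply: closed_openC; exact: closed_closure.
have [t [tU te]] :=
  open_content_approx (U `&` ~` closure (V s)) (divr_gt0 e0 (ltr0n _ 2)).
have h1 : outer_content (A `&` O) <= open_content (U `&` O).
  apply: outer_content_lb; first exact: openI.
  by move=> x [[Ax Ox] OMx]; split => //; exact: AU.
have h2 : outer_content (A `&` ~` O) <= open_content (U `&` ~` closure (V s)).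
  apply: outer_content_lb => // x [[Ax nOx] OMx]; split; first exact: AU.
  by move=> /sUO[].
have h3 : alpha s + alpha t <= open_content U.
  apply: (le_trans (alpha_add (s := s) (t := t) _)).
    rewrite -subset0 => x [Vsx Vtx].
    by have [_] := tU _ (subset_closure Vtx); apply; exact: subset_closure.
  apply: open_content_ub; rewrite finite_union_cat closureU => x [/sUO[]//|/tU[]//].
lra.
Qed.

Lemma borel_caratheodory (A : set (borel X)) :
  measurable A -> limit_outer.-caratheodory A.
Proof.
apply: smallest_sub; last by move=> O oO; exact: open_caratheodory.
split.
- exact: caratheodory_measurable_set0.
- by move=> D mD; rewrite setTD; exact: caratheodory_measurable_setC.
- by move=> F mF; exact: caratheodory_measurable_bigcup.
Qed.

Definition limit_measure_fun (A : set (borel X)) : \bar R := limit_outer A.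

Let limit0 : limit_measure_fun set0 = 0%E. Proof. exact: outer0. Qed.

Let limit_ge0 A : (0 <= limit_measure_fun A)%E. Proof. exact: outer_ge0. Qed.

Let limit_sigma : semi_sigma_additive limit_measure_fun.
Proof.
move=> F mF tF mUF.
apply: (@caratheodory_measure_sigma_additive R X limit_outer F _ tF).
  by move=> n; exact: borel_caratheodory.
exact: borel_caratheodory.
Qed.

HB.instance Definition _ := isMeasure.Build _ _ _ limit_measure_fun
  limit0 limit_ge0 limit_sigma.

Let limit_fin : fin_num_fun limit_measure_fun. Proof. by []. Qed.

HB.instance Definition _ := Measure_isFinite.Build _ _ _ limit_measure_fun
  limit_fin.

Local Notation mu :=
  (limit_measure_fun : {finite_measure set (borel X) -> \bar R}).

Lemma limit_measure_compact K (e : R) : compact K -> K `<=` Omega -> 0 < e ->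
  exists s, K `<=` V s /\ alpha s <= outer_content K + e.
Proof.
move=> cK KO e0; have [U [oU KU Ue]] := outer_content_approx K e0.
have [|s [Ks sU]] := compact_finite_union_sub baseB cK KO oU.
  by move=> x Kx; apply: KU; split=> //; exact: KO.
by exists s; split=> //; rewrite (le_trans _ (ltW Ue))// open_content_ub.
Qed.

(** Exhaust [A] by its intersections with relatively compact open sets [W], and
    remove from the compact closure of [W] an open set that covers what is not
    in [A] up to a small error. *)
Let limit_inner_regular (A : set (borel X)) : measurable A -> A `<=` Omega ->
  mu A = ereal_sup [set mu K | K in [set K : set X | compact K /\ K `<=` A]].
Proof.
have borel_open (U : set X) : open U -> measurable (U : set (borel X)).
  exact: sub_sigma_algebra.
have borel_closed (F : set X) : closed F -> measurable (F : set (borel X)).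
  by move=> cF; rewrite -[F]setCK; apply: measurableC; apply: borel_open; exact: closed_openC.
move=> mA AO; apply/le_anti/andP; split; last first.
  apply: ge_ereal_sup => _ [K [cK KA] <-]; apply: le_measure => //; rewrite inE//.
  by apply: borel_closed; exact: compact_closed.
apply/lee_addgt0Pr => e e0; have e2 : 0 < e / 2 by rewrite divr_gt0.
pose W n := V (iota 0 n).
have mW n : measurable (W n : set (borel X)).
  by apply: borel_open; exact: (open_finite_union baseB).
have [n An] : exists n, (mu A <= mu (A `&` W n) + (e / 2)%:E)%E.
  have : mu (A `&` W n) @[n --> \oo] --> mu (\bigcup_n (A `&` W n)).
    apply: nondecreasing_cvg_mu.
    - by move=> n; exact: measurableI.
    - by apply: bigcup_measurable => n _; exact: measurableI.
    - move=> i j ij; apply/subsetPset; apply: setIS.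
      apply: finite_union_subset => k; rewrite !mem_iota/= !add0n => ki.
      exact: leq_trans ij.
  rewrite -setI_bigcupr setIidl; last first.
    move=> x /AO Ox; have [_ _ _ /(_ setT x openT Logic.I Ox)[n [Bnx _]]] := baseB.
    exists n.+1 => //; rewrite /W /finite_union -bigcup_seq; exists n => //.
    by have := mem_iota 0 n.+1 n; rewrite add0n ltnS leqnn.
  move=> H; have : mu (A `&` W n) @[n --> \oo] --> (outer_content A)%:E := H.
  move=> /fine_cvgP[_ /cvgrPdist_le/(_ _ e2)[N _ /(_ N (leqnn N))]] /= {}H.
  exists N; rewrite -EFinD lee_fin.
  by have := le_trans (ler_norm _) H; rewrite lerBlDl.
pose L := closure (W n).
have cL : compact L by exact: (compact_finite_union baseB).
have mL : measurable (L : set (borel X)).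
  by apply: borel_closed; exact: closed_closure.
have [U [oU LU Ue]] := outer_content_approx (L `\` A) e2.
have mU : measurable (U : set (borel X)) by exact: borel_open.
pose K := L `\` U.
have cK : compact K.
  apply: (subclosed_compact _ cL); last exact: subDsetl.
  by apply: closedI; [exact: closed_closure|exact: open_closedC].
have KA : K `<=` A.
  move=> x [Lx nUx]; apply: contrapT => nAx; apply: nUx; apply: LU; split=> //.
  exact: (closure_finite_unionO baseB Lx).
apply: (@le_trans _ _ (mu K + e%:E)%E); last first.
  by rewrite leeD2r//; apply: ereal_sup_ubound; exists K.
have mLA : measurable (L `&` A : set (borel X)) by exact: measurableI.
have mLDA : measurable (L `\` A : set (borel X)) by exact: measurableD.
have LE : (mu L = mu (L `&` A) + mu (L `\` A))%E.
  rewrite -measureU// ?setUIDK//.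
  by rewrite setDE setIACA setICr setI0.
have LE' : (mu L <= mu K + mu U)%E.
  apply: (@le_trans _ _ (mu (K `|` U))).
    apply: le_measure; rewrite ?inE//.
      by apply: measurableU => //; exact: measurableD.
    by move=> x Lx; have [Ux|nUx] := pselect (U x); [right|left].
  by apply: measureU2 => //; exact: measurableD.
have UE : (mu U <= mu (L `\` A) + (e / 2)%:E)%E.
  rewrite -EFinD lee_fin (le_trans _ (ltW Ue))// outer_content_lb//.
have AW : (mu (A `&` W n) <= mu (L `&` A))%E.
  apply: le_measure; rewrite ?inE//; first exact: measurableI.
  by move=> x [Ax Wx]; split => //; exact: subset_closure.
move: An LE LE' UE AW; rewrite /limit_measure_fun /limit_outer.
rewrite -!EFinD !lee_fin => + -[->]; lra.
Qed.

Definition limit_radon_measure : finite_radon_measure R Omega :=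
  @FiniteRadonMeasure R X Omega mu (congr1 EFin outer_contentC)
    limit_inner_regular.

End limit_measure.

(** ** Vague compactness *)

Lemma borel_open (X : ptopologicalType) (U : set X) :
  open U -> measurable (U : set (borel X)).
Proof. exact: sub_sigma_algebra. Qed.

Lemma borel_closed (X : ptopologicalType) (F : set X) :
  closed F -> measurable (F : set (borel X)).
Proof.
by move=> cF; rewrite -[F]setCK; apply: measurableC; apply: borel_open;
  exact: closed_openC.
Qed.

(** Along a subsequence, the masses of the countably many sets
    [finite_union B s] converge, and their limits build a Radon measure.  The
    conclusion is the upper half of vague convergence; a compact set has a
    neighbourhood [finite_union B s] of almost the same limit mass. *)
Lemma vague_compactness (R : realType) (X : ptopologicalType) (Omega : set X)
    (B : nat -> set X) (mu_ : nat -> {finite_measure set (borel X) -> \bar R})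
    (C : R) :
  hausdorff_space X -> open Omega -> compact_base Omega B ->
  (forall n, fine (mu_ n Omega) <= C) ->
  exists phi : nat -> nat, {homo phi : a b / (a < b)%N} /\
  exists mu : finite_radon_measure R Omega, forall K (e : R),
    compact K -> K `<=` Omega -> 0 < e -> \forall n \near \oo,
      fine (mu_ (phi n) K) <= fine (mu K) + e.
Proof.
move=> hX oO baseB muC; pose V := finite_union B.
have mV s : measurable (V s : set (borel X)).
  by apply: borel_open; exact: (open_finite_union baseB).
have VO s : V s `<=` Omega.
  by move=> x Vx; apply: (closure_finite_unionO baseB (s := s)); exact: subset_closure.
have mO : measurable (Omega : set (borel X)) by exact: borel_open.
have fle n (A D : set (borel X)) : measurable A -> measurable D -> A `<=` D ->
    fine (mu_ n A) <= fine (mu_ n D).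
  by move=> mA mD AD; rewrite fine_le ?fin_num_measure// le_measure ?inE.
pose u s n := fine (mu_ n (V s)).
have [s n|phi [phi_lt phi_cvg]] := @diagonal_subsequence (seq nat) R u (fun=> C).
  by rewrite ger0_norm ?fine_ge0// (le_trans _ (muC n))// fle.
exists phi; split=> //.
pose alpha s := limn (u s \o phi).
have alphaP s : (u s \o phi) @ \oo --> alpha s by exact: phi_cvg.
have alpha_ge0 s : 0 <= alpha s.
  by apply: limr_ge; [exact: phi_cvg|apply: nearW => n; exact: fine_ge0].
have alpha_le s : alpha s <= C.
  apply: limr_le; first exact: phi_cvg.
  by apply: nearW => n; rewrite (le_trans _ (muC (phi n)))// fle.
have alpha_subadd s t r : V s `<=` V t `|` V r -> alpha s <= alpha t + alpha r.
  move=> str; apply: (ler_cvg_to (alphaP s) (cvgD (alphaP t) (alphaP r))).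
  apply: nearW => n; suff : u s (phi n) <= u t (phi n) + u r (phi n) by [].
  rewrite /u -fineD ?fin_num_measure// fine_le ?fin_numD ?fin_num_measure//.
  by rewrite (le_trans _ (measureU2 _ _ _))// le_measure ?inE//; exact: measurableU.
have alpha_add s t : V s `&` V t = set0 -> alpha s + alpha t <= alpha (s ++ t).
  move=> st0; apply: (ler_cvg_to (cvgD (alphaP s) (alphaP t)) (alphaP _)).
  apply: nearW => n; suff : u s (phi n) + u t (phi n) <= u (s ++ t) (phi n) by [].
  rewrite /u -fineD ?fin_num_measure//.
  by rewrite /V finite_union_cat measureU.
exists (limit_radon_measure hX baseB alpha_ge0 alpha_le alpha_subadd alpha_add).
move=> K e cK KO e0; have e2 : 0 < e / 2 by rewrite divr_gt0.
have [s [Ks sK]] :=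
  limit_measure_compact baseB alpha_ge0 alpha_le alpha_add cK KO e2.
have /cvgrPdist_le/(_ _ e2) := alphaP s; apply: filterS => n /= H.
apply: (@le_trans _ _ (u s (phi n))).
  apply: fle => //; by apply: borel_closed; exact: compact_closed.
have := le_trans (ler_norm _) H; move: sK H.
rewrite /= /limit_measure_fun /limit_outer/=; rewrite distrC => ? /(le_trans (ler_norm _)).
lra.
Qed.

(** * Tangent vectors in charts *)

Lemma near_eq_diff (R : realType) (V W : normedModType R) (f g : V -> W)
    (x v : V) :
  differentiable f x -> differentiable g x -> (\near x, f x = g x) ->
  'd f x v = 'd g x v.
Proof.
move=> df dg fg; rewrite -!deriveE//.
have dgv : derivable g x v by exact: diff_derivable.
apply: cvg_lim => //; apply: cvg_trans dgv; apply: near_eq_cvg.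
have fgx := nbhs_singleton fg.
have c : (h *: v + x) @[h --> (0 : R)] --> x.
  rewrite -[X in _ --> X]add0r -[X in _ --> X + _](scale0r v).
  by apply: cvgD; [apply: cvgZl; exact: cvg_id|exact: cvg_cst].
have H : \forall h \near (0 : R), f (h *: v + x) = g (h *: v + x) by exact: c _ fg.
by apply: cvg_within; apply: filterS H => h /= ->; rewrite fgx.
Qed.

Lemma diff_comp_at (R : realType) (U V W : normedModType R) (f : U -> V)
    (g : V -> W) (x : U) (y : V) (v : U) :
  f x = y -> differentiable f x -> differentiable g y ->
  differentiable (g \o f) x /\ 'd (g \o f) x v = 'd g y ('d f x v).
Proof.
by move=> <- df dg; rewrite diff_comp//; split=> //; exact: differentiable_comp.
Qed.

Section charts.
Variables (R : realType) (m : nat) (M : oriented_manifold R m).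
Implicit Types (i j k : chart_index M) (p q : M) (w : 'rV[R]_m).
Local Notation U i := (chart_dom (atlas i)).
Local Notation Tr i j := (transition (@atlas _ _ M i) (atlas j)).
Local Notation dTr i j p := ('d (Tr i j) (atlas i p)).

Lemma transition_differentiable i j p : U i p -> U j p ->
  differentiable (Tr i j) (atlas i p).
Proof.
by move=> ip jp; have [+ _] := atlas_smooth i j 1; apply; exists p.
Qed.

Lemma transition_derive_continuous i j p w : U i p -> U j p ->
  {for atlas i p, continuous (fun x => 'D_w (Tr i j) x)}.
Proof.
by move=> ip jp; have [_ /(_ w)] := atlas_smooth i j 1; apply; exists p.
Qed.

Lemma nbhs_chart_inv i p (A : set M) : U i p -> open A -> A p ->
  \forall x \near atlas i p, A (chart_inv (atlas i) x).
Proof.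
move=> ip oA Ap; have /(_ A) : {for atlas i p, continuous (chart_inv (atlas i))}.
  by apply: chart_inv_cts; exists p.
by apply; apply: open_nbhs_nbhs; split => //; rewrite chart_mapK.
Qed.

Lemma nbhs_chart_img i p : U i p -> nbhs (atlas i p) (atlas i @` U i).
Proof.
move=> ip; apply: open_nbhs_nbhs; split; last by exists p.
exact: chart_img_open.
Qed.

(** The chain rule, since [Tr i k] agrees with [Tr j k \o Tr i j] near
    [atlas i p]. *)
Lemma diff_transition_comp i j k p w : U i p -> U j p -> U k p ->
  dTr j k p (dTr i j p w) = dTr i k p w.
Proof.
move=> ip jp kp.
have Tp : Tr i j (atlas i p) = atlas j p by rewrite /transition/= chart_mapK.
have dij := transition_differentiable ip jp.
have djk := transition_differentiable jp kp.
have [dc E] := diff_comp_at w Tp dij djk.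
refine (etrans (esym E) _).
refine (near_eq_diff _ dc (transition_differentiable ip kp) _).
have := nbhs_chart_inv ip (chart_dom_open (atlas j)) jp.
by apply: filterS => x jx; rewrite /transition/= chart_mapK.
Qed.

Lemma diff_transition_id i p w : U i p -> dTr i i p w = w.
Proof.
move=> ip; transitivity ('d (@id 'rV[R]_m) (atlas i p) w).
  apply: near_eq_diff; [exact: transition_differentiable|by []|].
  have := nbhs_chart_img ip; apply: filterS => _ [q iq <-].
  by rewrite /transition/= chart_mapK.
by rewrite diff_val.
Qed.

Lemma tangent_out i p (v : tangent M p) : ~ U i p -> v i = 0.
Proof. by case: v => v /= /asboolP[+ _]; apply. Qed.

Lemma tangentE i j p (v : tangent M p) : U i p -> U j p -> v j = dTr i j p (v i).
Proof. by case: v => v /= /asboolP[_]; apply. Qed.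

Lemma tangent_ext i p (u v : tangent M p) : U i p -> u i = v i -> u = v.
Proof.
move=> ip uv; apply: val_inj; apply/funext => j /=.
have [jp|jp] := pselect (U j p); last by rewrite !tangent_out.
by rewrite (tangentE u ip jp) uv; exact: esym (tangentE v ip jp).
Qed.

Definition tangent_comp i w p j : 'rV[R]_m :=
  if `[< U i p /\ U j p >] then dTr i j p w else 0.

Lemma tangent_comp_subproof i w p : tangent_comp i w p \in @tangent_pred R m M p.
Proof.
apply/asboolP; split=> [j jp|j k jp kp]; rewrite /tangent_comp.
  by case: asboolP => // -[].
have [ip|ip] := pselect (U i p); last first.
  by do 2 (case: asboolP => [[]//|_]); rewrite linear0.
case: asboolP => [_|[]//]; case: asboolP => [_|[]//].
exact: esym (diff_transition_comp w ip jp kp).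
Qed.

(** The value 0 outside of the domain of the chart makes [tangent_of i w] a
    vector field on the whole manifold. *)
Definition tangent_of i w p : tangent M p :=
  Tangent (tangent_comp_subproof i w p).

Lemma tangent_ofE i w p : U i p -> tangent_of i w p i = w.
Proof.
by move=> ip; rewrite /= /tangent_comp asboolT// diff_transition_id.
Qed.

Lemma tangent_of_out i w p : ~ U i p -> tangent_of i w p = 0.
Proof.
move=> ip; apply: val_inj; apply/funext => j /=.
by rewrite /tangent_comp asboolF// => -[].
Qed.

Lemma tangent_compD p (u v : tangent M p) i : (u + v) i = u i + v i.
Proof. by []. Qed.

Lemma tangent_compZ p a (v : tangent M p) i : (a *: v) i = a *: v i.
Proof. by []. Qed.

Lemma tangent_comp0 p i : (0 : tangent M p) i = 0.
Proof. by []. Qed.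

(** The coordinate vector fields of the chart [i]. *)
Definition frame i (k : 'I_m) : vector_field M := tangent_of i (delta_mx 0 k).

Lemma frameE i p (v : tangent M p) : U i p ->
  v = \sum_k v i 0 k *: frame i k p.
Proof.
move=> ip; apply: (tangent_ext ip).
have -> (s : seq 'I_m) : (\sum_(k <- s) v i 0 k *: frame i k p) i =
    \sum_(k <- s) v i 0 k *: delta_mx 0 k.
  elim: s => [|k s ih]; first by rewrite !big_nil.
  by rewrite !big_cons tangent_compD ih tangent_compZ tangent_ofE.
exact: row_sum_delta.
Qed.

Lemma tangent_of_continuous i w j p : U i p -> U j p ->
  {for p, continuous (fun q => tangent_of i w q j)}.
Proof.
move=> ip jp.
have c : {for p, continuous (fun q => 'D_w (Tr i j) (atlas i q))}.
  apply: (@continuous_comp _ _ _ (atlas i) (fun x => 'D_w (Tr i j) x)).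
    exact: chart_map_cts.
  exact: transition_derive_continuous.
have E q : U i q -> U j q -> tangent_of i w q j = 'D_w (Tr i j) (atlas i q).
  move=> iq jq; rewrite /= /tangent_comp asboolT// deriveE//.
  exact: transition_differentiable.
rewrite /prop_for/continuous_at E//.
apply: cvg_trans c; apply: near_eq_cvg.
have : \forall q \near p, U i q /\ U j q.
  by apply: filterI; apply: open_nbhs_nbhs; split=> //; exact: chart_dom_open.
by apply: filterS => q [iq jq]; rewrite E.
Qed.

End charts.

(** * The Riemannian inner product *)

Section riemannian.
Variables (R : realType) (m : nat) (M : oriented_manifold R m).
Variable g : riemannian_metric M.
Implicit Types (i : chart_index M) (p : M).
Local Notation U i := (chart_dom (atlas i)).

Lemma riemDr p (u v w : tangent M p) : riem g u (v + w) = riem g u v + riem g u w.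
Proof.
by have := riem_linear g u 1 v w; rewrite /= scale1r => ->; rewrite mul1r.
Qed.

Lemma riem0r p (u : tangent M p) : riem g u 0 = 0.
Proof.
by apply: (addrI (riem g u 0)); rewrite -riemDr !addr0.
Qed.

Lemma riemZr p a (u v : tangent M p) : riem g u (a *: v) = a * riem g u v.
Proof. by have := riem_linear g u a v 0; rewrite /= !addr0 => ->; rewrite riem0r addr0. Qed.

Lemma riemNr p (u v : tangent M p) : riem g u (- v) = - riem g u v.
Proof. by rewrite -scaleN1r riemZr mulN1r. Qed.

Lemma riemBr p (u v w : tangent M p) : riem g u (v - w) = riem g u v - riem g u w.
Proof. by rewrite riemDr riemNr. Qed.

Lemma riemDl p (u v w : tangent M p) : riem g (u + v) w = riem g u w + riem g v w.
Proof. by rewrite riem_sym riemDr !(riem_sym g w). Qed.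

Lemma riemZl p a (u v : tangent M p) : riem g (a *: u) v = a * riem g u v.
Proof. by rewrite riem_sym riemZr riem_sym. Qed.

Lemma riemBl p (u v w : tangent M p) : riem g (u - v) w = riem g u w - riem g v w.
Proof. by rewrite riem_sym riemBr !(riem_sym g w). Qed.

Lemma riem0l p (u : tangent M p) : riem g 0 u = 0.
Proof. by rewrite riem_sym riem0r. Qed.

Lemma riem_ge0 p (u : tangent M p) : 0 <= riem g u u.
Proof.
have [->|/(riem_pos g)/ltW//] := eqVneq u 0; by rewrite riem0r.
Qed.

Lemma riem_eq0 p (u : tangent M p) : riem g u u = 0 -> u = 0.
Proof.
by have [//|/(riem_pos g)] := eqVneq u 0; move=> /[swap] ->; rewrite ltxx.
Qed.

Lemma riem_inj p (u v : tangent M p) : (forall w, riem g u w = riem g v w) -> u = v.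
Proof.
move=> uv; apply/eqP; rewrite -subr_eq0; apply/eqP/riem_eq0.
by rewrite riemBl uv subrr.
Qed.

Lemma tangent_norm_ge0 p (u : tangent M p) : 0 <= tangent_norm g u.
Proof. exact: sqrtr_ge0. Qed.

Lemma tangent_norm_sqr p (u : tangent M p) : tangent_norm g u ^+ 2 = riem g u u.
Proof. by rewrite sqr_sqrtr// riem_ge0. Qed.

Lemma tangent_norm0 p : tangent_norm g (0 : tangent M p) = 0.
Proof. by rewrite /tangent_norm riem0r sqrtr0. Qed.

Lemma tangent_normZ p a (u : tangent M p) :
  tangent_norm g (a *: u) = `|a| * tangent_norm g u.
Proof.
by rewrite /tangent_norm riemZr riemZl mulrA -expr2 sqrtrM ?sqr_ge0// sqrtr_sqr.
Qed.

Lemma tangent_norm_eq0 p (u : tangent M p) : tangent_norm g u = 0 -> u = 0.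
Proof. by move=> u0; apply: riem_eq0; rewrite -tangent_norm_sqr u0 expr0n. Qed.

Lemma riem_le p (u v : tangent M p) :
  riem g u v <= tangent_norm g u * tangent_norm g v.
Proof.
have [u0|u0] := eqVneq (tangent_norm g u) 0.
  by rewrite (tangent_norm_eq0 u0) riem0l tangent_norm0 mul0r.
have [v0|v0] := eqVneq (tangent_norm g v) 0.
  by rewrite (tangent_norm_eq0 v0) riem0r tangent_norm0 mulr0.
set a := tangent_norm g u in u0 *; set b := tangent_norm g v in v0 *.
have a0 : 0 < a by rewrite lt0r u0 tangent_norm_ge0.
have b0 : 0 < b by rewrite lt0r v0 tangent_norm_ge0.
have := riem_ge0 (b *: u - a *: v).
rewrite riemBr !riemBl !riemZr !riemZl -!tangent_norm_sqr -/a -/b (riem_sym g v u).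
rewrite (_ : _ - _ = 2 * (a * b) * (a * b - riem g u v)); last by ring.
by rewrite pmulr_rge0 ?subr_ge0// mulr_gt0// mulr_gt0.
Qed.

Lemma normr_riem p (u v : tangent M p) :
  `|riem g u v| <= tangent_norm g u * tangent_norm g v.
Proof.
rewrite ler_norml riem_le andbT lerNl -riemNr (le_trans (riem_le _ _))//.
by rewrite -scaleN1r tangent_normZ normrN1 mul1r.
Qed.

Lemma tangent_normD p (u v : tangent M p) :
  tangent_norm g (u + v) <= tangent_norm g u + tangent_norm g v.
Proof.
rewrite -(ler_pXn2r (ltn0Sn 1)) ?nnegrE ?addr_ge0 ?tangent_norm_ge0//.
rewrite sqrrD !tangent_norm_sqr riemDr !riemDl (riem_sym g v u).
by have := riem_le u v; lra.
Qed.

Lemma tangent_normN p (u : tangent M p) : tangent_norm g (- u) = tangent_norm g u.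
Proof. by rewrite -scaleN1r tangent_normZ normrN1 mul1r. Qed.

Lemma tangent_normB p (u v : tangent M p) :
  `|tangent_norm g u - tangent_norm g v| <= tangent_norm g (u - v).
Proof.
rewrite ler_norml; apply/andP; split.
  rewrite lerNl opprB lerBlDr -(tangent_normN (u - v)) opprB.
  by rewrite (le_trans _ (tangent_normD _ _))// subrK.
by rewrite lerBlDr (le_trans _ (tangent_normD _ _))// subrK.
Qed.

(** ** The Gram matrix of a chart *)

Definition gram i p : 'M[R]_m := projT1 (cid (riem_smooth g i)) (atlas i p).

Lemma riemE i p (u v : tangent M p) : U i p ->
  riem g u v = (u i *m gram i p *m (v i)^T) 0 0.
Proof. by move=> ip; rewrite /gram; case: cid => G /= [_ /(_ p ip)]. Qed.

Lemma gram_continuous i p k l : U i p ->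
  {for p, continuous (fun q => gram i q k l)}.
Proof.
move=> ip; rewrite /gram; case: cid => G /= [sG _].
have cG : {for atlas i p, continuous G} by apply: (sG 0%N); exists p.
apply: (@continuous_comp _ _ _ (fun q => G (atlas i q)) (fun N : 'M[R]_m => N k l)).
  by apply: (@continuous_comp _ _ _ (atlas i) G) => //; exact: chart_map_cts.
exact: coord_continuous.
Qed.

Lemma gram_unit i p : U i p -> gram i p \in unitmx.
Proof.
move=> ip; rewrite -row_free_unit -kermx_eq0; apply/rowV0P => w /sub_kermxP wG.
have : riem g (tangent_of i w p) (tangent_of i w p) = 0.
  by rewrite (riemE _ _ ip) tangent_ofE// wG mul0mx mxE.
by move/riem_eq0 => w0; rewrite -(tangent_ofE w ip) w0.
Qed.

(** ** Covectors as tangent vectors *)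

Definition covector_row i p (s : {scalar tangent M p}) : 'rV[R]_m :=
  \row_k s (frame i k p).

Lemma covectorE i p (s : {scalar tangent M p}) (v : tangent M p) : U i p ->
  s v = (covector_row i s *m (v i)^T) 0 0.
Proof.
move=> ip; rewrite {1}(frameE v ip) linear_sum mxE; apply: eq_bigr => k _.
by rewrite !mxE linearZ/= mulrC.
Qed.

Lemma sharp_subproof i p (s : {scalar tangent M p}) (v : tangent M p) : U i p ->
  riem g (tangent_of i (covector_row i s *m invmx (gram i p)) p) v = s v.
Proof.
move=> ip; rewrite (riemE _ _ ip) tangent_ofE// mulmxKV ?gram_unit//.
by rewrite -covectorE.
Qed.

Lemma sharp_exists p (s : {scalar tangent M p}) :
  exists u, forall v, riem g u v = s v.
Proof.
have [i ip] := atlas_cover p.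
by exists (tangent_of i (covector_row i s *m invmx (gram i p)) p) => v;
  rewrite sharp_subproof.
Qed.

(** The musical isomorphism from covectors to tangent vectors. *)
Definition sharp p (s : {scalar tangent M p}) : tangent M p :=
  projT1 (cid (sharp_exists s)).

Lemma sharpE p (s : {scalar tangent M p}) v : riem g (sharp s) v = s v.
Proof. by rewrite /sharp; case: cid. Qed.

Lemma sharp_chart i p (s : {scalar tangent M p}) : U i p ->
  sharp s i = covector_row i s *m invmx (gram i p).
Proof.
move=> ip; rewrite -[RHS](tangent_ofE _ ip); congr (component _ i).
by apply: riem_inj => v; rewrite sharpE sharp_subproof.
Qed.

(** By the Cauchy-Schwarz inequality, the supremum in the dual norm is attained
    at the normalisation of [sharp s]. *)
Lemma cotangent_normE p (s : {scalar tangent M p}) :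
  cotangent_norm g s = tangent_norm g (sharp s).
Proof.
pose S := [set `|s v| | v in [set v | tangent_norm g v <= 1]].
have ubS : ubound S (tangent_norm g (sharp s)).
  move=> _ [v /= v1 <-]; rewrite -sharpE (le_trans (normr_riem _ _))//.
  by rewrite ler_piMr// tangent_norm_ge0.
apply/le_anti/andP; split.
  apply: ge_sup => //; exists `|s 0|; exists 0 => //=.
  by rewrite tangent_norm0.
have [s0|s0] := eqVneq (tangent_norm g (sharp s)) 0.
  rewrite s0 (le_trans (normr_ge0 (s 0)))// ub_le_sup//.
    by exists (tangent_norm g (sharp s)).
  by exists 0 => //=; rewrite tangent_norm0.
set a := tangent_norm g (sharp s) in s0 *.
have a0 : 0 < a by rewrite lt0r s0 tangent_norm_ge0.
apply: ub_le_sup; first by exists a.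
exists (a^-1 *: sharp s) => /=.
  by rewrite tangent_normZ gtr0_norm ?invr_gt0// -/a mulVf.
rewrite -sharpE riemZr -tangent_norm_sqr -/a expr2 mulKf// gtr0_norm//.
Qed.

End riemannian.

(** * A countable base of chart neighbourhoods *)

Lemma continuous_borel_measurable (R : realType) (X : ptopologicalType)
    (D : set X) (f : X -> R) : open D -> (forall p, D p -> {for p, continuous f}) ->
  measurable_fun (D : set (borel X)) (f : borel X -> R).
Proof.
move=> oD cf mD; apply: (measurability _ (RGenOInfty.measurableE R)) => //.
move=> /= _ [_ [a ->] <-]; apply: borel_open.
rewrite openE => p [Dp fp]; apply: filterI.
  by apply: open_nbhs_nbhs.
by apply: cf => //; apply: open_nbhs_nbhs; split.
Qed.

Lemma measurable_inv_real (R : realType) : measurable_fun setT (fun x : R => x^-1).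
Proof.
rewrite -(setUv [set (0 : R)]); apply/measurable_funU => //.
  exact: measurableC.
split; first exact: measurable_fun_set1.
apply: open_continuous_measurable_fun.
  by apply: closed_openC; exact: closed_eq.
by move=> x /set_mem /eqP x0; exact: inv_continuous.
Qed.

Lemma continuous_compact_bounded (R : realType) (X : ptopologicalType)
    (K : set X) (f : X -> R) : compact K -> (forall p, K p -> {for p, continuous f}) ->
  exists C : R, forall p, K p -> f p <= C.
Proof.
move=> cK cf.
have : compact (f @` K).
  apply: continuous_compact => //; apply: continuous_in_subspaceT => p /set_mem.
  exact: cf.
move=> /compact_bounded[N [Nr Nf]]; exists (N + 1) => p Kp.
rewrite (le_trans (ler_norm _))//; apply: (Nf (N + 1)); first by rewrite ltrDl.
by exists p.
Qed.

Section base.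
Variables (R : realType) (m : nat) (M : oriented_manifold R m).
Implicit Types (i : chart_index M) (p : M).
Local Notation U i := (chart_dom (atlas i)).

(** Closed balls in a chart are compact, and their preimages are closed in the
    manifold because it is Hausdorff. *)
Lemma chart_compact_nbhs i p (W : set M) : U i p -> open W -> W p ->
  exists K : set M, [/\ compact K, K `<=` W & nbhs p K].
Proof.
move=> ip oW Wp.
have nW : nbhs (atlas i p) ((atlas i @` U i) `&` [set x | W (chart_inv (atlas i) x)]).
  by apply: filterI; [exact: nbhs_chart_img|exact: nbhs_chart_inv].
have /nbhs_ballP[r /= r0 rW] := nW.
pose D := closed_ball_ (fun x : 'rV[R]_m => `|x|) (atlas i p) (r / 2).
have r2 : 0 < r / 2 by rewrite divr_gt0.
have Dr x : D x -> ball (atlas i p) r x.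
  rewrite -ball_normE /D /closed_ball_ /= => /le_lt_trans; apply.
  by rewrite ltr_pdivrMr// ltr_pMr// ltr1n.
have cD : compact D.
  apply: bounded_closed_compact; last exact: closed_closed_ball_.
  exists (`|atlas i p| + r / 2); split; first exact: num_real.
  move=> y /ltW + x; rewrite /D /closed_ball_ /= => /[swap] xr; apply: le_trans.
  rewrite -lerBlDl; apply: le_trans xr.
  by rewrite -[`|_ - x|]normrN opprB; exact: lerB_dist.
exists (chart_inv (atlas i) @` D); split.
- apply: continuous_compact => //; apply: continuous_in_subspaceT => x /set_mem.
  by move=> /Dr/rW[ix _]; exact: chart_inv_cts.
- by move=> _ [x /Dr/rW[_ Wx] <-].
- have cp := chart_map_cts ip.
  have : nbhs (atlas i p) D.
    apply: filterS (nbhsx_ballx (atlas i p) (r / 2) r2) => x.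
    by rewrite -ball_normE /D /closed_ball_ /= => /ltW.
  move=> /cp nD.
  have nU : nbhs p (U i) by apply: open_nbhs_nbhs; split=> //; exact: chart_dom_open.
  have nDU : nbhs p ([set q | D (atlas i q)] `&` U i) by apply: filterI.
  apply: filterS nDU => q [Dq iq].
  by exists (atlas i q) => //; rewrite chart_mapK.
Qed.

(** Open sets with compact closure inside [Omega] and inside one chart form a
    base of [Omega]. *)
Lemma chart_base (Omega : set M) : open Omega ->
  exists (B : nat -> set M) (c : nat -> chart_index M),
    compact_base Omega B /\ forall n, closure (B n) `<=` U (c n).
Proof.
move=> oO; have [BB cB [Bo Bb]] := @carrier_second_countable _ _ M.
have /countable_injP[f finj] := cB.
pose good b := [/\ BB b, compact (closure b) & exists i, closure b `<=` Omega `&` U i].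
pose P n := [set b : set M | good b /\ f b = n].
pose B n := xget set0 (P n).
have BP n : [/\ open (B n), compact (closure (B n)) &
    exists i, closure (B n) `<=` Omega `&` U i].
  rewrite /B; case: xgetP => [b _ [[Bb' cb ib] _]|_].
    by split=> //; exact: Bo.
  split; [exact: open0|by rewrite closure0; exact: compact0|].
  by have [i _] := atlas_cover (point : M); exists i; rewrite closure0.
have [c cP] := choice (fun n => let: And3 _ _ h := BP n in h).
exists B, c; split; last by move=> n x /cP[].
split.
- by move=> n; have [] := BP n.
- by move=> n; have [] := BP n.
- by move=> n x /cP[].
move=> W p oW Wp Op; have [i ip] := atlas_cover p.
have oWO : open (W `&` (Omega `&` U i)).
  by do 2 (apply: openI => //); exact: chart_dom_open.
have [K [cK KW pK]] := chart_compact_nbhs ip oWO (conj Wp (conj Op ip)).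
have [b [BBb bp] bK] := Bb p K pK.
have clK : closed K by apply: compact_closed => //; exact: carrier_hausdorff.
have cbK : closure b `<=` K.
  by rewrite [X in _ `<=` X](closure_id K).1//; exact: closure_subset.
have gb : good b.
  split=> //; first by apply: (subclosed_compact _ cK cbK); exact: closed_closure.
  by exists i => x /cbK/KW[].
exists (f b).
have -> : B (f b) = b.
  rewrite /B; case: xgetP => [b' _ [[BB' _ _] ff]|/(_ b)]; last by case.
  by apply: finj => //; exact: mem_set.
by split=> // x /cbK/KW[].
Qed.

End base.

(** * Borel vector fields *)

Definition borel_field (R : realType) (m : nat) (M : oriented_manifold R m)
    (Omega : set M) (Y : vector_field M) : Prop :=
  forall i k, measurable_fun (Omega `&` chart_dom (atlas i) : set (borel M))
    (fun p : borel M => Y p i 0 k).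

Section borel_fields.
Variables (R : realType) (m : nat) (M : oriented_manifold R m).
Variables (g : riemannian_metric M) (Omega : set M).
Hypothesis oO : open Omega.
Implicit Types (i : chart_index M) (p : M) (X Y : vector_field M).
Local Notation U i := (chart_dom (atlas i)).
Local Notation bf := (borel_field Omega).

Lemma openOU i : open (Omega `&` U i).
Proof. by apply: openI => //; exact: chart_dom_open. Qed.

Lemma measurableO : measurable (Omega : set (borel M)).
Proof. exact: borel_open. Qed.

Lemma measurableOU i : measurable (Omega `&` U i : set (borel M)).
Proof. by apply: borel_open; exact: openOU. Qed.

Lemma measurable_fun_base d (T : measurableType d) (B : nat -> set M)
    (f : borel M -> T) : compact_base Omega B ->
  (forall n, measurable_fun (B n : set (borel M)) f) ->
  measurable_fun (Omega : set (borel M)) f.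
Proof.
move=> [Bo _ BO Bb] mf.
have -> : Omega = \bigcup_n B n :> set (borel M).
  apply/seteqP; split=> [p Op|p [n _ Bnp]].
    by have [n [Bnp _]] := Bb setT p openT Logic.I Op; exists n.
  by apply: (BO n); exact: subset_closure.
by apply/measurable_fun_bigcup => // n; exact: borel_open.
Qed.

Lemma measurable_fun_charts d (T : measurableType d) (f : borel M -> T) :
  (forall i, measurable_fun (Omega `&` U i : set (borel M)) f) ->
  measurable_fun (Omega : set (borel M)) f.
Proof.
move=> mf; have [B [c [bB cB]]] := chart_base oO.
apply: (measurable_fun_base bB) => n; have [_ _ BO _] := bB.
apply: (measurable_funS (measurableOU (c n))) => // p Bp.
by split; [apply: (BO n)|apply: cB]; exact: subset_closure.
Qed.

Lemma borel_field_continuous X : continuous_field Omega X -> bf X.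
Proof.
move=> cX i k; apply: continuous_borel_measurable; first exact: openOU.
move=> p [Op ip]; apply: (@continuous_comp _ _ _ (fun q => X q i) (fun w : 'rV[R]_m => w 0 k)).
  exact: cX.
exact: coord_continuous.
Qed.

Lemma borel_fieldD X Y : bf X -> bf Y -> bf (fun p => X p + Y p).
Proof.
move=> bX bY i k.
have := measurable_funD (bX i k) (bY i k); congr measurable_fun.
by apply/funext => p; rewrite tangent_compD mxE.
Qed.

Lemma borel_fieldZ (f : borel M -> R) Y : measurable_fun (Omega : set (borel M)) f ->
  bf Y -> bf (fun p => f p *: Y p).
Proof.
move=> mf bY i k.
have mf' : measurable_fun (Omega `&` U i : set (borel M)) f.
  by apply: (measurable_funS measurableO) mf => //; exact: subIsetl.
have := measurable_funM mf' (bY i k); congr measurable_fun.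
by apply/funext => p; rewrite tangent_compZ mxE.
Qed.

Lemma borel_field0 : bf (fun=> 0).
Proof.
move=> i k; rewrite (_ : (fun p : borel M => _) = cst 0); first exact: measurable_cst.
by apply/funext => p; rewrite tangent_comp0 mxE.
Qed.

Lemma borel_fieldB X Y : bf X -> bf Y -> bf (fun p => X p - Y p).
Proof.
move=> bX bY; have := borel_fieldD bX (borel_fieldZ (f := cst (-1)) (measurable_cst _) bY).
by congr borel_field; apply: functional_extensionality_dep => p; rewrite scaleN1r.
Qed.

(** On the other charts, the components are continuous where the charts overlap
    and 0 elsewhere. *)
Lemma borel_field_frame i k : bf (frame i k).
Proof.
move=> j l.
have -> : Omega `&` U j = ((Omega `&` U j) `&` U i) `|` ((Omega `&` U j) `&` ~` U i) :> set (borel M).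
  by rewrite -setIUr setUv setIT.
have mi : measurable (U i : set (borel M)).
  by apply: borel_open; exact: chart_dom_open.
apply/measurable_funU.
- by apply: measurableI => //; exact: measurableOU.
- by apply: measurableI; [exact: measurableOU|exact: measurableC].
split.
  apply: continuous_borel_measurable.
    by apply: openI; [exact: openOU|exact: chart_dom_open].
  move=> p [[_ jp] ip].
  apply: (@continuous_comp _ _ _ (fun q => frame i k q j) (fun w : 'rV[R]_m => w 0 l)).
    exact: tangent_of_continuous.
  exact: coord_continuous.
apply: (eq_measurable_fun (cst 0 : borel M -> R)); last exact: measurable_cst.
by move=> p /set_mem[_ ip]; rewrite /frame tangent_of_out// tangent_comp0 mxE.
Qed.

Lemma measurable_gram i k l :
  measurable_fun (Omega `&` U i : set (borel M)) (fun p : borel M => gram g i p k l).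
Proof.
apply: continuous_borel_measurable; first exact: openOU.
by move=> p [_ ip]; exact: gram_continuous.
Qed.

Lemma measurable_riem X Y : bf X -> bf Y ->
  measurable_fun (Omega : set (borel M)) (fun p : borel M => riem g (X p) (Y p)).
Proof.
move=> bX bY; apply: measurable_fun_charts => i.
apply: (eq_measurable_fun (fun p : borel M =>
   \sum_(l < m) (\sum_(k < m) X p i 0 k * gram g i p k l) * Y p i 0 l)).
  move=> p /set_mem[_ ip]; rewrite (riemE _ _ _ ip) mxE.
  by apply: eq_bigr => l _; rewrite !mxE.
apply: measurable_sum => l; apply: measurable_funM; last exact: bY.
apply: measurable_sum => k; apply: measurable_funM; first exact: bX.
exact: measurable_gram.
Qed.

Lemma measurable_tangent_norm X : bf X ->
  measurable_fun (Omega : set (borel M)) (fun p : borel M => tangent_norm g (X p)).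
Proof.
move=> bX; apply: (measurableT_comp (f := @Num.sqrt R)); last exact: measurable_riem.
exact: continuous_measurable_fun (@sqrt_continuous R).
Qed.

(** By Cramer's rule the entries of the inverse are quotients of minors. *)
Lemma measurable_gram_inv i k l :
  measurable_fun (Omega `&` U i : set (borel M)) (fun p : borel M => invmx (gram g i p) k l).
Proof.
have mdet n (F : borel M -> 'M[R]_n) :
    (forall a b, measurable_fun (Omega `&` U i : set (borel M)) (fun p : borel M => F p a b)) ->
    measurable_fun (Omega `&` U i : set (borel M)) (fun p : borel M => \det (F p)).
  move=> mF; apply: measurable_sum => s.
  by apply: measurable_funM => //; apply: measurable_prod => a _; exact: mF.
apply: (eq_measurable_fun (fun p : borel M =>
   (\det (gram g i p))^-1 * (\adj (gram g i p)) k l)).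
  by move=> p /set_mem[_ ip]; rewrite /invmx gram_unit// !mxE.
apply: measurable_funM.
  apply: (measurableT_comp (f := (fun x : R => x^-1))).
    exact: measurable_inv_real.
  by apply: mdet => a b; exact: measurable_gram.
apply: (eq_measurable_fun (fun p : borel M => cofactor (gram g i p) l k)).
  by move=> p _; rewrite mxE.
apply: measurable_funM => //; apply: mdet => a b.
apply: (eq_measurable_fun (fun p : borel M => gram g i p (lift l a) (lift k b))).
  by move=> p _; rewrite !mxE.
exact: measurable_gram.
Qed.

Lemma borel_field_sharp (s : covector_field M) : borel_covector_field Omega s ->
  bf (fun p => sharp g (s p)).
Proof.
move=> bs i k; have [t [mt tE]] := bs i.
apply: (eq_measurable_fun (fun p : borel M =>
   \sum_(l < m) t l p * invmx (gram g i p) l k)).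
  move=> p /set_mem[Op ip]; rewrite (sharp_chart _ _ ip) mxE.
  apply: eq_bigr => l _; rewrite mxE tE//; congr (_ * _).
  have -> : frame i l p i = delta_mx 0 l by exact: tangent_ofE.
  rewrite (bigD1 l)//= mxE !eqxx mulr1 big1 ?addr0// => j jl.
  by rewrite mxE eqxx (negbTE jl) mulr0.
apply: measurable_sum => l; apply: measurable_funM; first exact: mt.
exact: measurable_gram_inv.
Qed.

Lemma measurable_cotangent_norm (s : covector_field M) : borel_covector_field Omega s ->
  measurable_fun (Omega : set (borel M)) (fun p : borel M => cotangent_norm g (s p)).
Proof.
move=> bs; apply: (eq_measurable_fun (fun p : borel M => tangent_norm g (sharp g (s p)))).
  by move=> p _; rewrite cotangent_normE.
by apply: measurable_tangent_norm; exact: borel_field_sharp.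
Qed.

Lemma measurable_covector (s : covector_field M) X : borel_covector_field Omega s ->
  bf X -> measurable_fun (Omega : set (borel M)) (fun p : borel M => s p (X p)).
Proof.
move=> bs bX.
apply: (eq_measurable_fun (fun p : borel M => riem g (sharp g (s p)) (X p))).
  by move=> p _; rewrite sharpE.
by apply: measurable_riem => //; exact: borel_field_sharp.
Qed.

End borel_fields.

(** * Fields vanishing at infinity *)

Lemma cvg_sum_seq (R : realType) (T : Type) (F : set_system T) (FF : Filter F)
    I (r : seq I) (f : I -> T -> R) (a : I -> R) :
  (forall i, f i x @[x --> F] --> a i) ->
  \sum_(i <- r) f i x @[x --> F] --> \sum_(i <- r) a i.
Proof.
move=> fa; elim: r => [|i r ih].
  by rewrite big_nil; under eq_fun do rewrite big_nil; exact: cvg_cst.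
by rewrite big_cons; under eq_fun do rewrite big_cons; exact: cvgD.
Qed.

Section C0_fields.
Variables (R : realType) (m : nat) (M : oriented_manifold R m).
Variables (g : riemannian_metric M) (Omega : set M).
Hypothesis oO : open Omega.
Implicit Types (i : chart_index M) (p : M) (X Y : vector_field M).
Local Notation U i := (chart_dom (atlas i)).

Lemma continuous_fieldD X Y : continuous_field Omega X -> continuous_field Omega Y ->
  continuous_field Omega (fun p => X p + Y p).
Proof.
move=> cX cY i p Op ip.
exact: (@cvgD _ _ _ _ _ (fun q => X q i) (fun q => Y q i) _ _ (cX i p Op ip) (cY i p Op ip)).
Qed.

Lemma continuous_fieldZ (f : M -> R) X : (forall p, Omega p -> {for p, continuous f}) ->
  continuous_field Omega X -> continuous_field Omega (fun p => f p *: X p).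
Proof.
move=> cf cX i p Op ip.
exact: (@cvgZ _ _ _ _ _ f (fun q => X q i) _ _ (cf p Op) (cX i p Op ip)).
Qed.

Lemma continuous_riem X Y p : continuous_field Omega X -> continuous_field Omega Y ->
  Omega p -> {for p, continuous (fun q => riem g (X q) (Y q))}.
Proof.
move=> cX cY Op; have [i ip] := atlas_cover p.
have E q : U i q -> riem g (X q) (Y q) =
    \sum_(l < m) (\sum_(k < m) X q i 0 k * gram g i q k l) * Y q i 0 l.
  move=> iq; rewrite (riemE _ _ _ iq) mxE.
  by apply: eq_bigr => l _; rewrite !mxE.
rewrite /prop_for/continuous_at (E p ip).
have cc Z k : continuous_field Omega Z -> (Z q i 0 k : R) @[q --> p] --> (Z p i 0 k : R).
  move=> cZ; apply: (@continuous_comp _ _ _ (fun q => Z q i) (fun w : 'rV[R]_m => w 0 k)).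
    exact: cZ.
  exact: coord_continuous.
suff : \sum_(l < m) (\sum_(k < m) X q i 0 k * gram g i q k l) * Y q i 0 l @[q --> p] -->
    \sum_(l < m) (\sum_(k < m) X p i 0 k * gram g i p k l) * Y p i 0 l.
  apply: cvg_trans; apply: near_eq_cvg.
  have : nbhs p (U i) by apply: open_nbhs_nbhs; split => //; exact: chart_dom_open.
  by apply: filterS => q /E ->.
apply: cvg_sum_seq => l; apply: cvgM; last exact: cc.
apply: cvg_sum_seq => k; apply: cvgM; first exact: cc.
exact: gram_continuous.
Qed.

Lemma continuous_tangent_norm X p : continuous_field Omega X -> Omega p ->
  {for p, continuous (fun q => tangent_norm g (X q))}.
Proof.
move=> cX Op; apply: (@continuous_comp _ _ _ (fun q => riem g (X q) (X q)) (@Num.sqrt R)).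
  exact: continuous_riem.
exact: sqrt_continuous.
Qed.

Lemma C0_fieldD X Y : C0_field g Omega X -> C0_field g Omega Y ->
  C0_field g Omega (fun p => X p + Y p).
Proof.
move=> [cX X0] [cY Y0]; split; first exact: continuous_fieldD.
move=> e e0; have e2 : 0 < e / 2 by rewrite divr_gt0.
have [K [cK KO KX]] := X0 _ e2; have [L [cL LO LY]] := Y0 _ e2.
exists (K `|` L); split; [exact: compactU|by move=> p [/KO|/LO]|].
move=> p Op /not_orP[nK nL]; rewrite (le_lt_trans (tangent_normD _ _ _))//.
by rewrite (splitr e) ltrD ?KX ?LY.
Qed.

Lemma C0_fieldZ (f : M -> R) X : Cb_function Omega f -> C0_field g Omega X ->
  C0_field g Omega (fun p => f p *: X p).
Proof.
move=> [cf [C fC]] [cX X0]; split; first exact: continuous_fieldZ.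
move=> e e0; have C0 : 0 < `|C| + 1 by rewrite ltr_wpDl.
have [K [cK KO KX]] := X0 _ (divr_gt0 e0 C0).
exists K; split => // p Op nK; rewrite tangent_normZ.
rewrite (@le_lt_trans _ _ ((`|C| + 1) * tangent_norm g (X p)))//.
  rewrite ler_wpM2r ?tangent_norm_ge0// (le_trans (fC _ Op))//.
  by rewrite (le_trans (ler_norm _))// lerDl.
by rewrite mulrC -ltr_pdivlMr// KX.
Qed.

Lemma Cb_function_cst (c : R) : Cb_function Omega (fun=> c).
Proof. by split; [move=> p _; exact: cvg_cst|exists `|c|]. Qed.

Lemma C0_field0 : C0_field g Omega (fun=> 0).
Proof.
split; first by move=> i p _ _; exact: cvg_cst.
move=> e e0; exists set0; split; [exact: compact0|by []|].
by move=> p _ _; rewrite tangent_norm0.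
Qed.

Lemma C0_fieldB X Y : C0_field g Omega X -> C0_field g Omega Y ->
  C0_field g Omega (fun p => X p - Y p).
Proof.
move=> CX CY; have := C0_fieldD CX (C0_fieldZ (Cb_function_cst (-1)) CY).
by congr C0_field; apply: functional_extensionality_dep => p; rewrite scaleN1r.
Qed.

Lemma C0_Cb_field X : C0_field g Omega X -> Cb_field g Omega X.
Proof.
move=> [cX X0]; split=> //; have [K [cK KO KX]] := X0 _ ltr01.
have [C CP] := @continuous_compact_bounded R M K (fun p => tangent_norm g (X p)) cK
  (fun p Kp => continuous_tangent_norm cX (KO p Kp)).
exists (Num.max C 1) => p Op; rewrite le_max.
have [/CP ->//|/(KX _ Op)/ltW ->] := pselect (K p); by rewrite orbT.
Qed.

(** The set lies in a compact subset [K] of [Omega], and is closed in [K] because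
    the norm is continuous near [K]. *)
Lemma compact_superlevel X (t : R) : C0_field g Omega X -> 0 < t ->
  compact (Omega `&` [set p | t <= tangent_norm g (X p)]).
Proof.
move=> [cX X0] t0; have [K [cK KO KX]] := X0 _ t0.
have AK : Omega `&` [set p | t <= tangent_norm g (X p)] `<=` K.
  move=> p [Op /= tp]; apply: contrapT => /(KX _ Op).
  by rewrite ltNge tp.
apply: (subclosed_compact _ cK AK) => p clp.
have clK : closed K by apply: compact_closed => //; exact: carrier_hausdorff.
have Kp : K p by apply: clK; exact: closure_subset clp.
split; first exact: KO.
rewrite /= leNgt; apply/negP => pt.
have c := continuous_tangent_norm cX (KO p Kp).
have : nbhs p [set q | tangent_norm g (X q) < t].
  have n : nbhs (tangent_norm g (X p)) [set y | y < t].
    by apply: open_nbhs_nbhs; split => //; exact: open_lt.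
  exact: (c _ n).
by move=> /clp[q [[_ /= tq]]]; rewrite ltNge tq.
Qed.

(** Radial projection of [X] onto the unit ball. *)
Definition truncate X : vector_field M :=
  fun p => (Num.max 1 (tangent_norm g (X p)))^-1 *: X p.

Lemma truncate_le1 X p : tangent_norm g (truncate X p) <= 1.
Proof.
have m1 : 0 < Num.max 1 (tangent_norm g (X p)) by rewrite lt_max ltr01.
rewrite tangent_normZ gtr0_norm ?invr_gt0// ler_pdivrMl// mulr1.
by rewrite le_max lexx orbT.
Qed.

(** If [|u| <= 1], truncation moves [v] by at most [|v| - 1 <= |u - v|]. *)
Lemma truncate_dist X p (u : tangent M p) : tangent_norm g u <= 1 ->
  tangent_norm g (u - truncate X p) <= 2 * tangent_norm g (u - X p).
Proof.
move=> u1; set v := X p; set n := Num.max 1 (tangent_norm g v).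
have n1 : 1 <= n by rewrite le_max lexx.
have n0 : 0 < n by exact: lt_le_trans n1.
have -> : u - truncate X p = (u - v) + (v - n^-1 *: v).
  by rewrite addrA subrK.
rewrite (le_trans (tangent_normD _ _ _))// mulr_natl mulr2n lerD2l.
rewrite -{1}[v]scale1r -scalerBl tangent_normZ ger0_norm; last first.
  by rewrite subr_ge0 invf_le1.
have [v1|v1] := leP (tangent_norm g v) 1.
  by rewrite /n max_l// invr1 subrr mul0r tangent_norm_ge0.
rewrite /n (max_r (ltW v1)) mulrBl mul1r mulVf ?gt_eqF//; last exact: lt_trans v1.
rewrite (le_trans _ (tangent_normB g u v))// distrC.
by rewrite (le_trans _ (ler_norm _))// lerD2l lerN2.
Qed.

Lemma C0_truncate X : C0_field g Omega X -> C0_field g Omega (truncate X).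
Proof.
move=> CX; apply: C0_fieldZ => //; split.
  move=> p Op; apply: (@continuous_comp _ _ _ (fun q => Num.max 1 (tangent_norm g (X q))) (@GRing.inv R)).
    apply: (@continuous_max _ _ (fun=> 1) (fun q => tangent_norm g (X q))).
      exact: cvg_cst.
    exact: continuous_tangent_norm CX.1 Op.
  by apply: inv_continuous; rewrite gt_eqF// lt_max ltr01.
exists 1 => p _; rewrite gtr0_norm ?invr_gt0 ?lt_max ?ltr01//.
by rewrite invf_le1 ?lt_max ?ltr01// le_max lexx.
Qed.

End C0_fields.

(** * Bump functions *)

Section bump.
Variables (R : realType) (m : nat) (M : oriented_manifold R m).
Local Notation U i := (chart_dom (@atlas _ _ M i)).

(** The distance to the complement of [A], cut off at 1 so that it is also
    defined when [A] is everything. *)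
Definition depth (V : normedModType R) (A : set V) (x : V) : R :=
  inf [set r | r = 1 \/ exists2 y, ~ A y & r = `|x - y|].

Let depth_has_inf (V : normedModType R) (A : set V) x :
  has_inf [set r : R | r = 1 \/ exists2 y, ~ A y & r = `|x - y|].
Proof.
split; first by exists 1; left.
by exists 0 => _ [->|[y _ ->]].
Qed.

Lemma depth_ge0 (V : normedModType R) (A : set V) x : 0 <= depth A x.
Proof.
apply: lb_le_inf; first by case: (depth_has_inf A x).
by move=> _ [->|[y _ ->]].
Qed.

Lemma depth_le1 (V : normedModType R) (A : set V) x : depth A x <= 1.
Proof. by apply: inf_lbound; [case: (depth_has_inf A x)|left]. Qed.

Lemma depth_out (V : normedModType R) (A : set V) x : ~ A x -> depth A x = 0.
Proof.
move=> nA; apply/le_anti; rewrite depth_ge0 andbT.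
apply: inf_lbound; first by case: (depth_has_inf A x).
by right; exists x => //; rewrite subrr normr0.
Qed.

Lemma depth_gt0 (V : normedModType R) (A : set V) x : open A -> A x -> 0 < depth A x.
Proof.
move=> oA Ax; have /nbhs_ballP[r /= r0 rA] := open_nbhs_nbhs (conj oA Ax).
apply: (@lt_le_trans _ _ (Num.min 1 r)); first by rewrite lt_min ltr01.
apply: lb_le_inf; first by case: (depth_has_inf A x).
move=> _ [->|[y nAy ->]]; first by rewrite ge_min lexx.
rewrite ge_min leNgt; apply/orP; right; rewrite leNgt; apply/negP => yr.
by apply: nAy; apply: rA; rewrite -ball_normE.
Qed.

Lemma depth_lip (V : normedModType R) (A : set V) x y :
  depth A x <= depth A y + `|x - y|.
Proof.
rewrite -lerBlDr; apply: lb_le_inf; first by case: (depth_has_inf A y).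
move=> _ [->|[z nAz ->]]; rewrite lerBlDr.
  by rewrite (le_trans (depth_le1 _ _))// lerDl.
apply: (@le_trans _ _ `|x - z|).
  by apply: inf_lbound; [case: (depth_has_inf A x)|right; exists z].
by rewrite [leRHS]addrC; exact: ler_distD.
Qed.

Lemma depth_continuous (V : normedModType R) (A : set V) : continuous (depth A).
Proof.
move=> x; apply/cvgrPdist_lt => e e0.
apply: filterS (nbhsx_ballx x e e0) => y; rewrite -ball_normE /= => xy.
have h1 := depth_lip A x y; have := depth_lip A y x; rewrite distrC => h2.
by rewrite (le_lt_trans _ xy)// ler_norml; apply/andP; split; lra.
Qed.

(** Near a point outside the chart the bump function vanishes because the
    closure of [V] lies inside the chart. *)
Lemma bump_exists i (V : set M) : open V -> compact (closure V) ->
  closure V `<=` U i ->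
  exists f : M -> R, [/\ continuous f, forall p, 0 <= f p <= 1,
    forall p, V p -> 0 < f p, forall p, ~ V p -> f p = 0 &
    forall e, 0 < e -> compact [set p | e <= f p]].
Proof.
move=> oV cV Vi; pose A := atlas i @` V.
have VU p : V p -> U i p by move=> Vp; apply: Vi; exact: subset_closure.
have oA : open A.
  rewrite openE => _ [p Vp <-].
  have nA : nbhs (atlas i p) ((atlas i @` U i) `&` [set x | V (chart_inv (atlas i) x)]).
    by apply: filterI; [exact: nbhs_chart_img (VU p Vp)|exact: nbhs_chart_inv (VU p Vp) oV Vp].
  apply: filterS nA => x [[q iq <-]] /=; rewrite chart_mapK// => Vq.
  by exists q.
pose f p := if `[< V p >] then depth A (atlas i p) else 0.
have fV p : V p -> f p = depth A (atlas i p) by move=> Vp; rewrite /f asboolT.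
have fnV p : ~ V p -> f p = 0 by move=> Vp; rewrite /f asboolF.
have fU p : U i p -> f p = depth A (atlas i p).
  move=> ip; have [/fV//|nV] := pselect (V p); rewrite fnV// depth_out//.
  move=> [q Vq] /(congr1 (chart_inv (atlas i))); rewrite !chart_mapK//; last exact: VU.
  by move=> qp; apply: nV; rewrite -qp.
have cf : continuous f.
  move=> p; have [ip|nip] := pselect (U i p).
    have c : {for p, continuous (fun q => depth A (atlas i q))}.
      apply: (@continuous_comp _ _ _ (atlas i) (depth A)).
        exact: chart_map_cts.
      exact: depth_continuous.
    rewrite /continuous_at fU//; apply: cvg_trans c; apply: near_eq_cvg.
    have : nbhs p (U i) by apply: open_nbhs_nbhs; split => //; exact: chart_dom_open.
    by apply: filterS => q /fU ->.
  rewrite /continuous_at (fnV p); last by move=> /VU.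
  apply: (@cvg_trans _ ((fun=> 0 : R) @ p)); last exact: cvg_cst.
  apply: near_eq_cvg.
  have : nbhs p (~` closure V).
    apply: open_nbhs_nbhs; split; first by apply: closed_openC; exact: closed_closure.
    by move=> /Vi.
  apply: filterS => q nq; rewrite fnV// => Vq; apply: nq; exact: subset_closure.
exists f; split => //.
- move=> p; have [Vp|nV] := pselect (V p).
    by rewrite fV// depth_ge0 depth_le1.
  by rewrite fnV// lexx ler01.
- by move=> p Vp; rewrite fV//; apply: depth_gt0 => //; exists p.
- move=> e e0; apply: (subclosed_compact _ cV).
    have -> : [set p | e <= f p] = f @^-1` [set x | e <= x] by [].
    by apply: closed_comp => [p _|]; [exact: cf|exact: closed_ge].
  move=> p /= ef; have [|nV] := pselect (V p); first exact: subset_closure.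
  by move: ef; rewrite fnV// leNgt e0.
Qed.

End bump.

(** * A monotone class theorem for vector fields *)

Definition bounded_borel_field (R : realType) (m : nat)
    (M : oriented_manifold R m) (g : riemannian_metric M) (Omega : set M)
    (Y : vector_field M) : Prop :=
  borel_field Omega Y /\
  exists C : R, forall p, Omega p -> tangent_norm g (Y p) <= C.

(** The stability properties that an identity between integrals has by linearity
    and dominated convergence. *)
Record field_class (R : realType) (m : nat)
    (M : oriented_manifold R m) (g : riemannian_metric M) (Omega : set M)
    (P : vector_field M -> Prop) : Prop := FieldClass {
  field_class0 : P (fun=> 0);
  field_class_lin : forall a X Y, bounded_borel_field g Omega X ->
    bounded_borel_field g Omega Y -> P X -> P Y -> P (fun p => a *: X p + Y p);
  field_class_lim : forall (Y_ : nat -> vector_field M) Y (C : R),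
    (forall n, bounded_borel_field g Omega (Y_ n)) -> (forall n, P (Y_ n)) ->
    bounded_borel_field g Omega Y ->
    (forall n p, Omega p -> tangent_norm g (Y_ n p) <= C) ->
    (forall p, Omega p -> tangent_norm g (Y p - Y_ n p) @[n --> \oo] --> 0) ->
    P Y }.

Section monotone_class.
Variables (R : realType) (m : nat) (M : oriented_manifold R m).
Variables (g : riemannian_metric M) (Omega : set M).
Hypothesis oO : open Omega.
Variables (B : nat -> set M) (c : nat -> chart_index M).
Hypotheses (bB : compact_base Omega B)
  (cB : forall n, closure (B n) `<=` chart_dom (atlas (c n))).
Implicit Types (p : M) (X Y : vector_field M).
Local Notation bbf := (bounded_borel_field g Omega).

Let Bo n : open (B n). Proof. by have [+ _ _ _] := bB; apply. Qed.
Let Bc n : compact (closure (B n)). Proof. by have [_ + _ _] := bB; apply. Qed.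
Let BO n : B n `<=` Omega.
Proof. by have [_ _ + _] := bB => /(_ n) + p Bp; apply; exact: subset_closure. Qed.
Let BU n : B n `<=` chart_dom (atlas (c n)).
Proof. by move=> p Bp; apply: cB; exact: subset_closure. Qed.
Let mO : measurable (Omega : set (borel M)). Proof. exact: borel_open. Qed.
Let mB n : measurable (B n : set (borel M)). Proof. exact: borel_open. Qed.

Lemma bounded_borel_fieldD X Y : bbf X -> bbf Y -> bbf (fun p => X p + Y p).
Proof.
move=> [bX [C XC]] [bY [D YD]]; split; first exact: borel_fieldD.
exists (C + D) => p Op; rewrite (le_trans (tangent_normD _ _ _))//.
by rewrite lerD ?XC ?YD.
Qed.

Lemma bounded_borel_fieldZ (f : borel M -> R) Y :
  bounded_measurable (Omega : set (borel M)) f -> bbf Y -> bbf (fun p => f p *: Y p).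
Proof.
move=> [mf [C fC]] [bY [D YD]]; split; first exact: borel_fieldZ.
by exists (C * D) => p Op; rewrite tangent_normZ ler_pM ?tangent_norm_ge0 ?fC ?YD.
Qed.

Lemma bounded_borel_field0 : bbf (fun=> 0).
Proof.
by split; [exact: borel_field0|exists 0 => p _; rewrite tangent_norm0].
Qed.

Lemma bounded_borel_fieldB X Y : bbf X -> bbf Y -> bbf (fun p => X p - Y p).
Proof.
move=> [bX [C XC]] [bY [D YD]]; split; first exact: borel_fieldB.
exists (C + D) => p Op; rewrite (le_trans (tangent_normD _ _ _))//.
by rewrite tangent_normN lerD ?XC ?YD.
Qed.

Lemma bounded_borel_field_indic A Y : measurable (A : set (borel M)) -> bbf Y ->
  bbf (fun p => (\1_A p : R) *: Y p).
Proof. by move=> mA; apply: bounded_borel_fieldZ; exact: bounded_measurable_indic. Qed.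

Lemma C0_bounded_borel X : C0_field g Omega X -> bbf X.
Proof.
move=> CX; have [cX XC] := C0_Cb_field CX; split=> //.
exact: borel_field_continuous.
Qed.

Lemma bounded_measurable_tangent_norm X : bbf X ->
  bounded_measurable (Omega : set (borel M)) (fun p : borel M => tangent_norm g (X p)).
Proof.
move=> [bX [C XC]]; split; first exact: measurable_tangent_norm.
by exists C => p Op; rewrite ger0_norm ?tangent_norm_ge0 ?XC.
Qed.

Lemma bounded_measurable_riem X Y : bbf X -> bbf Y ->
  bounded_measurable (Omega : set (borel M)) (fun p : borel M => riem g (X p) (Y p)).
Proof.
move=> [bX [C XC]] [bY [D YD]]; split; first exact: measurable_riem.
exists (C * D) => p Op; rewrite (le_trans (normr_riem _ _ _))//.
by rewrite ler_pM ?tangent_norm_ge0 ?XC ?YD.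
Qed.

Lemma frame_bounded n k : exists C : R, forall p, B n p ->
  tangent_norm g (frame (c n) k p) <= C.
Proof.
have [p Bp|C CP] := @continuous_compact_bounded R M (closure (B n))
  (fun p => gram g (c n) p k k) (@Bc n).
  by apply: gram_continuous; exact: cB Bp.
exists (Num.sqrt C) => p /subset_closure Bp; rewrite /tangent_norm ler_sqrt; last first.
  rewrite (le_trans _ (CP _ Bp))//.
  have := riem_ge0 g (frame (c n) k p); rewrite (riemE _ _ _ (cB Bp)).
  have -> : frame (c n) k p (c n) = delta_mx 0 k by apply: tangent_ofE; exact: cB.
  by rewrite -rowE trmx_delta -colE !mxE.
rewrite (riemE _ _ _ (cB Bp)).
have -> : frame (c n) k p (c n) = delta_mx 0 k by apply: tangent_ofE; exact: cB.
by rewrite -rowE trmx_delta -colE !mxE CP.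
Qed.

(** The building blocks of bounded Borel fields, for [A] a Borel subset of a
    member of the base. *)
Definition cut_frame n k (A : set M) : vector_field M :=
  fun p => (\1_A p : R) *: frame (c n) k p.

Lemma bounded_cut_frame n k A : measurable (A : set (borel M)) -> A `<=` B n ->
  bbf (cut_frame n k A).
Proof.
move=> mA AB; split.
  apply: borel_fieldZ => //; last exact: borel_field_frame.
have [C CP] := frame_bounded n k.
exists `|C| => p _; rewrite tangent_normZ indicE.
have [/set_mem/AB Bp|_] := boolP (p \in A); last by rewrite normr0 mul0r.
by rewrite normr1 mul1r (le_trans (CP _ Bp))// ler_norm.
Qed.

Section with_class.
Variable P : vector_field M -> Prop.
Hypothesis clP : field_class g Omega P.

Lemma field_class_eq X Y : (forall p, X p = Y p) -> P X -> P Y.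
Proof. by move=> XY; rewrite (functional_extensionality_dep XY). Qed.

Lemma field_classD X Y : bbf X -> bbf Y -> P X -> P Y -> P (fun p => X p + Y p).
Proof.
move=> bX bY PX PY; have := field_class_lin clP 1 bX bY PX PY.
by apply: field_class_eq => p; rewrite scale1r.
Qed.

Lemma field_classB X Y : bbf X -> bbf Y -> P X -> P Y -> P (fun p => X p - Y p).
Proof.
move=> bX bY PX PY; have := field_class_lin clP (-1) bY bX PY PX.
by apply: field_class_eq => p; rewrite scaleN1r addrC.
Qed.

(** Pointwise convergence of the indicators gives a bounded limit of fields. *)
Lemma field_class_indic_lim (A_ : nat -> set M) (A : set M) Y (C : R) :
  (forall n, bbf (fun p => (\1_(A_ n) p : R) *: Y p)) ->
  bbf (fun p => (\1_A p : R) *: Y p) ->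
  (forall n p, Omega p -> A_ n p -> tangent_norm g (Y p) <= C) ->
  (forall n, P (fun p => (\1_(A_ n) p : R) *: Y p)) ->
  (forall p, Omega p -> \forall n \near \oo, A_ n p <-> A p) ->
  P (fun p => (\1_A p : R) *: Y p).
Proof.
move=> bA_ bA YC PA_ AA.
apply: (field_class_lim clP bA_ PA_ bA (C := `|C|)).
  move=> n p Op; rewrite tangent_normZ indicE.
  have [/set_mem Ap|_] := boolP (p \in A_ n); last by rewrite normr0 mul0r.
  by rewrite normr1 mul1r (le_trans (YC n p Op Ap))// ler_norm.
move=> p Op; apply: cvg_near_cst; apply: filterS (AA p Op) => n AE.
have -> : \1_(A_ n) p = \1_A p :> R.
  rewrite !indicE; congr (_%:R); congr nat_of_bool.
  by apply/idP/idP => /set_mem/AE/mem_set.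
by rewrite subrr tangent_norm0; apply/eqP.
Qed.

Lemma indicU_disj (A D : set M) (p : M) : A `&` D = set0 ->
  \1_(A `|` D) p = \1_A p + \1_D p :> R.
Proof.
move=> AD; rewrite !indicE in_setU.
have [pA|_] := boolP (p \in A); have [pD|_] := boolP (p \in D) => /=;
  rewrite ?addr0 ?add0r//.
have : (A `&` D) p by split; exact: set_mem.
by rewrite AD.
Qed.

Lemma field_class_indicU (A D : set M) Y : A `&` D = set0 ->
  bbf (fun p => (\1_A p : R) *: Y p) -> bbf (fun p => (\1_D p : R) *: Y p) ->
  P (fun p => (\1_A p : R) *: Y p) -> P (fun p => (\1_D p : R) *: Y p) ->
  P (fun p => (\1_(A `|` D) p : R) *: Y p).
Proof.
move=> AD bA bD PA PD; have := field_classD bA bD PA PD.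
by apply: field_class_eq => p; rewrite indicU_disj// scalerDl.
Qed.

Definition covered n : set M := \big[setU/set0]_(k < n) B k.

(** Borel sets that partition [Omega], each contained in one chart. *)
Definition piece n : set M := B n `\` covered n.

Lemma open_covered n : open (covered n).
Proof. by rewrite /covered -bigcup_mkord; apply: bigcup_open. Qed.

Lemma measurable_piece n : measurable (piece n : set (borel M)).
Proof. by apply: measurableD => //; apply: borel_open; exact: open_covered. Qed.

Lemma piece_sub n : piece n `<=` B n. Proof. exact: subDsetl. Qed.

(** A bounded Borel field is a limit of finite sums of cut-off coordinate
    fields: decompose it along the pieces of [Omega], and each component in the
    chart of a piece into simple functions. *)
Lemma field_class_pieces :
  (forall n k A, measurable (A : set (borel M)) -> A `<=` piece n -> P (cut_frame n k A)) ->
  forall Y, bbf Y -> P Y.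
Proof.
move=> Pgen Y bY; have [C0 C0P] := bY.2.
have mpc := measurable_piece.
have Pf n k (f : borel M -> R) : bounded_measurable (Omega : set (borel M)) f ->
    P (fun p => f p *: cut_frame n k (piece n) p).
  have bcf : bbf (cut_frame n k (piece n)).
    by apply: bounded_cut_frame => //; exact: piece_sub.
  apply: (@bounded_measurable_ind _ _ R (Omega : set (borel M))
    (fun f => P (fun p => f p *: cut_frame n k (piece n) p))) => //.
  - move=> A mA.
    have := Pgen n k (A `&` piece n) (measurableI _ _ mA (mpc n)) (@subIsetr _ _ _).
    by apply: field_class_eq => p; rewrite /cut_frame scalerA indicI.
  - move=> a f1 f2 bf1 bf2 P1 P2.
    have := field_class_lin clP a (bounded_borel_fieldZ bf1 bcf)
      (bounded_borel_fieldZ bf2 bcf) P1 P2.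
    by apply: field_class_eq => p; rewrite scalerDl scalerA.
  - move=> {}f bf H.
    have i0 (l : nat) : 0 < l.+1%:R^-1 :> R by rewrite invr_gt0.
    have [h hP] := choice (fun l => H _ (i0 l)).
    have [D DP] := bcf.2; have [Cf CfP] := bf.2.
    apply: (field_class_lim clP (Y_ := fun l p => h l p *: cut_frame n k (piece n) p)
        (C := (Cf + 1) * D)).
    + by move=> l; apply: bounded_borel_fieldZ => //; have [] := hP l.
    + by move=> l; have [] := hP l.
    + exact: bounded_borel_fieldZ.
    + move=> l p Op; rewrite tangent_normZ ler_pM ?tangent_norm_ge0 ?DP//.
      have [_ _ /(_ p Op) fh] := hP l.
      rewrite (_ : h l p = f p - (f p - h l p)); last by rewrite opprB addrC subrK.
      rewrite (le_trans (ler_normB _ _))// lerD ?CfP// (le_trans fh)//.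
      by rewrite invf_le1// ler1n.
    + move=> p Op; apply/cvgrPdist_le => e e0.
      have D0 : 0 < `|D| + 1 by rewrite ltr_wpDl.
      have := near_infty_natSinv_lt (PosNum (divr_gt0 e0 D0)).
      apply: filterS => l /= le; rewrite sub0r normrN ger0_norm ?tangent_norm_ge0//.
      rewrite -scalerBl tangent_normZ.
      have [_ _ /(_ p Op) fh] := hP l.
      apply: (@le_trans _ _ (l.+1%:R^-1 * (`|D| + 1))).
        rewrite ler_pM ?tangent_norm_ge0// (le_trans (DP _ Op))//.
        by rewrite (le_trans (ler_norm _))// lerDl.
      by rewrite -ler_pdivlMr// ltW.
have Ppiece n : P (fun p => (\1_(piece n) p : R) *: Y p).
  pose y k p := Y p (c n) 0 k : R.
  have my k : measurable_fun (piece n : set (borel M)) (y k : borel M -> R).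
    apply: (measurable_funS (measurableOU oO (c n))) (bY.1 (c n) k).
    by move=> p /piece_sub Bp; split; [exact: BO Bp|exact: BU].
  pose E N := piece n `&` [set p | \sum_k `|y k p| <= N%:R].
  have mE N : measurable (E N : set (borel M)).
    have ms : measurable_fun (piece n : set (borel M)) (fun p : borel M => \sum_k `|y k p|).
      by apply: measurable_sum => k; exact: measurableT_comp.
    have := ms (mpc n) _ (measurable_itv `]-oo, N%:R]); congr measurable.
  have EO N p : E N p -> Omega p by move=> [/piece_sub/BO].
  have bE N : bbf (fun p => (\1_(E N) p : R) *: Y p) by exact: bounded_borel_field_indic.
  apply: (field_class_indic_lim (A_ := E) (C := C0)) => //.
  - exact: bounded_borel_field_indic.
  - by move=> N p Op _; exact: C0P.
  - move=> N.
    pose f k : borel M -> R := (y k : borel M -> R) \_ (E N).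
    have bf k : bounded_measurable (Omega : set (borel M)) (f k).
      split.
        apply/measurable_restrict => //.
        apply: (measurable_funS (mpc n)) (my k) => //.
        by move=> p [_ []].
      exists N%:R => p _; rewrite /f /patch; case: ifPn => [/set_mem[_ /= yN]|_].
        rewrite (le_trans _ yN)// (bigD1 k)//= lerDl.
        by apply: sumr_ge0.
      by rewrite normr0.
    have bfc k : bbf (fun p => f k p *: cut_frame n k (piece n) p).
      apply: bounded_borel_fieldZ => //.
      by apply: bounded_cut_frame => //; exact: piece_sub.
    have [+ _] : P (fun p => \sum_k f k p *: cut_frame n k (piece n) p) /\
        bbf (fun p => \sum_k f k p *: cut_frame n k (piece n) p).
      elim: (index_enum _) => [|k r [ihP ihb]].
        split; first by apply: field_class_eq (field_class0 clP) => p; rewrite big_nil.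
        rewrite (_ : (fun p : M => _) = (fun=> 0)); first exact: bounded_borel_field0.
        by apply: functional_extensionality_dep => p; rewrite big_nil.
      have e : (fun p => f k p *: cut_frame n k (piece n) p +
          \sum_(k <- r) f k p *: cut_frame n k (piece n) p) =
          (fun p => \sum_(k <- k :: r) f k p *: cut_frame n k (piece n) p).
        by apply: functional_extensionality_dep => p; rewrite big_cons.
      rewrite -e; split; last exact: bounded_borel_fieldD.
      by apply: field_classD => //; exact: Pf.
    apply: field_class_eq => p; rewrite indicE /f /patch.
    have [/set_mem Ep|nE] := boolP (p \in E N); last first.
      by rewrite scale0r big1// => k _; exact: scale0r.
    have Up : chart_dom (atlas (c n)) p by apply: BU; apply: piece_sub; exact: Ep.1.
    rewrite scale1r [RHS](frameE _ Up); apply: eq_bigr => k _.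
    by rewrite /cut_frame indicE (mem_set Ep.1) scale1r.
  - move=> p Op; have [pp|npp] := pselect (piece n p); last first.
      by apply: nearW => N; split => // -[].
    near=> N; split; first by case.
    move=> _; split=> //=; near: N; exact: nbhs_infty_ger.
have bcov N : bbf (fun p => (\1_(covered N) p : R) *: Y p).
  by apply: bounded_borel_field_indic => //; apply: borel_open; exact: open_covered.
have bpc N : bbf (fun p => (\1_(piece N) p : R) *: Y p).
  by apply: bounded_borel_field_indic.
have Pcov N : P (fun p => (\1_(covered N) p : R) *: Y p).
  elim: N => [|N ih].
    apply: field_class_eq (field_class0 clP) => p.
    by rewrite /covered big_ord0 indic0 scale0r.
  have -> : covered N.+1 = covered N `|` piece N.
    rewrite {1}/covered big_ord_recr/= -/(covered N) /piece.
    by apply/seteqP; split=> p; have [] := pselect (covered N p); rewrite /setU/setD/=; tauto.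
  by apply: field_class_indicU => //; rewrite /piece setDE setICA setICr setI0.
have : P (fun p => (\1_Omega p : R) *: Y p).
  apply: (field_class_indic_lim (A_ := covered) (C := C0)) => //.
  - exact: bounded_borel_field_indic.
  - by move=> n p Op _; exact: C0P.
  move=> p Op; have [_ _ _ /(_ setT p openT Logic.I Op)[n [Bnp _]]] := bB.
  exists n.+1 => // k /= nk; split=> // _; rewrite /covered -bigcup_mkord.
  by exists n.
move=> PO; apply: (field_class_lim clP (Y_ := fun _ p => (\1_Omega p : R) *: Y p) (C := C0)) => //.
- by move=> _; exact: bounded_borel_field_indic.
- by move=> _ p Op; rewrite indicE mem_set// scale1r C0P.
- move=> p Op; rewrite indicE mem_set// scale1r subrr tangent_norm0; exact: cvg_cst.
Unshelve. all: by end_near. Qed.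

End with_class.

(** ** Countably many generators *)

Lemma base_bump n s : exists f : M -> R, [/\ continuous f,
  forall p, 0 <= f p <= 1,
  forall p, (finite_union B s `&` B n) p -> 0 < f p,
  forall p, ~ (finite_union B s `&` B n) p -> f p = 0 &
  forall e, 0 < e -> compact [set p | e <= f p]].
Proof.
have sub : closure (finite_union B s `&` B n) `<=` closure (B n).
  by apply: closure_subset; exact: subIsetr.
apply: (@bump_exists _ _ _ (c n)).
- by apply: openI => //; exact: (open_finite_union bB).
- by apply: (subclosed_compact _ (@Bc n) sub); exact: closed_closure.
- by move=> p /sub/cB.
Qed.

Definition bump_fun n s : M -> R := projT1 (cid (base_bump n s)).

(** As [l] grows, these fields increase to the coordinate field cut off to
    [finite_union B s `&` B n]. *)
Definition bump_field n k s (l : nat) : vector_field M :=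
  fun p => Num.min 1 (l%:R * bump_fun n s p) *: frame (c n) k p.

Lemma C0_bump_field n k s l : C0_field g Omega (bump_field n k s l).
Proof.
rewrite /bump_field /bump_fun; case: cid => f /= [cf f01 fV fnV fc].
have cm : continuous (fun p => Num.min 1 (l%:R * f p)).
  move=> p; apply: (@continuous_min _ _ (fun=> 1) (fun q => l%:R * f q)).
    exact: cvg_cst.
  by apply: cvgM; [exact: cvg_cst|exact: cf].
have f0 p : 0 <= f p by have /andP[] := f01 p.
split.
  move=> i p Op ip; have [jp|nj] := pselect (chart_dom (atlas (c n)) p).
    apply: (@cvgZ _ _ _ _ _ (fun p => Num.min 1 (l%:R * f p)) (fun q => frame (c n) k q i)).
      exact: cm.
    exact: tangent_of_continuous.
  have Z : nbhs p (~` closure (B n)).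
    apply: open_nbhs_nbhs; split; first by apply: closed_openC; exact: closed_closure.
    by move=> /cB.
  have fz q : ~ closure (B n) q -> f q = 0.
    by move=> nq; apply: fnV => -[_ Bq]; apply: nq; exact: subset_closure.
  rewrite /prop_for/continuous_at (fz p); last by move=> /cB.
  rewrite mulr0 min_r ?ler01// scale0r tangent_comp0.
  apply: (@cvg_trans _ ((fun=> (0 : 'rV[R]_m)) @ p)); last exact: cvg_cst.
  apply: near_eq_cvg; apply: filterS Z => q nq.
  by rewrite fz// mulr0 min_r ?ler01// scale0r tangent_comp0.
move=> e e0; have [C CP] := frame_bounded n k.
have lC : 0 < l%:R * `|C| + 1 by rewrite ltr_wpDl// mulr_ge0.
have h0 : 0 < e / (l%:R * `|C| + 1) by rewrite divr_gt0.
(* Outside of this set the norm, at most [l * f p * `|C|], is below [e]. *)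
exists [set p | e / (l%:R * `|C| + 1) <= f p]; split.
- exact: fc.
- move=> p /= fp; apply: (@BO n); apply: contrapT => nB.
  have f0' : f p = 0 by apply: fnV => -[].
  by move: fp; rewrite f0' leNgt h0.
move=> p Op /= /negP; rewrite -ltNge => fp; rewrite tangent_normZ.
have [Vp|nV] := pselect ((finite_union B s `&` B n) p); last first.
  by rewrite fnV// mulr0 min_r ?ler01// normr0 mul0r.
rewrite ger0_norm ?le_min ?ler01 ?mulr_ge0//.
rewrite (@le_lt_trans _ _ (l%:R * f p * `|C|))//.
  rewrite ler_pM ?tangent_norm_ge0 ?le_min ?ler01 ?mulr_ge0//.
    by rewrite ge_min lexx orbT.
  by rewrite (le_trans (CP _ Vp.2))// ler_norm.
rewrite ltr_pdivlMr// in fp; apply: le_lt_trans fp.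
by rewrite mulrDr mulr1 mulrAC [_ * f p]mulrC lerDl.
Qed.

(** Countably many continuous fields generate all bounded Borel fields.  Limits
    of bump fields are the coordinate fields cut off to finite unions of members
    of the base; these exhaust open sets, and Dynkin's pi-lambda theorem leads
    from open sets to Borel sets, hence to the generators of
    [field_class_pieces]. *)
Lemma field_class_bumps (P : vector_field M -> Prop) : field_class g Omega P ->
  (forall n k s l, P (bump_field n k s l)) -> forall Y, bbf Y -> P Y.
Proof.
move=> clP Pbump; apply: (field_class_pieces clP).
have bcf n k (A : set M) : measurable (A : set (borel M)) -> bbf (cut_frame n k (A `&` B n)).
  move=> mA; apply: bounded_cut_frame; last exact: subIsetr.
  exact: measurableI.
have frC n k : exists C : R, forall p, B n p -> tangent_norm g (frame (c n) k p) <= C.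
  exact: frame_bounded.
have mV s : measurable (finite_union B s : set (borel M)).
  by apply: borel_open; exact: (open_finite_union bB).
have PV n k s : P (cut_frame n k (finite_union B s `&` B n)).
  have [C CP] := frC n k.
  apply: (field_class_lim clP (Y_ := bump_field n k s) (C := `|C|)).
  - by move=> l; apply: C0_bounded_borel; exact: C0_bump_field.
  - exact: Pbump.
  - exact: bcf.
  - move=> l p Op; rewrite /bump_field /bump_fun; case: cid => f /= [_ f01 fV fnV _].
    rewrite tangent_normZ.
    have [Vp|nV] := pselect ((finite_union B s `&` B n) p); last first.
      by rewrite fnV// mulr0 min_r ?ler01// normr0 mul0r.
    have f0 : 0 <= f p by have /andP[] := f01 p.
    rewrite ger0_norm ?le_min ?ler01 ?mulr_ge0// -[leRHS]mul1r.
    rewrite ler_pM ?tangent_norm_ge0 ?le_min ?ler01 ?mulr_ge0//.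
      by rewrite ge_min lexx.
    by rewrite (le_trans (CP _ Vp.2))// ler_norm.
  - move=> p Op; rewrite /bump_field /bump_fun; case: cid => f /= [_ f01 fV fnV _].
    apply: cvg_near_cst.
    have [Vp|nV] := pselect ((finite_union B s `&` B n) p); last first.
      apply: nearW => l; rewrite fnV// mulr0 min_r ?ler01// scale0r subr0.
      by rewrite /cut_frame indicE memNset// scale0r tangent_norm0.
    near=> l; rewrite /cut_frame indicE mem_set// scale1r min_l.
      by rewrite scale1r subrr tangent_norm0.
    rewrite -ler_pdivrMr ?fV// div1r; near: l; exact: nbhs_infty_ger.
have Popen n k (W : set M) : open W -> P (cut_frame n k (W `&` B n)).
  move=> oW; have [C CP] := frC n k.
  pose s l := [seq j <- iota 0 l | `[< closure (B j) `<=` W >]].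
  apply: (field_class_indic_lim clP (A_ := fun l => finite_union B (s l) `&` B n) (C := C)).
  - by move=> l; exact: bcf.
  - by apply: bcf; exact: borel_open.
  - by move=> l p Op [_ Bp]; exact: CP.
  - by move=> l; exact: PV.
  move=> p Op; have VW l : finite_union B (s l) p -> W p.
    rewrite /finite_union -bigcup_seq => -[j /=]; rewrite mem_filter.
    by move=> /andP[/asboolP jW _] Bp; apply: jW; exact: subset_closure.
  have [Wp|nW] := pselect (W p); last first.
    by apply: nearW => l; split=> [[/VW]|[]].
  have [_ _ _ /(_ W p oW Wp Op)[j [Bjp jW]]] := bB.
  exists j.+1 => // l /= jl; split=> [[/VW ?]//|[_ Bp]]; split=> //.
  rewrite /finite_union -bigcup_seq; exists j => //=.
  by rewrite mem_filter mem_iota/= add0n jl andbT; apply/asboolP.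
have Pborel n k (A : set M) : measurable (A : set (borel M)) -> P (cut_frame n k (A `&` B n)).
  move=> mA; have [C CP] := frC n k.
  apply: (@dynkin_induction _ (borel M) (@open M) (fun A => P (cut_frame n k (A `&` B n)))) => //.
  - by move=> V W; exact: openI.
  - by apply: Popen; exact: openT.
  - by move=> W oW; exact: Popen.
  - move=> D mD PD.
    have := field_classB clP (bcf n k _ measurableT) (bcf n k _ mD) (Popen n k _ openT) PD.
    apply: field_class_eq => p; rewrite /cut_frame -scalerBl; congr (_ *: _).
    rewrite !indicE !in_setI in_setT in_setC/=.
    by case: (p \in D); case: (p \in B n); rewrite ?subrr ?subr0.
  - move=> F mF tF PF.
    pose S N := \big[setU/set0]_(j < N) F j.
    have mS N : measurable (S N : set (borel M)) by exact: bigsetU_measurable.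
    have PS N : P (cut_frame n k (S N `&` B n)).
      elim: N => [|N ih].
        apply: field_class_eq (field_class0 clP) => p.
        by rewrite /cut_frame /S big_ord0 set0I indic0 scale0r.
      have -> : S N.+1 `&` B n = (S N `&` B n) `|` (F N `&` B n).
        by rewrite /S big_ord_recr/= setIUl.
      apply: field_class_indicU => //.
      - rewrite -subset0 => p [[]]; rewrite /S -bigcup_mkord => -[j /= jN Fjp] _ [FNp _].
        have /trivIsetP/(_ j N Logic.I Logic.I (negbT (ltn_eqF jN)))/seteqP[/(_ p) + _] := tF.
        by apply.
      - exact: bcf.
      - exact: bcf.
      - exact: PF.
    apply: (field_class_indic_lim clP (A_ := fun N => S N `&` B n) (C := C)).
    + by move=> N; exact: bcf.
    + by apply: bcf; exact: bigcup_measurable.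
    + by move=> N p _ [_ Bp]; exact: CP.
    + exact: PS.
    move=> p Op; have SF N : S N p -> (\bigcup_j F j) p.
      by rewrite /S -bigcup_mkord => -[j _ Fjp]; exists j.
    have [[j _ Fjp]|nF] := pselect ((\bigcup_j F j) p); last first.
      by apply: nearW => N; split=> [[/SF]|[]].
    exists j.+1 => // N /= jN; split=> [[/SF ?]//|[_ Bp]]; split=> //.
    by rewrite /S -bigcup_mkord; exists j.
move=> n k A mA Ap; have := Pborel n k A mA; rewrite setIidl//.
by apply: subset_trans Ap _; exact: piece_sub.
Unshelve. all: by end_near. Qed.

End monotone_class.

(** * Covector measures as unit fields *)

Lemma approx_chain (R : realFieldType) (e x y z w : R) :
  x <= y + e / 2 -> y <= z + e / 2 -> z <= w -> x <= w + e.
Proof. by lra. Qed.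

Lemma approx_cancel (R : realFieldType) (e x y z w : R) :
  x + y <= z + w + e / 2 -> z <= x + e / 2 -> y <= w + e.
Proof. by lra. Qed.

Section total_variation.
Variables (R : realType) (m : nat) (M : oriented_manifold R m).
Variables (g : riemannian_metric M) (Omega : set M).
Hypothesis oO : open Omega.
Implicit Types (p : M) (X Y : vector_field M) (nu : covector_measure g Omega).
Local Notation bbf := (bounded_borel_field g Omega).
Local Notation bm := (bounded_measurable (Omega : set (borel M))).

Let mO : measurable (Omega : set (borel M)). Proof. exact: borel_open. Qed.

(** The total variation, bundled as a measure; the openness of [Omega] is an
    argument because it makes [Omega] measurable. *)
Definition tv_measure (_ : open Omega) nu (A : set (borel M)) : \bar R :=
  tot_var nu A.

Section measure.
Variable nu : covector_measure g Omega.
Let s p := cotangent_norm g (cm_density nu p).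

Let s_ge0 p : 0 <= s p.
Proof. by rewrite /s cotangent_normE tangent_norm_ge0. Qed.

Let ms : measurable_fun (Omega : set (borel M)) (s : borel M -> R).
Proof. by apply: measurable_cotangent_norm => //; exact: cm_borel. Qed.

Let f : borel M -> \bar R := (fun p => (s p)%:E) \_ Omega.

Let mf : measurable_fun setT f.
Proof.
by apply/(measurable_restrictT _ mO); apply/measurable_EFinP.
Qed.

Let f_ge0 p : (0 <= f p)%E.
Proof. by rewrite /f /patch; case: ifP => // _; rewrite lee_fin. Qed.

Let tvE A : tv_measure oO nu A = (\int[cm_measure nu]_(p in A) f p)%E.
Proof. by rewrite /tv_measure /tot_var integral_mkcondr. Qed.

Let tv0 : tv_measure oO nu set0 = 0%E.
Proof. by rewrite tvE integral_set0. Qed.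

Let tv_ge0 A : (0 <= tv_measure oO nu A)%E.
Proof. by rewrite tvE integral_ge0. Qed.

Let tv_sigma : semi_sigma_additive (tv_measure oO nu).
Proof.
have -> : tv_measure oO nu = (fun A => \int[cm_measure nu]_(p in A) f p)%E.
  by apply/funext => A; rewrite tvE.
exact: semi_sigma_additive_nng_induced.
Qed.

HB.instance Definition _ := isMeasure.Build _ _ _ (tv_measure oO nu)
  tv0 tv_ge0 tv_sigma.

Let tv_fin : fin_num_fun (tv_measure oO nu).
Proof.
move=> A mA; rewrite ge0_fin_numE// /tv_measure /tot_var.
have [C CP] := cm_bounded nu.
have mAO : measurable (A `&` Omega : set (borel M)) by exact: measurableI.
apply: (@le_lt_trans _ _ (\int[cm_measure nu]_(p in A `&` Omega) (`|C|)%:E)%E).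
  apply: ge0_le_integral => //.
  - by move=> p _; rewrite lee_fin; exact: s_ge0.
  - by apply/measurable_EFinP; apply: (measurable_funS mO) ms => // p [].
  - by move=> p [_ Op]; rewrite lee_fin (le_trans (CP p Op))// ler_norm.
by rewrite integral_cst// lte_mul_pinfty ?lee_fin// ltey_eq fin_num_measure.
Qed.

HB.instance Definition _ := Measure_isFinite.Build _ _ _ (tv_measure oO nu) tv_fin.

End measure.

Local Notation tv nu :=
  (tv_measure oO nu : {finite_measure set (borel M) -> \bar R}).

(** The vector field that represents [sigma^nu]. *)
Definition unit_field nu : vector_field M :=
  fun p => (cotangent_norm g (cm_density nu p))^-1 *: sharp g (cm_density nu p).

Lemma polarE nu p (v : tangent M p) : polar nu v = riem g (unit_field nu p) v.
Proof. by rewrite /polar /unit_field riemZl sharpE mulrC. Qed.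

Lemma unit_field_eq1 nu p : cotangent_norm g (cm_density nu p) != 0 ->
  riem g (unit_field nu p) (unit_field nu p) = 1.
Proof.
rewrite cotangent_normE => a0; rewrite /unit_field cotangent_normE.
by rewrite riemZl riemZr -tangent_norm_sqr expr2 mulKf// mulVf.
Qed.

Lemma unit_field_le1 nu p : tangent_norm g (unit_field nu p) <= 1.
Proof.
have [a0|/unit_field_eq1 u1] := eqVneq (cotangent_norm g (cm_density nu p)) 0.
  by rewrite /unit_field a0 invr0 scale0r tangent_norm0.
by rewrite /tangent_norm u1 sqrtr1.
Qed.

Lemma bounded_unit_field nu : bbf (unit_field nu).
Proof.
split; last by exists 1 => p _; exact: unit_field_le1.
apply: borel_fieldZ => //; last by apply: borel_field_sharp => //; exact: cm_borel.
apply: (measurableT_comp (f := (fun x : R => x^-1))); first exact: measurable_inv_real.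
by apply: measurable_cotangent_norm => //; exact: cm_borel.
Qed.

Lemma pairingE nu X :
  pairing nu X = \int[tv nu]_(p in Omega) riem g (unit_field nu p) (X p).
Proof.
transitivity (\int[tv nu]_(p in Omega) polar nu (X p)); first by [].
by apply: eq_Rint => p _; exact: polarE.
Qed.

Lemma tv_setIO nu (A : set (borel M)) : tot_var nu (A `&` Omega) = tot_var nu A.
Proof. by rewrite /tot_var -setIA setIid. Qed.

(** [sigma^nu] has norm 1 almost everywhere for the total variation, which does
    not charge the zeros of [sigma]. *)
Lemma Rint_unit_field nu (f : borel M -> R) : bm f ->
  \int[tv nu]_(p in Omega) (f p * riem g (unit_field nu p) (unit_field nu p)) =
  \int[tv nu]_(p in Omega) f p.
Proof.
move=> bf; have bu := bounded_unit_field nu.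
set r := fun p : M => riem g (unit_field nu p) (unit_field nu p).
have br : bm r by exact: bounded_measurable_riem.
pose s p := cotangent_norm g (cm_density nu p).
have ms : measurable_fun (Omega : set (borel M)) (s : borel M -> R).
  by apply: measurable_cotangent_norm => //; exact: cm_borel.
pose Z := Omega `&` [set p | s p = 0].
have mZ : measurable (Z : set (borel M)).
  by have := ms mO _ (measurable_set1 0); congr measurable.
have Z0 : tv nu Z = 0%E.
  rewrite /= /tv_measure /tot_var -[RHS](integral0 (cm_measure nu) (Z `&` Omega)).
  by apply: eq_integral => p /set_mem[[_ sp] _]; congr EFin.
have [C CP] := bf.2.
have bd : bm (fun p => f p * r p - f p).
  by apply: bounded_measurableB => //; exact: bounded_measurableM.
apply/eqP; rewrite -subr_eq0 -RintB//; last exact: bounded_measurableM.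
rewrite -normr_eq0; apply/eqP/le_anti; rewrite normr_ge0 andbT.
rewrite (le_trans (normr_Rint mO _ bd))//.
have bZ : bm (fun p => `|C| * \1_Z p).
  by apply: bounded_measurableZ; exact: bounded_measurable_indic.
apply: (@le_trans _ _ (\int[tv nu]_(p in Omega) (`|C| * \1_Z p))).
  apply: le_Rint => //; first exact: bounded_measurable_norm.
  move=> p Op; rewrite indicE; have [sp|sp] := eqVneq (s p) 0.
    rewrite mem_set// mulr1 /r /unit_field -/(s p) sp invr0 scale0r riem0l mulr0.
    by rewrite sub0r normrN (le_trans (CP p Op))// ler_norm.
  by rewrite /r (unit_field_eq1 sp) mulr1 subrr normr0 mulr_ge0.
rewrite RintZ//; last exact: bounded_measurable_indic.
rewrite Rint_indic// setIidl; last by move=> p [].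
by rewrite [X in fine X](_ : _ = 0%E)// mulr0.
Qed.

Lemma bounded_measurable_pairing nu X : bbf X ->
  bm (fun p : borel M => riem g (unit_field nu p) (X p)).
Proof. by move=> bX; apply: bounded_measurable_riem => //; exact: bounded_unit_field. Qed.

(** By the Cauchy-Schwarz inequality, as the unit field and [X] stay in the unit
    ball. *)
Lemma pairing_le nu X (f : borel M -> R) : bbf X -> bm f ->
  (forall p, Omega p -> 0 <= f p) ->
  (forall p, Omega p -> tangent_norm g (X p) <= 1) ->
  \int[tv nu]_(p in Omega) riem g (unit_field nu p) (f p *: X p) <=
  \int[tv nu]_(p in Omega) f p.
Proof.
move=> bX bf f0 X1; apply: le_Rint => //.
  by apply: bounded_measurable_pairing; exact: bounded_borel_fieldZ.
move=> p Op; rewrite riemZr ler_piMr ?f0// (le_trans (riem_le _ _ _))//.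
by rewrite mulr_ile1 ?tangent_norm_ge0 ?unit_field_le1 ?X1.
Qed.

End total_variation.

(** * Density of continuous fields, and uniqueness of limits *)

Section uniqueness.
Variables (R : realType) (m : nat) (M : oriented_manifold R m).
Variables (g : riemannian_metric M) (Omega : set M).
Hypothesis oO : open Omega.
Implicit Types (p : M) (X Y : vector_field M) (nu : covector_measure g Omega).
Local Notation bbf := (bounded_borel_field g Omega).
Local Notation bm := (bounded_measurable (Omega : set (borel M))).
Local Notation tv nu :=
  (tv_measure oO nu : {finite_measure set (borel M) -> \bar R}).

Let mO : measurable (Omega : set (borel M)). Proof. exact: borel_open. Qed.

(** The L1 distance of fields. *)
Definition field_dist (mu : {finite_measure set (borel M) -> \bar R}) X Y : R :=
  \int[mu]_(p in Omega) tangent_norm g (X p - Y p).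

Section field_dist_theory.
Variable mu : {finite_measure set (borel M) -> \bar R}.
Local Notation dist := (field_dist mu).

Lemma bounded_measurable_dist X Y : bbf X -> bbf Y ->
  bm (fun p : borel M => tangent_norm g (X p - Y p)).
Proof.
move=> bX bY; apply: (bounded_measurable_tangent_norm oO (X := fun p => X p - Y p)).
exact: bounded_borel_fieldB.
Qed.

Lemma field_dist_ge0 X Y : 0 <= dist X Y.
Proof. by apply: Rintegral_ge0 => p _; exact: tangent_norm_ge0. Qed.

Lemma field_distxx X : dist X X = 0.
Proof.
rewrite /field_dist; under eq_Rintegral do rewrite subrr tangent_norm0.
by rewrite Rintegral_cst// mul0r.
Qed.

Lemma field_distC X Y : dist X Y = dist Y X.
Proof. by apply: eq_Rint => p _; rewrite -(tangent_normN g (Y p - X p)) opprB. Qed.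

Lemma field_dist_triangle X Y Z : bbf X -> bbf Y -> bbf Z ->
  dist X Z <= dist X Y + dist Y Z.
Proof.
move=> bX bY bZ; rewrite -RintD//; try exact: bounded_measurable_dist.
apply: le_Rint => //; try exact: bounded_measurable_dist.
  by apply: bounded_measurableD; exact: bounded_measurable_dist.
move=> p _; rewrite -[X p - Z p](subrKA (Y p)); exact: tangent_normD.
Qed.

Lemma field_dist_lin a X Y X' Y' : bbf X -> bbf Y -> bbf X' -> bbf Y' ->
  dist (fun p => a *: X p + Y p) (fun p => a *: X' p + Y' p) <=
  `|a| * dist X X' + dist Y Y'.
Proof.
move=> bX bY bX' bY'.
have bZ Z : bbf Z -> bbf (fun p => a *: Z p).
  by move=> bZ; apply: bounded_borel_fieldZ => //; exact: bounded_measurable_cst.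
rewrite -RintZ//; last exact: bounded_measurable_dist.
rewrite -RintD//; last exact: bounded_measurable_dist; last first.
  by apply: bounded_measurableZ; exact: bounded_measurable_dist.
apply: le_Rint => //.
- apply: (bounded_measurable_dist (X := fun p => a *: X p + Y p)
     (Y := fun p => a *: X' p + Y' p)); by apply: bounded_borel_fieldD => //; exact: bZ.
- apply: bounded_measurableD; last exact: bounded_measurable_dist.
  by apply: bounded_measurableZ; exact: bounded_measurable_dist.
move=> p _; rewrite opprD addrACA -scalerBr (le_trans (tangent_normD _ _ _))//.
by rewrite tangent_normZ.
Qed.

Lemma field_dist_lim (Y_ : nat -> vector_field M) Y (C : R) :
  (forall n, bbf (Y_ n)) -> bbf Y ->
  (forall n p, Omega p -> tangent_norm g (Y_ n p) <= C) ->
  (forall p, Omega p -> tangent_norm g (Y p - Y_ n p) @[n --> \oo] --> 0) ->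
  dist Y (Y_ n) @[n --> \oo] --> 0.
Proof.
move=> bY_ bY YC Yl; have [D DP] := bY.2.
have -> : 0 = \int[mu]_(p in Omega) (0 : R) by rewrite Rintegral_cst// mul0r.
apply: (Rint_cvg mO (C := D + C)) => //.
- by move=> n; apply: (bounded_measurable_dist bY (bY_ n)).1.
- exact: bounded_measurable_cst.
move=> n p Op; rewrite ger0_norm ?tangent_norm_ge0//.
by rewrite (le_trans (tangent_normD _ _ _))// tangent_normN lerD ?DP ?YC.
Qed.

(** The L1 closure of a linear space of fields: dominated convergence makes
    bounded pointwise limits L1 limits. *)
Lemma field_class_closure (Q : vector_field M -> Prop) :
  (forall X, Q X -> bbf X) -> Q (fun=> 0) ->
  (forall a X Y, Q X -> Q Y -> Q (fun p => a *: X p + Y p)) ->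
  field_class g Omega
    (fun Y => forall e : R, 0 < e -> exists X, Q X /\ dist Y X <= e).
Proof.
move=> Qb Q0 Qlin; split.
- by move=> e e0; exists (fun=> 0); rewrite field_distxx ltW.
- move=> a X Y bX bY PX PY e e0.
  have a0 : 0 < 2 * (`|a| + 1) by rewrite mulr_gt0// ltr_wpDl.
  have [X' [QX' dX]] := PX _ (divr_gt0 e0 a0).
  have [Y' [QY' dY]] := PY _ (divr_gt0 e0 (ltr0n R 2)).
  exists (fun p => a *: X' p + Y' p); split; first exact: Qlin.
  rewrite (le_trans (field_dist_lin _ _ _ _ _))//; try exact: Qb.
  rewrite [leRHS](splitr e) lerD//.
  apply: (@le_trans _ _ ((`|a| + 1) * (e / (2 * (`|a| + 1))))).
    by rewrite ler_pM ?field_dist_ge0// lerDl.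
  rewrite le_eqVlt; apply/orP; left; apply/eqP; field.
  by rewrite gt_eqF// ltr_wpDl.
- move=> Y_ Y C bY_ PY_ bY YC Yl e e0.
  have e2 : 0 < e / 2 by rewrite divr_gt0.
  have /cvgrPdist_le/(_ _ e2)[n _ /(_ n (leqnn n)) dn] := field_dist_lim bY_ bY YC Yl.
  rewrite /= sub0r normrN ger0_norm ?field_dist_ge0// in dn.
  have [X [QX dX]] := PY_ n _ e2.
  exists X; split=> //; rewrite (le_trans (field_dist_triangle bY (bY_ n) (Qb _ QX)))//.
  by rewrite [leRHS]splitr lerD.
Qed.

(** The L1 closure of the continuous fields vanishing at infinity is a
    [field_class], and it contains the bump fields. *)
Lemma C0_field_dense Y : bbf Y -> forall e : R, 0 < e ->
  exists X, C0_field g Omega X /\ dist Y X <= e.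
Proof.
move=> bY; have [B [c [bB cB]]] := chart_base oO.
have cl : field_class g Omega (fun Y => forall e : R, 0 < e ->
    exists X, C0_field g Omega X /\ dist Y X <= e).
  apply: field_class_closure.
  - by move=> X; exact: C0_bounded_borel.
  - exact: C0_field0.
  - move=> a X X' CX CX'; apply: C0_fieldD => //.
    by apply: C0_fieldZ => //; exact: Cb_function_cst.
refine (field_class_bumps (bB := bB) (cB := cB) oO cl _ bY).
move=> n k s l e e0; exists (bump_field bB cB n k s l); rewrite field_distxx.
by split; [exact: C0_bump_field|exact: ltW].
Qed.

End field_dist_theory.

(** The property to which the monotone class theorem is applied for uniqueness. *)
Lemma field_class_pairing_eq nu nu' : field_class g Omega (fun Y =>
  \int[tv nu]_(p in Omega) riem g (unit_field nu p) (Y p) =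
  \int[tv nu']_(p in Omega) riem g (unit_field nu' p) (Y p)).
Proof.
have lin (n : covector_measure g Omega) a X Y : bbf X -> bbf Y ->
    \int[tv n]_(p in Omega) riem g (unit_field n p) (a *: X p + Y p) =
    a * \int[tv n]_(p in Omega) riem g (unit_field n p) (X p) +
    \int[tv n]_(p in Omega) riem g (unit_field n p) (Y p).
  move=> bX bY; have bmX := bounded_measurable_pairing oO n bX.
  have bmY := bounded_measurable_pairing oO n bY.
  rewrite -RintZ// -RintD//; last exact: bounded_measurableZ.
  by apply: eq_Rint => p _; rewrite riemDr riemZr.
have lim (n : covector_measure g Omega) (Y_ : nat -> vector_field M) Y (C : R) :
    (forall k, bbf (Y_ k)) -> bbf Y ->
    (forall k p, Omega p -> tangent_norm g (Y_ k p) <= C) ->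
    (forall p, Omega p -> tangent_norm g (Y p - Y_ k p) @[k --> \oo] --> 0) ->
    \int[tv n]_(p in Omega) riem g (unit_field n p) (Y_ k p) @[k --> \oo] -->
    \int[tv n]_(p in Omega) riem g (unit_field n p) (Y p).
  move=> bY_ bY YC Yl; apply: (Rint_cvg mO (C := C)).
  - by move=> k; exact: (bounded_measurable_pairing oO n (bY_ k)).1.
  - exact: bounded_measurable_pairing.
  - move=> k p Op; rewrite (le_trans (normr_riem _ _ _))// -[leRHS]mul1r.
    by rewrite ler_pM ?tangent_norm_ge0 ?unit_field_le1 ?YC.
  - move=> p Op; apply/cvgrPdist_le => e e0.
    have /cvgrPdist_le/(_ _ e0) := Yl p Op; apply: filterS => k.
    rewrite sub0r normrN ger0_norm ?tangent_norm_ge0// -riemBr => H.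
    rewrite (le_trans (normr_riem _ _ _))// (le_trans _ H)//.
    by rewrite ler_piMl ?tangent_norm_ge0 ?unit_field_le1.
split.
- have z (n : covector_measure g Omega) :
      \int[tv n]_(p in Omega) riem g (unit_field n p) 0 = 0.
    transitivity (\int[tv n]_(p in Omega) (0 : R)).
      by apply: eq_Rint => p _; exact: riem0r.
    by rewrite Rintegral_cst// mul0r.
  by rewrite !z.
- by move=> a X Y bX bY XE YE; rewrite !lin// XE YE.
- move=> Y_ Y C bY_ PY_ bY YC Yl.
  have h := lim nu _ _ _ bY_ bY YC Yl; have h' := lim nu' _ _ _ bY_ bY YC Yl.
  have E : (fun k => \int[tv nu]_(p in Omega) riem g (unit_field nu p) (Y_ k p)) =
      (fun k => \int[tv nu']_(p in Omega) riem g (unit_field nu' p) (Y_ k p)).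
    by apply/funext => k; exact: PY_.
  rewrite E in h; exact: (cvg_unique _ h h').
Qed.

(** Testing with [1_A u], where [u] is the unit field of [nu], gives
    [|nu| A <= |nu'| A]; by symmetry the total variations agree, and then
    equality in the Cauchy-Schwarz inequality identifies the unit fields. *)
Lemma pairing_determines nu nu' :
  (forall X, C0_field g Omega X -> pairing nu X = pairing nu' X) -> cm_equiv nu nu'.
Proof.
move=> H; have HY Y : bbf Y ->
    \int[tv nu]_(p in Omega) riem g (unit_field nu p) (Y p) =
    \int[tv nu']_(p in Omega) riem g (unit_field nu' p) (Y p).
  move=> bY; have [B [c [bB cB]]] := chart_base oO.
  refine (field_class_bumps (bB := bB) (cB := cB) oO (field_class_pairing_eq nu nu') _ bY).
  by move=> n k s l; rewrite -!pairingE; apply: H; exact: C0_bump_field.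
have le (n n' : covector_measure g Omega) (A : set (borel M)) :
    (forall Y, bbf Y -> \int[tv n]_(p in Omega) riem g (unit_field n p) (Y p) =
      \int[tv n']_(p in Omega) riem g (unit_field n' p) (Y p)) ->
    measurable A -> A `<=` Omega -> fine (tv n A) <= fine (tv n' A).
  move=> nn mA AO; have b1 := @bounded_measurable_indic _ (borel M) R Omega A mA.
  have bu := bounded_unit_field oO n.
  have fE (k : covector_measure g Omega) : fine (tv k A) = \int[tv k]_(p in Omega) \1_A p.
    by rewrite Rint_indic// setIidl.
  rewrite (fE n) (fE n') -Rint_unit_field//.
  have -> : \int[tv n]_(p in Omega) (\1_A p * riem g (unit_field n p) (unit_field n p)) =
      \int[tv n]_(p in Omega) riem g (unit_field n p) ((\1_A p : R) *: unit_field n p).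
    by apply: eq_Rint => p _; apply/esym; exact: riemZr.
  rewrite (nn _ (bounded_borel_field_indic oO mA bu)).
  by apply: pairing_le => // p _; exact: unit_field_le1.
have tvE (A : set (borel M)) : measurable A -> A `<=` Omega -> tv nu A = tv nu' A.
  move=> mA AO; have f1 : tv nu A \is a fin_num by exact: fin_num_measure.
  have f2 : tv nu' A \is a fin_num by exact: fin_num_measure.
  rewrite -(fineK f1) -(fineK f2); congr EFin; apply/le_anti.
  by rewrite !le// => Y bY; rewrite HY.
split; first exact: tvE.
have bu := bounded_unit_field oO nu; have bu' := bounded_unit_field oO nu'.
pose f (p : borel M) := 1 - riem g (unit_field nu' p) (unit_field nu p).
have b1 := @bounded_measurable_cst _ (borel M) R Omega 1.
have br := bounded_measurable_riem oO bu' bu.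
have bf : bm f by exact: bounded_measurableB.
have f0 p : 0 <= f p.
  rewrite subr_ge0 (le_trans (riem_le _ _ _))//.
  by rewrite mulr_ile1 ?tangent_norm_ge0 ?unit_field_le1.
have intf : \int[tv nu']_(p in Omega) f p = 0.
  rewrite RintB// -HY//.
  have := Rint_unit_field oO nu b1; under eq_Rintegral do rewrite mul1r.
  move=> ->; rewrite !Rintegral_cst// !mul1r; apply/eqP; rewrite subr_eq0; apply/eqP.
  by congr fine; apply/esym; exact: tvE.
pose A : set (borel M) := Omega `&` [set p | f p != 0].
have mA : measurable A.
  have := bf.1 mO _ (measurableC (measurable_set1 (0 : R))); congr measurable.
  by apply/seteqP; split=> p [Op /eqP]; split.
have A0 : tv nu' A = 0%E.
  apply: (Rint_eq0_measure0 mO bf _ _ mA) => [p _|||p []//]; first exact: f0.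
    by rewrite intf.
  by move=> p [].
exists A; split=> //; first by apply: etrans A0; apply: tvE => // p [].
move=> p /= /not_implyP[Op np]; split=> //=; apply/negP => /eqP fp.
apply: np => v; rewrite !polarE; congr (riem g _ v).
apply/eqP; rewrite -subr_eq0; apply/eqP/(riem_eq0 (g := g))/le_anti.
rewrite riem_ge0 andbT riemBr !riemBl (riem_sym g (unit_field nu p) (unit_field nu' p)).
have r1 (n : covector_measure g Omega) : riem g (unit_field n p) (unit_field n p) <= 1.
  by rewrite -tangent_norm_sqr expr_le1// ?tangent_norm_ge0 ?unit_field_le1.
have := r1 nu; have := r1 nu'; move: fp; rewrite /f; lra.
Qed.

Lemma weak_star_cvg_unique (nu_ : nat -> covector_measure g Omega) nu nu' :
  weak_star_cvg nu_ nu -> weak_star_cvg nu_ nu' -> cm_equiv nu nu'.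
Proof.
move=> h h'; apply: pairing_determines => X CX.
exact: (cvg_unique _ (h X CX) (h' X CX)).
Qed.

Lemma weak_weak_star_cvg (nu_ : nat -> covector_measure g Omega) nu :
  weak_cvg nu_ nu -> weak_star_cvg nu_ nu.
Proof. by move=> h X CX; apply: h; exact: C0_Cb_field. Qed.

End uniqueness.

(** * Lower semicontinuity of the total variation *)

Section lower_semicontinuity.
Variables (R : realType) (m : nat) (M : oriented_manifold R m).
Variables (g : riemannian_metric M) (Omega : set M).
Hypothesis oO : open Omega.
Variables (nu_ : nat -> covector_measure g Omega) (nu : covector_measure g Omega).
Hypothesis nuP : weak_star_cvg nu_ nu.
Implicit Types (p : M) (X Y : vector_field M).
Local Notation bbf := (bounded_borel_field g Omega).
Local Notation bm := (bounded_measurable (Omega : set (borel M))).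
Local Notation tv nu :=
  (tv_measure oO nu : {finite_measure set (borel M) -> \bar R}).

Let mO : measurable (Omega : set (borel M)). Proof. exact: borel_open. Qed.

Lemma bounded_measurable_Cb (psi : M -> R) : Cb_function Omega psi -> bm psi.
Proof. by move=> [cp bp]; split=> //; exact: continuous_borel_measurable. Qed.

(** Approximating the unit field [u] of [nu] by a continuous field [X] in the
    unit ball, the integral of [psi] is nearly the pairing of [nu] with
    [psi X], which passes to the limit. *)
Lemma Rint_liminf (psi : M -> R) (e : R) : Cb_function Omega psi ->
  (forall p, Omega p -> 0 <= psi p) -> 0 < e -> \forall n \near \oo,
  \int[tv nu]_(p in Omega) psi p <= \int[tv (nu_ n)]_(p in Omega) psi p + e.
Proof.
move=> Cpsi psi0 e0; have [_ [C CP]] := Cpsi.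
have bpsi := bounded_measurable_Cb Cpsi.
have C1 : 0 < `|C| + 1 by rewrite ltr_wpDl.
(* Truncation at most doubles the distance to the unit field, and [psi] is at
   most [`|C| + 1]; this leaves an error of [e / 2]. *)
have e4 : 0 < e / (4 * (`|C| + 1)) by rewrite divr_gt0// mulr_gt0.
have bu := bounded_unit_field oO nu.
have [X [CX dX]] := C0_field_dense oO (tv nu) bu e4.
pose Z := truncate g X.
have CZ : C0_field g Omega Z by exact: C0_truncate.
have bZ : bbf Z by exact: C0_bounded_borel.
have CpZ : C0_field g Omega (fun p => psi p *: Z p) by exact: C0_fieldZ.
have bpZ := C0_bounded_borel oO CpZ.
have bX := C0_bounded_borel oO CX.
have bd Y : bbf Y -> bm (fun p : borel M => tangent_norm g (unit_field nu p - Y p)).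
  by move=> bY; exact: (bounded_measurable_dist oO bu bY).
have main : \int[tv nu]_(p in Omega) psi p <=
    \int[tv nu]_(p in Omega) riem g (unit_field nu p) (psi p *: Z p) + e / 2.
  rewrite -Rint_unit_field//.
  apply: (@le_trans _ _ (\int[tv nu]_(p in Omega)
    (riem g (unit_field nu p) (psi p *: Z p) +
     2 * (`|C| + 1) * tangent_norm g (unit_field nu p - X p)))).
    apply: le_Rint => //.
    - by apply: bounded_measurableM => //; exact: bounded_measurable_riem.
    - apply: bounded_measurableD; first exact: bounded_measurable_pairing.
      by apply: bounded_measurableZ; exact: bd.
    move=> p Op; have psiC : psi p <= `|C| + 1.
      rewrite (le_trans (ler_norm _))// (le_trans (CP p Op))//.
      by rewrite (le_trans (ler_norm _))// lerDl.
    have := truncate_dist X (unit_field_le1 nu p); rewrite -/Z.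
    move: (unit_field nu p) (unit_field_le1 nu p) (Z p) => u u1 z zd.
    have : riem g u u - riem g u z <= tangent_norm g (u - z).
      rewrite -riemBr (le_trans (riem_le _ _ _))//.
      by rewrite ler_piMl ?tangent_norm_ge0.
    rewrite riemZr => /(ler_wpM2l (psi0 p Op)).
    have := ler_pM (psi0 p Op) (tangent_norm_ge0 g _) psiC zd.
    lra.
  rewrite RintD//; [|exact: bounded_measurable_pairing|].
    2: by apply: bounded_measurableZ; exact: bd.
  rewrite lerD2l RintZ//; last exact: bd.
  apply: (@le_trans _ _ (2 * (`|C| + 1) * (e / (4 * (`|C| + 1))))).
    by rewrite ler_wpM2l// mulr_ge0// ltW.
  by rewrite le_eqVlt; apply/orP; left; apply/eqP; field; rewrite gt_eqF.
have e2 : 0 < e / 2 by rewrite divr_gt0.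
have /cvgrPdist_le/(_ _ e2) := nuP CpZ; apply: filterS => n.
rewrite !(pairingE oO) => /(le_trans (ler_norm _)) H.
have H' := @pairing_le _ _ _ _ _ oO (nu_ n) Z psi bZ bpsi psi0
  (fun p _ => truncate_le1 g X p).
rewrite lerBlDl in H; exact: approx_chain main H H'.
Qed.

(** The indicator of [U] is the limit of the functions
    [min 1 (l * \sum_j b j)], where [b j] are bump functions of the first members
    of the base that have their closure in [U]. *)
Lemma tv_liminf (U : set M) (e : R) : open U -> U `<=` Omega -> 0 < e ->
  \forall n \near \oo, fine (tv nu U) <= fine (tv (nu_ n) U) + e.
Proof.
move=> oU UO e0; have [B [c [bB cB]]] := chart_base oO.
have mU : measurable (U : set (borel M)) by exact: borel_open.
have [b bP] := choice (fun j => base_bump bB cB j [:: j]).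
have VE j : finite_union B [:: j] `&` B j = B j.
  by rewrite /finite_union big_seq1 setIid.
pose s l := [seq j <- iota 0 l | `[< closure (B j) `<=` U >]].
pose psi l p := Num.min 1 (l%:R * \sum_(j <- s l) b j p).
have b0 j p : 0 <= b j p by have [_ /(_ p)/andP[]] := bP j.
have psi01 l p : 0 <= psi l p <= 1.
  rewrite /psi le_min ler01 ge_min lexx !andbT mulr_ge0//.
  by apply: sumr_ge0 => j _.
have psi_out l p : ~ U p -> psi l p = 0.
  move=> nU; rewrite /psi big_seq big1 ?mulr0 ?min_r ?ler01// => j.
  rewrite mem_filter => /andP[/asboolP jU _].
  have [_ _ _ + _] := bP j; apply; rewrite VE => Bjp; apply: nU; apply: jU.
  exact: subset_closure.
have psi_in p : U p -> \forall l \near \oo, psi l p = 1.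
  move=> Up; have [_ _ _ /(_ U p oU Up (UO p Up))[j [Bjp jU]]] := bB.
  have bj : 0 < b j p by have [_ _ + _ _] := bP j; apply; rewrite VE.
  near=> l; rewrite /psi min_l//.
  have js : j \in s l.
    rewrite mem_filter mem_iota/= add0n; apply/andP; split; first exact/asboolP.
    by near: l; exact: nbhs_infty_gt.
  have lb : 1 <= l%:R * b j p.
    by rewrite -ler_pdivrMr// div1r; near: l; exact: nbhs_infty_ger.
  rewrite (le_trans lb)// ler_wpM2l// (big_rem j)//= lerDl.
  by apply: sumr_ge0.
have Cpsi l : Cb_function Omega (psi l).
  split; last by exists 1 => p _; have /andP[p0 p1] := psi01 l p; rewrite ger0_norm.
  move=> p _; apply: (@continuous_min _ _ (fun=> 1) (fun q => l%:R * \sum_(j <- s l) b j q)).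
    exact: cvg_cst.
  apply: cvgM; first exact: cvg_cst.
  by apply: cvg_sum_seq => j; have [+ _ _ _ _] := bP j; apply.
have bpsi l := bounded_measurable_Cb (Cpsi l).
have b1 : bm (\1_U : borel M -> R) by exact: bounded_measurable_indic.
have tvU k : fine (tv k U) = \int[tv k]_(p in Omega) (\1_U p : R).
  by rewrite Rint_indic// setIidl.
have : \int[tv nu]_(p in Omega) psi l p @[l --> \oo] --> \int[tv nu]_(p in Omega) (\1_U p : R).
  apply: (Rint_cvg mO (C := 1)) => //.
  - by move=> l; exact: (bpsi l).1.
  - by move=> l p _; have /andP[p0 p1] := psi01 l p; rewrite ger0_norm.
  move=> p Op; apply: cvg_near_cst; rewrite indicE.
  have [/set_mem Up|/negP nU] := boolP (p \in U).
    by apply: filterS (psi_in p Up).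
  by apply: nearW => l; rewrite psi_out// => Up; apply: nU; exact: mem_set.
have e2 : 0 < e / 2 by rewrite divr_gt0.
move=> /cvgrPdist_le/(_ _ e2)[l _ /(_ l (leqnn l))] /= /(le_trans (ler_norm _)) H.
have := Rint_liminf (Cpsi l) (fun p _ => (andP (psi01 l p)).1) e2.
apply: filterS => n H'.
have H'' : \int[tv (nu_ n)]_(p in Omega) psi l p <= \int[tv (nu_ n)]_(p in Omega) (\1_U p : R).
  apply: le_Rint => // p _; rewrite indicE.
  have [/set_mem Up|/negP nU] := boolP (p \in U); first by have /andP[] := psi01 l p.
  by rewrite psi_out// => Up; apply: nU; exact: mem_set.
rewrite lerBlDl in H; rewrite (tvU _ nu) (tvU _ (nu_ n)).
exact: approx_chain H H' H''.
Unshelve. all: by end_near. Qed.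

Lemma tot_var_liminf (U : set M) : open U -> U `<=` Omega ->
  (tot_var nu U <= limn_einf (fun n => tot_var (nu_ n) U))%E.
Proof.
move=> oU UO; have mU : measurable (U : set (borel M)) by exact: borel_open.
apply/lee_addgt0Pr => e e0.
have [N _ NP] := tv_liminf oU UO e0.
have -> : limn_einf (fun n => tot_var (nu_ n) U) =
    ereal_sup (range (einfs (fun n => tot_var (nu_ n) U))).
  by rewrite limn_einf_lim; apply/cvg_lim => //; exact: cvg_einfs_sup.
rewrite -leeBlDr//; apply: (@le_trans _ _ (einfs (fun n => tot_var (nu_ n) U) N)).
  apply: le_ereal_inf_tmp => _ [n /= Nn <-].
  have fE (k : covector_measure g Omega) : tot_var k U = (fine (tv k U))%:E.
    by rewrite -[LHS](fineK (fin_num_measure (tv k) _ mU)).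
  rewrite (fE nu) (fE (nu_ n)) -EFinD lee_fin lerBlDr; exact: NP.
by apply: ereal_sup_ubound; exists N.
Qed.

(** Apply the lower bound to [C + psi] and to [C - psi]; the masses converge. *)
Lemma tot_var_weak_cvg :
  (limn_esup (fun n => tot_var (nu_ n) Omega) <= tot_var nu Omega)%E ->
  weak_cvg_measure Omega (fun n => tot_var (nu_ n)) (tot_var nu).
Proof.
move=> lim psi Cpsi; have [cpsi [C0 CP0]] := Cpsi.
pose C := `|C0| + 1; have C1 : 0 < C by rewrite ltr_wpDl.
have CP p : Omega p -> `|psi p| <= C.
  by move=> /CP0 /le_trans; apply; rewrite (le_trans (ler_norm _))// lerDl.
have bpsi := bounded_measurable_Cb Cpsi.
have mass (e : R) : 0 < e -> \forall n \near \oo,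
    fine (tv (nu_ n) Omega) <= fine (tv nu Omega) + e.
  move=> e0.
  have lt : (limn_esup (fun n => tot_var (nu_ n) Omega) < tot_var nu Omega + e%:E)%E.
    rewrite (le_lt_trans lim)// lteDl// ?lte_fin//.
    exact: (fin_num_measure (tv nu)).
  have E : limn_esup (fun n => tot_var (nu_ n) Omega) =
      ereal_inf (range (esups (fun n => tot_var (nu_ n) Omega))).
    by rewrite limn_esup_lim; apply/cvg_lim => //; exact: cvg_esups_inf.
  rewrite E in lt.
  have [_ [N _ <-] Nlt] := ereal_inf_lt lt.
  exists N => // n /= Nn; rewrite -lee_fin EFinD !fineK; try exact: fin_num_measure.
  by rewrite (le_trans _ (ltW Nlt))//; apply: ereal_sup_ubound; exists n.
have half (s e : R) : `|s| = 1 -> 0 < e -> \forall n \near \oo,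
    s * \int[tv nu]_(p in Omega) psi p <= s * \int[tv (nu_ n)]_(p in Omega) psi p + e.
  move=> s1 e0; have e2 : 0 < e / 2 by rewrite divr_gt0.
  have eC : 0 < e / 2 / C by rewrite divr_gt0.
  have Cs : Cb_function Omega (fun p => C + s * psi p).
    split.
      move=> p Op; apply: cvgD; first exact: cvg_cst.
      by apply: cvgM; [exact: cvg_cst|exact: cpsi].
    exists (C + C) => p Op; rewrite (le_trans (ler_normD _ _))// gtr0_norm// lerD2l.
    by rewrite normrM s1 mul1r CP.
  have Cs0 p : Omega p -> 0 <= C + s * psi p.
    move=> Op; have : `|s * psi p| <= C by rewrite normrM s1 mul1r CP.
    by rewrite ler_norml => /andP[+ _]; rewrite -lerBlDl sub0r.
  have I k : \int[tv k]_(p in Omega) (C + s * psi p) =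
      C * fine (tv k Omega) + s * \int[tv k]_(p in Omega) psi p.
    rewrite RintD//; [|exact: bounded_measurable_cst|exact: bounded_measurableZ].
    by rewrite Rintegral_cst// RintZ.
  apply: filterS (filterI (Rint_liminf Cs Cs0 e2) (mass _ eC)) => n [].
  rewrite !I => h1 h2.
  have : C * fine (tv (nu_ n) Omega) <= C * fine (tv nu Omega) + e / 2.
    apply: le_trans (ler_wpM2l (ltW C1) h2) _.
    by rewrite mulrDr [C * (_ / _)]mulrC divfK// gt_eqF.
  exact: approx_cancel h1.
suff : \int[tv (nu_ n)]_(p in Omega) psi p @[n --> \oo] --> \int[tv nu]_(p in Omega) psi p.
  exact.
apply/cvgrPdist_le => e e0.
have h1 := half 1 e (normr1 _) e0; have h2 := half (-1) e (normrN1 _) e0.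
apply: filterS (filterI h1 h2) => n [{}h1 {}h2].
by rewrite ler_norml; apply/andP; split; move: h1 h2; lra.
Qed.

End lower_semicontinuity.

(** * Pairings and densities *)

Section pairing_theory.
Variables (R : realType) (m : nat) (M : oriented_manifold R m).
Variables (g : riemannian_metric M) (Omega : set M).
Hypothesis oO : open Omega.
Implicit Types (p : M) (X Y : vector_field M) (nu : covector_measure g Omega).
Local Notation bbf := (bounded_borel_field g Omega).
Local Notation bm := (bounded_measurable (Omega : set (borel M))).
Local Notation tv nu :=
  (tv_measure oO nu : {finite_measure set (borel M) -> \bar R}).

Let mO : measurable (Omega : set (borel M)). Proof. exact: borel_open. Qed.

Lemma pairing_lin nu a X Y : bbf X -> bbf Y ->
  pairing nu (fun p => a *: X p + Y p) = a * pairing nu X + pairing nu Y.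
Proof.
move=> bX bY; rewrite !(pairingE oO).
have bmX := bounded_measurable_pairing oO nu bX.
have bmY := bounded_measurable_pairing oO nu bY.
rewrite -RintZ// -RintD//; last exact: bounded_measurableZ.
by apply: eq_Rint => p _; rewrite riemDr riemZr.
Qed.

Lemma pairing_dist nu X Y : bbf X -> bbf Y ->
  `|pairing nu X - pairing nu Y| <= field_dist g Omega (tv nu) X Y.
Proof.
move=> bX bY; rewrite !(pairingE oO).
have bmX := bounded_measurable_pairing oO nu bX.
have bmY := bounded_measurable_pairing oO nu bY.
rewrite -RintB// (le_trans (normr_Rint mO _ _))//; first exact: bounded_measurableB.
apply: le_Rint => //.
- by apply: bounded_measurable_norm; exact: bounded_measurableB.
- exact: bounded_measurable_dist.
move=> p _; rewrite -riemBr (le_trans (normr_riem _ _ _))//.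
by rewrite ler_piMl ?tangent_norm_ge0 ?unit_field_le1.
Qed.

(** For indicators this is the definition of [tot_var]; linear combinations and
    uniform limits give all bounded measurable functions. *)
Lemma Rint_tv nu (f : borel M -> R) : bm f ->
  \int[tv nu]_(p in Omega) f p =
  \int[cm_measure nu]_(p in Omega) (f p * cotangent_norm g (cm_density nu p)).
Proof.
pose s p := cotangent_norm g (cm_density nu p).
have s0 p : 0 <= s p by rewrite /s cotangent_normE tangent_norm_ge0.
have bs : bm s.
  split; first by apply: measurable_cotangent_norm => //; exact: cm_borel.
  have [C CP] := cm_bounded nu; exists C => p Op.
  by rewrite ger0_norm ?s0//; exact: CP.
have bfs h : bm h -> bm (fun p => h p * s p).
  by move=> bh; exact: bounded_measurableM.
move: f; apply: (@bounded_measurable_ind _ _ R (Omega : set (borel M))) => //.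
- move=> A mA; rewrite Rint_indic//.
  have -> : tv nu (A `&` Omega) = tot_var nu A by exact: tv_setIO.
  rewrite /tot_var.
  transitivity (\int[cm_measure nu]_(p in A `&` Omega) s p); first by [].
  rewrite setIC Rintegral_mkcondr; apply: eq_Rint => p Op.
  rewrite /patch indicE; case: (p \in A); first by rewrite mul1r.
  by rewrite mul0r.
- move=> a f h bf bh IHf IHh.
  have -> : \int[cm_measure nu]_(p in Omega) ((a * f p + h p) * s p) =
      \int[cm_measure nu]_(p in Omega) (a * (f p * s p) + h p * s p).
    by apply: eq_Rint => p _; rewrite mulrDl mulrA.
  rewrite !RintD// ?RintZ//; try exact: bfs; try exact: bounded_measurableZ; last first.
    by apply: bounded_measurableZ; exact: bfs.
  by rewrite IHf IHh.
- move=> f bf H; apply/eqP; rewrite -subr_eq0 -normr_eq0; apply/eqP/le_anti.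
  rewrite normr_ge0 andbT; apply/ler_addgt0Pr => e e0; rewrite add0r.
  pose C := \int[tv nu]_(p in Omega) (1 : R) + \int[cm_measure nu]_(p in Omega) s p.
  have C0 : 0 <= C by rewrite addr_ge0// Rintegral_ge0.
  have C1 : 0 < C + 1 by rewrite ltr_wpDl.
  have [h [bh IHh fh]] := H _ (divr_gt0 e0 C1).
  set d := e / (C + 1) in fh.
  have b1 := @bounded_measurable_cst _ (borel M) R Omega d.
  have d0 : 0 <= d by rewrite divr_ge0// ltW.
  have h1 : `|\int[tv nu]_(p in Omega) f p - \int[tv nu]_(p in Omega) h p| <=
      d * \int[tv nu]_(p in Omega) 1.
    rewrite -RintB// (le_trans (normr_Rint mO _ _))//; first exact: bounded_measurableB.
    rewrite -RintZ//; last exact: bounded_measurable_cst.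
    apply: le_Rint => //.
    - by apply: bounded_measurable_norm; exact: bounded_measurableB.
    - by apply: bounded_measurableZ; exact: bounded_measurable_cst.
    by move=> p Op; rewrite mulr1 fh.
  have h2 : `|\int[cm_measure nu]_(p in Omega) (f p * s p) -
      \int[cm_measure nu]_(p in Omega) (h p * s p)| <=
      d * \int[cm_measure nu]_(p in Omega) s p.
    rewrite -RintB//; try exact: bfs.
    rewrite (le_trans (normr_Rint mO _ _))//.
      by apply: bounded_measurableB; exact: bfs.
    rewrite -RintZ//; apply: le_Rint => //.
    - by apply: bounded_measurable_norm; apply: bounded_measurableB; exact: bfs.
    - exact: bounded_measurableZ.
    by move=> p Op; rewrite -mulrBl normrM (ger0_norm (s0 p)) ler_wpM2r// fh.
  rewrite IHh in h1.
  have := ler_distD (\int[cm_measure nu]_(p in Omega) (h p * s p))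
    (\int[tv nu]_(p in Omega) f p) (\int[cm_measure nu]_(p in Omega) (f p * s p)).
  move=> /le_trans; apply; rewrite [X in _ + X]distrC.
  rewrite (le_trans (lerD h1 h2))// -mulrDr -/C /d mulrAC ler_pdivrMr//.
  by rewrite ler_wpM2l ?lerDl// ltW.
Qed.

Lemma pairing_density nu X : bbf X ->
  pairing nu X = \int[cm_measure nu]_(p in Omega) cm_density nu p (X p).
Proof.
move=> bX; rewrite (pairingE oO) Rint_tv; last exact: bounded_measurable_pairing.
apply: eq_Rint => p Op; rewrite -polarE /polar.
have [s0|s0] := eqVneq (cotangent_norm g (cm_density nu p)) 0; last by rewrite divfK.
rewrite s0 mulr0; apply/esym/normr0_eq0/le_anti; rewrite normr_ge0 andbT.
rewrite -(sharpE g) (le_trans (normr_riem _ _ _))//.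
by rewrite -cotangent_normE s0 mul0r.
Qed.

End pairing_theory.

Section covector_of.
Variables (R : realType) (m : nat) (M : oriented_manifold R m).

Definition covector_fun (i : chart_index M) (p : M) (w : 'I_m -> R)
  (v : tangent M p) : R := \sum_k w k * v i 0 k.

Lemma covector_fun_linear i p w : scalar (@covector_fun i p w).
Proof.
move=> a u v; rewrite /covector_fun mulr_sumr -big_split/=; apply: eq_bigr => k _.
transitivity (w k * (a *: u i + v i) 0 k); first by [].
by rewrite !mxE mulrDr mulrCA.
Qed.

HB.instance Definition _ i p w := GRing.isLinear.Build R (tangent M p) R *%R
  (@covector_fun i p w) (@covector_fun_linear i p w).

Definition covector_of i p w : {scalar tangent M p} := @covector_fun i p w.

End covector_of.

(** * Covector fields given on the pieces *)

Section gluing.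
Variables (R : realType) (m : nat) (M : oriented_manifold R m).
Variables (g : riemannian_metric M) (Omega : set M).
Hypothesis oO : open Omega.
Variables (B : nat -> set M) (c : nat -> chart_index M).
Hypotheses (bB : compact_base Omega B)
  (cB : forall n, closure (B n) `<=` chart_dom (atlas (c n))).
Implicit Types (p : M) (X Y : vector_field M).
Local Notation bbf := (bounded_borel_field g Omega).

Lemma piece_inj n k p : piece B n p -> piece B k p -> n = k.
Proof.
move=> [Bn nn] [Bk nk]; apply/eqP; rewrite eqn_leq; apply/andP; split; rewrite leqNgt.
  by apply/negP => kn; apply: nn; rewrite /covered -bigcup_mkord; exists k.
by apply/negP => nk'; apply: nk; rewrite /covered -bigcup_mkord; exists n.
Qed.

Lemma bigcup_piece : Omega = \bigcup_n piece B n :> set (borel M).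
Proof.
have [_ _ BO Bb] := bB; apply/seteqP; split=> [p Op|p [n _ [Bnp _]]]; last first.
  by apply: (BO n); exact: subset_closure.
have [n0 [Bn0 _]] := Bb setT p openT Logic.I Op.
have ex : exists n, `[< B n p >] by exists n0; exact/asboolP.
have [n /asboolP Bn nmin] := ex_minnP ex.
exists n => //; split=> //; rewrite /covered -bigcup_mkord => -[k /= kn Bk].
by have := nmin k (asboolT Bk); rewrite leqNgt kn.
Qed.

Definition piece_index p : nat := xget 0%N [set n | piece B n p].

Lemma piece_indexE n p : piece B n p -> piece_index p = n.
Proof.
by move=> np; apply: xget_unique => //= k kp; exact: piece_inj kp np.
Qed.

(** The pieces being disjoint, components found chart by chart assemble into one
    covector field; outside of [Omega], [piece_index] takes a default value. *)
Definition glued (w : nat -> 'I_m -> borel M -> R) : covector_field M :=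
  fun p => covector_of (c (piece_index p)) p (fun k => w (piece_index p) k p).

Lemma gluedE w n p (v : tangent M p) : piece B n p ->
  glued w p v = \sum_k w n k p * v (c n) 0 k.
Proof. by move=> np; rewrite /glued (piece_indexE np). Qed.

Lemma glued_frame w n k p : piece B n p -> glued w p (frame (c n) k p) = w n k p.
Proof.
move=> np; rewrite (gluedE _ _ np).
have ip : chart_dom (atlas (c n)) p.
  by apply: cB; apply: subset_closure; exact: (piece_sub np).
have -> : frame (c n) k p (c n) = delta_mx 0 k by exact: tangent_ofE.
rewrite (bigD1 k)//= mxE !eqxx mulr1 big1 ?addr0// => l lk.
by rewrite mxE (negbTE lk) mulr0.
Qed.

Lemma borel_glued w : (forall n k, measurable_fun setT (w n k)) ->
  borel_covector_field Omega (glued w).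
Proof.
move=> mw.
have mg Y : borel_field Omega Y ->
    measurable_fun (Omega : set (borel M)) (fun p : borel M => glued w p (Y p)).
  move=> bY; rewrite bigcup_piece.
  apply/(measurable_fun_bigcup _ (measurable_piece bB)) => n.
  apply: (eq_measurable_fun (fun p : borel M => \sum_k w n k p * Y p (c n) 0 k)).
    by move=> p /set_mem pp; exact/esym/gluedE.
  apply: measurable_sum => k; apply: measurable_funM.
    exact: measurable_funTS.
  apply: (measurable_funS (measurableOU oO (c n))) (bY (c n) k).
  have [_ _ BO _] := bB.
  by move=> p /piece_sub Bp; split; [apply: (BO n)|apply: cB]; exact: subset_closure.
move=> i; exists (fun k p => glued w p (frame i k p)); split.
  move=> k; apply: measurable_funS (mg _ (borel_field_frame oO i k)) => //.
  exact: measurableO.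
move=> p Op ip v; rewrite [in LHS](frameE v ip) linear_sum/=.
by apply: eq_bigr => k _; rewrite linearZ/= mulrC.
Qed.

End gluing.

(** * Functionals dominated by a measure *)

Section extension.
Variables (R : realType) (m : nat) (M : oriented_manifold R m).
Variables (g : riemannian_metric M) (Omega : set M).
Hypothesis oO : open Omega.
Variable mu : {finite_measure set (borel M) -> \bar R}.
Implicit Types (p : M) (X Y : vector_field M).
Local Notation bbf := (bounded_borel_field g Omega).
Local Notation bm := (bounded_measurable (Omega : set (borel M))).
Local Notation dist := (field_dist g Omega mu).

Let mO : measurable (Omega : set (borel M)). Proof. exact: borel_open. Qed.

(** [L] is uniformly continuous for the L1 distance on a dense subspace. *)
Lemma extend_functional (L : vector_field M -> R) :
  (forall a X Y, C0_field g Omega X -> C0_field g Omega Y ->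
     L (fun p => a *: X p + Y p) = a * L X + L Y) ->
  (forall X Y, C0_field g Omega X -> C0_field g Omega Y ->
     `|L X - L Y| <= dist X Y) ->
  exists L' : vector_field M -> R, [/\
    forall a X Y, bbf X -> bbf Y ->
      L' (fun p => a *: X p + Y p) = a * L' X + L' Y,
    forall X Y, bbf X -> bbf Y -> `|L' X - L' Y| <= dist X Y &
    forall X, C0_field g Omega X -> L' X = L X].
Proof.
move=> Llin Ldist.
have Cb X : C0_field g Omega X -> bbf X by exact: C0_bounded_borel.
(* As in the Hahn-Banach theorem, each lower bound [L X - dist Y X] for a value
   at [Y] lies below each upper bound [L X' + dist Y X']. *)
have ex Y : exists r : R, bbf Y -> forall X, C0_field g Omega X ->
    `|r - L X| <= dist Y X.
  have [bY|] := pselect (bbf Y); last by exists 0.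
  pose S := [set L X + dist Y X | X in C0_field g Omega].
  have lb X : C0_field g Omega X -> lbound S (L X - dist Y X).
    move=> CX _ [X' CX' <-]; rewrite lerBlDr -addrA -lerBlDl.
    rewrite (le_trans (ler_norm _))// (le_trans (Ldist _ _ CX CX'))//.
    rewrite (le_trans (field_dist_triangle oO mu (Cb _ CX) bY (Cb _ CX')))//.
    by rewrite addrC [dist X Y]field_distC.
  have C00 := @C0_field0 _ _ _ g Omega.
  have hS : has_inf S.
    split; first by exists (L (fun=> 0) + dist Y (fun=> 0)); exists (fun=> 0).
    by exists (L (fun=> 0) - dist Y (fun=> 0)); exact: lb.
  exists (inf S) => _ X CX; rewrite ler_distl; apply/andP; split.
    by apply: lb_le_inf; [exact: hS.1|exact: lb].
  by apply: ge_inf; [exact: hS.2|exists X].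
have [L' L'P] := choice ex.
exists L'; split.
- move=> a X Y bX bY; apply/eqP; rewrite -subr_eq0 -normr_eq0; apply/eqP/le_anti.
  rewrite normr_ge0 andbT; apply/ler_addgt0Pr => e e0; rewrite add0r.
  have a0 : 0 < 2 * (`|a| + 1) by rewrite mulr_gt0// ltr_wpDl.
  have d0 := divr_gt0 e0 a0.
  have [X' [CX' dX]] := C0_field_dense oO mu bX d0.
  have [Y' [CY' dY]] := C0_field_dense oO mu bY d0.
  set d := e / _ in d0 dX dY.
  have bZ : bbf (fun p => a *: X p + Y p).
    by apply: bounded_borel_fieldD => //; apply: bounded_borel_fieldZ => //; exact: bounded_measurable_cst.
  have CZ' : C0_field g Omega (fun p => a *: X' p + Y' p).
    by apply: C0_fieldD => //; apply: C0_fieldZ => //; exact: Cb_function_cst.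
  have hX := le_trans (L'P X bX X' CX') dX.
  have hY := le_trans (L'P Y bY Y' CY') dY.
  have hZ := L'P _ bZ _ CZ'.
  have dZ := field_dist_lin oO mu a bX bY (Cb _ CX') (Cb _ CY').
  rewrite Llin// in hZ.
  have ad : `|a| * dist X X' <= `|a| * d by rewrite ler_wpM2l.
  have aL : `|a * L' X - a * L X'| <= `|a| * d.
    by rewrite -mulrBr normrM ler_wpM2l.
  have de : 2 * (`|a| * d + d) <= e.
    rewrite /d le_eqVlt; apply/orP; left; apply/eqP; field.
    by rewrite gt_eqF// ltr_wpDl.
  move: (L' _) (a * L' X) (L' Y) (a * L X') (L Y') hZ hY aL => z x y x' y' hZ hY aL.
  have hZ' := le_trans hZ (le_trans dZ (lerD ad dY)).
  move: (`|a| * d) hZ' aL de => ad' hZ' aL de.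
  move: hZ' hY aL; rewrite !ler_norml => /andP[? ?] /andP[? ?] /andP[? ?].
  by apply/andP; split; move: de; lra.
- move=> X Y bX bY; apply/ler_addgt0Pr => e e0.
  have [X' [CX' dX]] := C0_field_dense oO mu bX (divr_gt0 e0 (ltr0n R 2)).
  have h1 := L'P X bX X' CX'; have h2 := L'P Y bY X' CX'.
  have := field_dist_triangle oO mu bY bX (Cb _ CX'); rewrite (field_distC g Omega mu Y X).
  move=> h3; rewrite distrC in h2.
  have := ler_distD (L X') (L' X) (L' Y) => h4; move: h1 h2 h3 h4 dX.
  move: (dist _ _) (dist _ _) (dist _ _) `|_| `|_| `|_| => *; lra.
- move=> X CX; apply/eqP; rewrite -subr_eq0 -normr_le0.
  by rewrite (le_trans (L'P X (Cb _ CX) X CX))// field_distxx.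
Qed.

End extension.

Section representation.
Variables (R : realType) (m : nat) (M : oriented_manifold R m).
Variables (g : riemannian_metric M) (Omega : set M).
Hypothesis oO : open Omega.
Variable mu : {finite_measure set (borel M) -> \bar R}.
Implicit Types (p : M) (X Y : vector_field M).
Local Notation bbf := (bounded_borel_field g Omega).
Local Notation bm := (bounded_measurable (Omega : set (borel M))).
Local Notation dist := (field_dist g Omega mu).

Let mO : measurable (Omega : set (borel M)). Proof. exact: borel_open. Qed.

Variable L : vector_field M -> R.
Hypothesis L_lin : forall a X Y, bbf X -> bbf Y ->
  L (fun p => a *: X p + Y p) = a * L X + L Y.
Hypothesis L_dist : forall X Y, bbf X -> bbf Y -> `|L X - L Y| <= dist X Y.

Let L0 : L (fun=> 0) = 0.
Proof.
have b0 := @bounded_borel_field0 _ _ _ g Omega.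
have := L_lin 1 b0 b0.
rewrite (_ : (fun p : M => _) = (fun=> 0)); last first.
  by apply: functional_extensionality_dep => p; rewrite scaler0 addr0.
by rewrite mul1r => /eqP; rewrite addrC -subr_eq subrr eq_sym => /eqP.
Qed.

Let L_le Y : bbf Y -> `|L Y| <= \int[mu]_(p in Omega) tangent_norm g (Y p).
Proof.
move=> bY; have b0 := @bounded_borel_field0 _ _ _ g Omega.
have := L_dist bY b0; rewrite L0 subr0 => /le_trans; apply.
by rewrite le_eqVlt; apply/orP; left; apply/eqP; apply: eq_Rint => p _; rewrite subr0.
Qed.

Let L_lim (Y_ : nat -> vector_field M) Y (C : R) :
  (forall n, bbf (Y_ n)) -> bbf Y ->
  (forall n p, Omega p -> tangent_norm g (Y_ n p) <= C) ->
  (forall p, Omega p -> tangent_norm g (Y p - Y_ n p) @[n --> \oo] --> 0) ->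
  L (Y_ n) @[n --> \oo] --> L Y.
Proof.
move=> bY_ bY YC Yl; apply/cvgrPdist_le => e e0.
have /cvgrPdist_le/(_ _ e0) := field_dist_lim oO mu bY_ bY YC Yl.
apply: filterS => n; rewrite sub0r normrN ger0_norm ?field_dist_ge0//.
by apply: le_trans; exact: L_dist.
Qed.

Section pieces.
Variables (B : nat -> set M) (c : nat -> chart_index M).
Hypotheses (bB : compact_base Omega B)
  (cB : forall n, closure (B n) `<=` chart_dom (atlas (c n))).

(** The coordinate fields being bounded on a piece, [L] is dominated by [mu]
    on their cut-offs, and Radon-Nikodym applies. *)
Lemma component_densities : exists h : nat -> 'I_m -> borel M -> R,
  (forall n k, measurable_fun setT (h n k)) /\
  forall n k A, measurable (A : set (borel M)) -> A `<=` piece B n ->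
    L (cut_frame c n k A) = \int[mu]_(p in A) h n k p.
Proof.
have [_ _ BO _] := bB.
have BO' n : B n `<=` Omega by move=> p Bp; apply: (BO n); exact: subset_closure.
have mP := measurable_piece bB.
have ex (nk : nat * 'I_m) : exists h : borel M -> R, measurable_fun setT h /\
    forall A, measurable (A : set (borel M)) -> A `<=` piece B nk.1 ->
    L (cut_frame c nk.1 nk.2 A) = \int[mu]_(p in A) h p.
  case: nk => n k /=; have [C CP] := frame_bounded g bB cB n k.
  pose rho (A : set (borel M)) := L (cut_frame c n k (A `&` piece B n)).
  have bcf (A : set (borel M)) : measurable A -> bbf (cut_frame c n k (A `&` piece B n)).
    move=> mA; apply: (bounded_cut_frame g oO bB cB); first exact: measurableI.
    by move=> p [_ /piece_sub].
  have rhoD (A D : set (borel M)) : measurable A -> measurable D -> A `&` D = set0 ->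
      rho (A `|` D) = rho A + rho D.
    move=> mA mD AD; rewrite /rho -[X in X + _]mul1r -L_lin; try exact: bcf.
    congr L; apply: functional_extensionality_dep => p.
    rewrite /cut_frame scale1r setIUl indicU_disj ?scalerDl//.
    by rewrite setIACA AD set0I.
  have rhoC (A : set (borel M)) : measurable A -> `|rho A| <= `|C| * fine (mu A).
    move=> mA; rewrite (le_trans (L_le (bcf A mA)))//.
    have b1 := @bounded_measurable_indic _ (borel M) R Omega A mA.
    apply: (@le_trans _ _ (\int[mu]_(p in Omega) (`|C| * \1_A p))).
      apply: le_Rint => //.
      - exact/(bounded_measurable_tangent_norm oO)/bcf.
      - exact: bounded_measurableZ.
      move=> p Op; rewrite /cut_frame tangent_normZ !indicE in_setI.
      have [pA|_] := boolP (p \in A); last by rewrite normr0 mul0r mulr0.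
      have [/set_mem/piece_sub Bp|_] := boolP (p \in piece B n); last first.
        by rewrite normr0 mul0r mulr1.
      by rewrite normr1 mul1r mulr1 (le_trans (CP _ Bp))// ler_norm.
    rewrite RintZ// Rint_indic// ler_wpM2l// fine_le ?fin_num_measure//.
      exact: measurableI.
    by apply: le_measure; rewrite ?inE//; exact: measurableI.
  have [h [mh _ hP]] := dominated_additive_density rhoD rhoC.
  exists h; split=> // A mA AP; rewrite -hP// /rho; congr (L (cut_frame c n k _)).
  by apply/esym/setIidl.
have [h hP] := choice ex.
exists (fun n k => h (n, k)); split; first by move=> n k; exact: (hP (n, k)).1.
by move=> n k; exact: (hP (n, k)).2.
Qed.

(** The formula for [1_T Y] is stable under bounded limits because the glued
    density is bounded on [T]. *)
Lemma functional_bounded_density h (T : set (borel M)) (N : R) :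
  (forall n k, measurable_fun setT (h n k)) ->
  (forall n k A, measurable (A : set (borel M)) -> A `<=` piece B n ->
    L (cut_frame c n k A) = \int[mu]_(p in A) h n k p) ->
  measurable T -> T `<=` Omega ->
  (forall p, T p -> cotangent_norm g (glued B c h p) <= N) ->
  forall Y, bbf Y -> L (fun p => (\1_T p : R) *: Y p) =
    \int[mu]_(p in Omega) (\1_T p * glued B c h p (Y p)).
Proof.
move=> mh hP mT TO TN.
have bs := borel_glued oO bB cB mh.
have le Y (C : R) p : Omega p -> tangent_norm g (Y p) <= C ->
    `|\1_T p * glued B c h p (Y p)| <= `|N| * `|C|.
  move=> Op YC; rewrite normrM indicE.
  have [/set_mem Tp|_] := boolP (p \in T); last by rewrite normr0 mul0r mulr_ge0.
  rewrite normr1 mul1r -(sharpE g) (le_trans (normr_riem _ _ _))//.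
  rewrite -cotangent_normE ler_pM ?tangent_norm_ge0//.
    by rewrite cotangent_normE tangent_norm_ge0.
    by rewrite (le_trans (TN _ Tp))// ler_norm.
  by rewrite (le_trans YC)// ler_norm.
have b1 := @bounded_measurable_indic _ (borel M) R Omega T mT.
have mf Y : bbf Y -> measurable_fun (Omega : set (borel M))
    (fun p : borel M => \1_T p * glued B c h p (Y p)).
  move=> [bY _]; apply: measurable_funM; first exact: b1.1.
  exact: measurable_covector.
have bf Y : bbf Y -> bm (fun p : borel M => \1_T p * glued B c h p (Y p)).
  move=> bY; split; first exact: mf.
  by have [C CP] := bY.2; exists (`|N| * `|C|) => p Op; apply: le => //; exact: CP.
have bT Y : bbf Y -> bbf (fun p => (\1_T p : R) *: Y p).
  by move=> bY; exact: bounded_borel_field_indic.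
refine (field_class_pieces oO bB cB _ _).
  split.
  - rewrite (_ : (fun p : M => _) = (fun=> 0)); last first.
      by apply: functional_extensionality_dep => p; rewrite scaler0.
    rewrite L0; transitivity (\int[mu]_(p in Omega) (0 : R)).
      by rewrite Rintegral_cst// mul0r.
    by apply: eq_Rint => p _; rewrite linear0 mulr0.
  - move=> a X Y bX bY XE YE.
    transitivity (L (fun p => a *: ((\1_T p : R) *: X p) + (\1_T p : R) *: Y p)).
      congr L; apply: functional_extensionality_dep => p.
      by rewrite scalerDr !scalerA mulrC.
    rewrite L_lin; [|exact: bT..].
    rewrite XE YE -RintZ//; last exact: bf.
    rewrite -RintD//; [|exact/bounded_measurableZ/bf|exact: bf].
    by apply: eq_Rint => p _; rewrite linearP mulrDr mulrCA.
  - move=> Y_ Y C bY_ YE bY YC Yl.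
    have h1 : L (fun p => (\1_T p : R) *: Y_ n p) @[n --> \oo] -->
        L (fun p => (\1_T p : R) *: Y p).
      apply: (L_lim (C := `|C|)).
      + by move=> n; exact: bT.
      + exact: bT.
      + move=> n p Op; rewrite tangent_normZ indicE.
        case: (_ \in _); last by rewrite normr0 mul0r.
        by rewrite normr1 mul1r (le_trans (YC n p Op))// ler_norm.
      + move=> p Op; rewrite indicE; case: (_ \in _).
          by under eq_fun do rewrite !scale1r; exact: Yl.
        by under eq_fun do rewrite !scale0r subr0 tangent_norm0; exact: cvg_cst.
    have h2 : \int[mu]_(p in Omega) (\1_T p * glued B c h p (Y_ n p)) @[n --> \oo] -->
        \int[mu]_(p in Omega) (\1_T p * glued B c h p (Y p)).
      apply: (Rint_cvg mO (C := `|N| * `|C|)).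
      + by move=> n; exact: mf.
      + exact: bf.
      + by move=> n p Op; apply: le => //; exact: YC.
      + move=> p Op; apply: cvgM; first exact: cvg_cst.
        apply/cvgrPdist_le => e e0.
        pose s := glued B c h p.
        have s1 : 0 < cotangent_norm g s + 1.
          by rewrite ltr_wpDl// cotangent_normE tangent_norm_ge0.
        have /cvgrPdist_le/(_ _ (divr_gt0 e0 s1)) := Yl p Op.
        apply: filterS => n; rewrite sub0r normrN ger0_norm ?tangent_norm_ge0//.
        rewrite ler_pdivlMr// => H; rewrite -linearB/= -(sharpE g).
        rewrite (le_trans (normr_riem _ _ _))// (le_trans _ H)// mulrC.
        by rewrite ler_wpM2l ?tangent_norm_ge0// -cotangent_normE lerDl.
    have E : (fun n => L (fun p => (\1_T p : R) *: Y_ n p)) =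
       (fun n => \int[mu]_(p in Omega) (\1_T p * glued B c h p (Y_ n p))).
      by apply/funext => n; exact: YE.
    by rewrite E in h1; exact: (cvg_unique _ h1 h2).
move=> n k A mA AP.
transitivity (L (cut_frame c n k (T `&` A))).
  congr L; apply: functional_extensionality_dep => p.
  by rewrite /cut_frame scalerA indicI.
have mTA : measurable (T `&` A : set (borel M)) by exact: measurableI.
rewrite hP//; last by move=> p [_ /AP].
transitivity (\int[mu]_(p in Omega `&` (T `&` A)) h n k p).
  by congr Rintegral; apply/esym/setIidr => p [/TO].
rewrite Rintegral_mkcondr; apply: eq_Rint => p Op.
rewrite /patch in_setI /cut_frame linearZ/= !indicE.
case: (p \in T); last by rewrite mul0r.
have [/set_mem/AP pA|_] := boolP (p \in A); last by rewrite mul0r mulr0.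
by rewrite !mul1r (glued_frame cB).
Qed.

End pieces.

(** Riesz representation: a density of norm larger than 1 on a set of positive
    measure would, tested against its own direction, violate the domination. *)
Lemma functional_density : exists s : covector_field M, [/\
  borel_covector_field Omega s,
  (forall p, Omega p -> cotangent_norm g (s p) <= 1) &
  forall Y, bbf Y -> L Y = \int[mu]_(p in Omega) s p (Y p)].
Proof.
have [B [c [bB cB]]] := chart_base oO.
have [h [mh hP]] := component_densities bB cB.
pose s := glued B c h.
have bs : borel_covector_field Omega s by exact: borel_glued mh.
pose a p := cotangent_norm g (s p).
have a0 p : 0 <= a p by rewrite /a cotangent_normE tangent_norm_ge0.
have ma : measurable_fun (Omega : set (borel M)) (a : borel M -> R).
  exact: measurable_cotangent_norm.
pose T (N : R) := Omega `&` [set p | a p <= N].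
have mT N : measurable (T N : set (borel M)).
  by have := ma mO _ (measurable_itv `]-oo, N]); congr measurable.
have LT N Y : bbf Y -> L (fun p => (\1_(T N) p : R) *: Y p) =
    \int[mu]_(p in Omega) (\1_(T N) p * s p (Y p)).
  exact: (functional_bounded_density bB cB mh hP (mT N) (fun p => @proj1 _ _)
    (fun p => @proj2 _ _)).
pose E N := T N `\` T 1.
have mE N : measurable (E N : set (borel M)) by exact: measurableD.
have bI (A : set (borel M)) : measurable A -> bm (\1_A : borel M -> R).
  exact: bounded_measurable_indic.
(* Testing with the direction of [s] on [E N] bounds the integral of [a] over
   [E N] by the measure of [E N], although [a] exceeds 1 there. *)
have muE N : mu (E N) = 0%E.
  pose U : vector_field M := fun p => (\1_(E N) p : R) *: ((a p)^-1 *: sharp g (s p)).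
  have U1 p : tangent_norm g (U p) <= \1_(E N) p.
    rewrite /U !tangent_normZ -cotangent_normE -/(a p) normfV (ger0_norm (a0 p)).
    rewrite indicE; case: (_ \in _); last by rewrite normr0 mul0r.
    rewrite normr1 mul1r; have [->|ap] := eqVneq (a p) 0; first by rewrite mulr0.
    by rewrite mulVf.
  have bU : bbf U.
    split; last first.
      by exists 1 => p _; rewrite (le_trans (U1 p))// indicE; case: (_ \in _).
    apply: borel_fieldZ => //.
    apply: borel_fieldZ => //; last exact: borel_field_sharp.
    by apply: (measurableT_comp (f := (fun x : R => x^-1))); first exact: measurable_inv_real.
  have sU p : s p (U p) = \1_(E N) p * a p.
    rewrite /U !linearZ/= -[s p (sharp g (s p))](sharpE g) -tangent_norm_sqr.
    rewrite -cotangent_normE -/(a p); congr (_ * _).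
    by have [->|ap] := eqVneq (a p) 0; [rewrite expr2 !mulr0|rewrite expr2 mulKf].
  pose f (p : borel M) := \1_(E N) p * a p - \1_(E N) p.
  have fE p : f p = \1_(E N) p * (a p - 1) by rewrite /f mulrBr mulr1.
  have ba : bm (fun p : borel M => \1_(E N) p * a p).
    split; first by apply: measurable_funM => //; exact: (bI _ (mE N)).1.
    exists `|N| => p Op; rewrite indicE; have [/set_mem[[_ aN] _]|_] := boolP (p \in _).
      by rewrite mul1r ger0_norm// (le_trans aN)// ler_norm.
    by rewrite mul0r normr0.
  have bf : bm f by apply: bounded_measurableB => //; exact: bI.
  have a1 p : Omega p -> E N p -> 1 < a p.
    by move=> Op [_ nT]; rewrite ltNge; apply/negP => ap; apply: nT.
  refine (@Rint_eq0_measure0 _ (borel M) R Omega (E N) f mu mO bf _ _ (mE N) _ _).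
  - move=> p Op; rewrite fE indicE; have [/set_mem Ep|_] := boolP (p \in _).
      by rewrite mul1r subr_ge0 ltW// a1.
    by rewrite mul0r.
  - rewrite RintB//; last exact: bI.
    rewrite subr_le0.
    have -> : \int[mu]_(p in Omega) (\1_(E N) p * a p) =
        L (fun p => (\1_(T N) p : R) *: U p).
      rewrite LT//; apply: eq_Rint => p Op; rewrite sU mulrA; congr (_ * _).
      rewrite !indicE; have [/set_mem Ep|_] := boolP (p \in E N); last by rewrite mulr0.
      by rewrite (mem_set Ep.1) mulr1.
    have bTU : bbf (fun p => (\1_(T N) p : R) *: U p) by exact: bounded_borel_field_indic.
    rewrite (le_trans (ler_norm _))// (le_trans (L_le bTU))//.
    apply: le_Rint => //; [exact: (bounded_measurable_tangent_norm oO)|exact: bI|].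
    move=> p _; rewrite tangent_normZ indicE; case: (_ \in T N).
      by rewrite normr1 mul1r.
    by rewrite normr0 mul0r indicE.
  - by move=> p [[]].
  - move=> p Ep; rewrite fE indicE mem_set// mul1r gt_eqF// subr_gt0 a1//.
    by case: Ep => -[].
(* The cut-offs of [Y] to [T n] converge to [Y], and differ from the cut-off to
   [T 1] only on the null set [E n]. *)
have LT1 Y : bbf Y -> L Y = L (fun p => (\1_(T 1) p : R) *: Y p).
  move=> bY; have bT N : bbf (fun p => (\1_(T N) p : R) *: Y p).
    exact: bounded_borel_field_indic.
  have [C CP] := bY.2.
  have : L (fun p => (\1_(T n%:R) p : R) *: Y p) @[n --> \oo] --> L Y.
    apply: (L_lim (C := C)) => //.
      move=> n p Op; rewrite tangent_normZ indicE; case: (_ \in _).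
        by rewrite normr1 mul1r CP.
      by rewrite normr0 mul0r (le_trans _ (CP p Op))// tangent_norm_ge0.
    move=> p Op; apply: cvg_near_cst; near=> n; rewrite indicE mem_set.
      by rewrite scale1r subrr tangent_norm0.
    by split=> //=; near: n; exact: nbhs_infty_ger.
  have LTn (n : nat) : (0 < n)%N -> L (fun p => (\1_(T n%:R) p : R) *: Y p) =
      L (fun p => (\1_(T 1) p : R) *: Y p).
    move=> n0; apply/eqP; rewrite -subr_eq0 -normr_le0.
    rewrite (le_trans (L_dist (bT _) (bT _)))//.
    apply: (@le_trans _ _ (\int[mu]_(p in Omega) (`|C| * \1_(E n%:R) p))).
      apply: le_Rint => //.
      - exact: (bounded_measurable_dist oO).
      - by apply: bounded_measurableZ; exact: bI.
      move=> p Op; rewrite -scalerBl tangent_normZ.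
      have n1 : 1 <= n%:R :> R by rewrite ler1n.
      have -> : (\1_(T n%:R) p - \1_(T 1) p : R) = \1_(E n%:R) p.
        rewrite !indicE /E in_setD; have [/set_mem Tp|_] := boolP (p \in T 1).
          by rewrite mem_set ?subrr//; case: Tp => ? /= ap; split=> //=; exact: le_trans n1.
        by rewrite subr0 andbT.
      rewrite ger0_norm; last by rewrite indicE.
      by rewrite mulrC ler_wpM2r// ?indicE// (le_trans (CP p Op))// ler_norm.
    rewrite RintZ; [|exact: mO|exact: bI].
    rewrite Rint_indic// setIidl; last by move=> p [[]].
    by rewrite [X in fine X](_ : _ = 0%E)// mulr0.
  move=> h1; apply: (cvg_unique _ h1); first exact: Rhausdorff.
  by apply: cvg_near_cst; exists 1%N => // n /= /LTn ->.
pose w n k (p : borel M) := \1_(T 1) p * h n k p.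
have ws p v : glued B c w p v = \1_(T 1) p * s p v.
  rewrite /s /glued /covector_of/= /covector_fun mulr_sumr.
  by apply: eq_bigr => k _; rewrite /w mulrA.
exists (glued B c w); split.
- apply: borel_glued => // n k; apply: measurable_funM; last exact: mh.
  exact: measurable_indic.
- move=> p Op; have [Tp|nT] := pselect (T 1 p).
    have -> : cotangent_norm g (glued B c w p) = a p; last by case: Tp.
    rewrite /a /cotangent_norm; congr sup; apply: eq_imagel => v _.
    by rewrite ws indicE mem_set// mul1r.
  rewrite cotangent_normE; suff -> : tangent_norm g (sharp g (glued B c w p)) = 0 by [].
  apply/eqP; rewrite -sqrf_eq0 tangent_norm_sqr sharpE ws indicE memNset//.
  by rewrite mul0r.
- move=> Y bY; rewrite LT1// LT//; apply: eq_Rint => p _; exact/esym/ws.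
Unshelve. all: by end_near. Qed.

End representation.

(** * Weak-star compactness *)

Lemma cvgn_approx (R : realType) (u : nat -> R) :
  (forall e : R, 0 < e -> exists v : nat -> R, cvgn v /\
     \forall n \near \oo, `|u n - v n| <= e) -> cvgn u.
Proof.
move=> H; apply/cauchy_cvgP/cauchy_exP => e e0.
have e2 : 0 < e / 2 by rewrite divr_gt0.
have [v [cv uv]] := H _ e2; exists (limn v).
have /cvgrPdist_lt/(_ _ e2) vl := cv.
apply: filterS (filterI uv vl) => n [un vn].
rewrite /ball/= -(subrKA (v n)) (le_lt_trans (ler_normD _ _))//.
by rewrite (splitr e) ltr_leD// distrC.
Qed.

Section compactness.
Variables (R : realType) (m : nat) (M : oriented_manifold R m).
Variables (g : riemannian_metric M) (Omega : set M).
Hypothesis oO : open Omega.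
Implicit Types (p : M) (X Y : vector_field M).
Local Notation bbf := (bounded_borel_field g Omega).
Local Notation bm := (bounded_measurable (Omega : set (borel M))).
Local Notation tv nu :=
  (tv_measure oO nu : {finite_measure set (borel M) -> \bar R}).

Let mO : measurable (Omega : set (borel M)). Proof. exact: borel_open. Qed.

Section pairing_limit.
Variables (B : nat -> set M) (c : nat -> chart_index M).
Hypotheses (bB : compact_base Omega B)
  (cB : forall n, closure (B n) `<=` chart_dom (atlas (c n))).
Variables (mu : {finite_measure set (borel M) -> \bar R}).
Variable nu_ : nat -> covector_measure g Omega.
Hypothesis nu_mu : forall X (e : R), C0_field g Omega X -> 0 < e ->
  \forall n \near \oo, \int[tv (nu_ n)]_(p in Omega) tangent_norm g (X p) <=
    \int[mu]_(p in Omega) tangent_norm g (X p) + e.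
Hypothesis nu_bump : forall n k s l,
  cvgn (fun j => pairing (nu_ j) (bump_field bB cB n k s l)).

Let C0b X : C0_field g Omega X -> bbf X. Proof. exact: C0_bounded_borel. Qed.

Let near_dist X Y (e : R) : C0_field g Omega X -> C0_field g Omega Y -> 0 < e ->
  \forall n \near \oo, `|pairing (nu_ n) X - pairing (nu_ n) Y| <=
    field_dist g Omega mu X Y + e.
Proof.
move=> CX CY e0; have CZ := C0_fieldB CX CY.
apply: filterS (nu_mu CZ e0) => n; apply: le_trans.
exact: (pairing_dist oO (nu_ n) (C0b CX) (C0b CY)).
Qed.

Let pairing_cvgn X : C0_field g Omega X -> cvgn (fun n => pairing (nu_ n) X).
Proof.
move=> CX; pose Q Y := C0_field g Omega Y /\ cvgn (fun n => pairing (nu_ n) Y).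
have cl : field_class g Omega (fun Y => forall e : R, 0 < e ->
    exists X, Q X /\ field_dist g Omega mu Y X <= e).
  apply: (field_class_closure oO).
  - by move=> Y [/C0b].
  - split; first exact: C0_field0.
    have -> : (fun n => pairing (nu_ n) (fun=> 0 : tangent M _)) = (fun=> 0).
      apply/funext => n; have b0 := @bounded_borel_field0 _ _ _ g Omega.
      have := pairing_dist oO (nu_ n) b0 b0.
      rewrite (pairingE oO); transitivity (\int[tv (nu_ n)]_(p in Omega) (0 : R)).
        by apply: eq_Rint => p _; exact: riem0r.
      by rewrite Rintegral_cst// mul0r.
    exact: is_cvg_cst.
  - move=> a Y Z [CY cY] [CZ cZ]; split.
      by apply: C0_fieldD => //; apply: C0_fieldZ => //; exact: Cb_function_cst.
    have -> : (fun n => pairing (nu_ n) (fun p => a *: Y p + Z p)) =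
        (fun n => a * pairing (nu_ n) Y + pairing (nu_ n) Z).
      by apply/funext => n; apply: (pairing_lin oO); exact: C0b.
    by apply: is_cvgD => //; apply: is_cvgM => //; exact: is_cvg_cst.
have clX : forall e : R, 0 < e -> exists X', Q X' /\ field_dist g Omega mu X X' <= e.
  refine (field_class_bumps (bB := bB) (cB := cB) oO cl _ (C0b CX)).
  move=> n k s l e e0; exists (bump_field bB cB n k s l); rewrite field_distxx//.
  by split; [split; [exact: C0_bump_field|exact: nu_bump]|exact: ltW].
apply: cvgn_approx => e e0; have e2 : 0 < e / 2 by rewrite divr_gt0.
have [X' [[CX' cX'] dX]] := clX _ e2.
exists (fun n => pairing (nu_ n) X'); split=> //.
apply: filterS (near_dist CX CX' e2) => n /le_trans; apply.
by rewrite [leRHS]splitr lerD2r.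
Qed.

(** The bounds [nu_mu] make the pairings Lipschitz for the L1 distance of [mu], up
    to a vanishing error.  Convergence thus passes from the bump fields to their
    L1 closure, and the limit functional has a density of norm at most 1. *)
Lemma pairing_limit : exists s : covector_field M, [/\
  borel_covector_field Omega s,
  (forall p, Omega p -> cotangent_norm g (s p) <= 1) &
  forall X, C0_field g Omega X ->
    pairing (nu_ n) X @[n --> \oo] --> \int[mu]_(p in Omega) s p (X p)].
Proof.
pose L X := limn (fun n => pairing (nu_ n) X).
have LP X : C0_field g Omega X -> pairing (nu_ n) X @[n --> \oo] --> L X.
  by move=> /pairing_cvgn.
have [||L' [lin dist L'L]] := @extend_functional _ _ _ g Omega oO mu L.
- move=> a X Y CX CY.
  have CZ : C0_field g Omega (fun p => a *: X p + Y p).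
    by apply: C0_fieldD => //; apply: C0_fieldZ => //; exact: Cb_function_cst.
  apply: (cvg_unique (@Rhausdorff R) (LP _ CZ)).
  have -> : (fun n => pairing (nu_ n) (fun p => a *: X p + Y p)) =
      (fun n => a * pairing (nu_ n) X + pairing (nu_ n) Y).
    by apply/funext => n; apply: (pairing_lin oO); exact: C0b.
  by apply: cvgD; [apply: cvgM; [exact: cvg_cst|exact: LP]|exact: LP].
- move=> X Y CX CY; apply/ler_addgt0Pr => e e0.
  have h : `|pairing (nu_ n) X - pairing (nu_ n) Y| @[n --> \oo] --> `|L X - L Y|.
    by apply: cvg_norm; apply: cvgB; exact: LP.
  by apply: (cvgr_to_le h); exact: near_dist.
have [s [bs s1 sL]] := functional_density oO lin dist.
exists s; split=> // X CX; rewrite -sL; last exact: C0b.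
by rewrite L'L//; exact: LP.
Qed.

End pairing_limit.

(** The total variations have a vague limit point [mu]; along a further
    subsequence the pairings with the countably many bump fields converge, and
    the limit functional is dominated by [mu]. *)
Lemma weak_star_compactness (nu_ : nat -> covector_measure g Omega) :
  (ereal_sup (range (fun n => tot_var (nu_ n) Omega)) < +oo)%E ->
  exists phi : nat -> nat, {homo phi : a b / (a < b)%N} /\
  exists nu : covector_measure g Omega, weak_star_cvg (fun n => nu_ (phi n)) nu.
Proof.
move=> bounded; have [B [c [bB cB]]] := chart_base oO.
have tvE n : (fine (tv (nu_ n) Omega))%:E = tot_var (nu_ n) Omega.
  by apply: fineK; exact: fin_num_measure.
have [C tvC] : exists C, forall n, fine (tv (nu_ n) Omega) <= C.
  exists (fine (ereal_sup (range (fun n => tot_var (nu_ n) Omega)))) => n.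
  have ub k : (tot_var (nu_ k) Omega <=
      ereal_sup (range (fun n => tot_var (nu_ n) Omega)))%E.
    by apply: ereal_sup_ubound; exists k.
  rewrite -lee_fin tvE fineK ?ub// fin_numE; apply/andP; split; last by rewrite lt_eqF.
  by rewrite gt_eqF// (lt_le_trans _ (ub 0%N))// -tvE ltNyr.
have [phi1 [phi1_lt [mu muP]]] := vague_compactness (carrier_hausdorff (o := M)) oO bB tvC.
pose u (i : nat * 'I_m * seq nat * nat) n :=
  pairing (nu_ (phi1 n)) (bump_field bB cB i.1.1.1 i.1.1.2 i.1.2 i.2).
have bu i : exists D : R, forall n, `|u i n| <= D.
  case: i => -[[n k] s] l.
  set X := bump_field bB cB n k s l.
  have bX : bbf X by apply: C0_bounded_borel => //; exact: C0_bump_field.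
  have [K KP] := bX.2; exists (`|K| * C) => j.
  rewrite /u -/X (pairingE oO).
  have bp := bounded_measurable_pairing oO (nu_ (phi1 j)) bX.
  rewrite (le_trans (normr_Rint mO _ bp))//.
  apply: (@le_trans _ _ (\int[tv (nu_ (phi1 j))]_(p in Omega) `|K|)).
    apply: le_Rint => //; [exact: bounded_measurable_norm|exact: bounded_measurable_cst|].
    move=> p Op; rewrite (le_trans (normr_riem _ _ _))// -[leRHS]mul1r.
    rewrite ler_pM ?tangent_norm_ge0 ?unit_field_le1//.
    by rewrite (le_trans (KP p Op))// ler_norm.
  by rewrite Rintegral_cst// ler_wpM2l// tvC.
have [D DP] := choice bu.
have [phi2 [phi2_lt uP]] := diagonal_subsequence DP.
have phi2_ge n : (n <= phi2 n)%N.
  by elim: n => // n /leq_ltn_trans; apply; exact: phi2_lt.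
exists (phi1 \o phi2); split; first by move=> a b ab; apply: phi1_lt; exact: phi2_lt.
have [|n k s l|s [bs s1 sP]] := @pairing_limit B c bB cB mu (fun n => nu_ (phi1 (phi2 n))).
- move=> X e CX e0; have bX := C0_bounded_borel oO CX.
  have [N _ NP] : \forall n \near \oo,
      \int[tv (nu_ (phi1 n))]_(p in Omega) tangent_norm g (X p) <=
      \int[mu]_(p in Omega) tangent_norm g (X p) + e.
    apply: (@Rint_limsup_le _ (borel M) R Omega mO (fun n => tv (nu_ (phi1 n))) mu
      (fun p => tangent_norm g (X p)) C) => //.
    - exact: (bounded_measurable_tangent_norm oO).
    - by move=> p _; exact: tangent_norm_ge0.
    - move=> t d t0 d0; apply: muP => //; exact: compact_superlevel.
  by exists N => // n /= Nn; apply: NP; rewrite /= (leq_trans Nn).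
- exact: (uP (n, k, s, l)).
have bd : exists K : R, forall p, Omega p -> cotangent_norm g (s p) <= K by exists 1.
exists (CovectorMeasure mu bs bd) => X CX.
by rewrite (pairing_density oO)//; [exact: sP|exact: C0_bounded_borel].
Qed.

End compactness.

Theorem lemma3p9 (R : realType) (m : nat) (M : oriented_manifold R m)
    (g : riemannian_metric M) (Omega : set M) (Omega_open : open Omega)
    (nu_ : nat -> covector_measure g Omega) :
  (* (i) *)
  ((forall nu nu' : covector_measure g Omega,
      weak_star_cvg nu_ nu -> weak_star_cvg nu_ nu' -> cm_equiv nu nu') /\
   (forall nu nu' : covector_measure g Omega,
      weak_cvg nu_ nu -> weak_cvg nu_ nu' -> cm_equiv nu nu')) /\
  (* (ii) *)
  ((ereal_sup (range (fun n => tot_var (nu_ n) Omega)) < +oo)%E ->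
   exists phi : nat -> nat, {homo phi : a b / (a < b)%N} /\
   exists nu : covector_measure g Omega,
     weak_star_cvg (fun n => nu_ (phi n)) nu) /\
  (* (iii) *)
  (forall nu : covector_measure g Omega, weak_star_cvg nu_ nu ->
     (forall U : set M, open U -> U `<=` Omega ->
        (tot_var nu U <= limn_einf (fun n => tot_var (nu_ n) U))%E) /\
     ((limn_esup (fun n => tot_var (nu_ n) Omega) <= tot_var nu Omega)%E ->
        weak_cvg_measure Omega (fun n => tot_var (nu_ n)) (tot_var nu))).
Proof.
split; [split|split].
- exact: weak_star_cvg_unique.
- move=> nu nu' /weak_weak_star_cvg h /weak_weak_star_cvg h'.
  exact: weak_star_cvg_unique Omega_open _ _ _ h h'.
- exact: weak_star_compactness.
- move=> nu h; split; first exact: tot_var_liminf.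
  exact: tot_var_weak_cvg.
Qed.
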